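(* Let $c = dd'e$ for some $d, d', e \in \mathbb{Z}_+$ with $d' \mid d$ and $(d,e)=1$, and let $f$ be the largest integer such that $f^2 \mid cd$. Let $\mathcal{I}, \mathcal{J} \subset \mathbb{Z}$ be intervals with $|\mathcal{I}|, |\mathcal{J}| \ll c^{1/2+o(1)}$. Then for any complex sequences $(\alpha_m)_{m \in \mathcal{I}}$, $(\beta_n)_{n \in \mathcal{J}}$ and any $a \in (\mathbb{Z}/c\mathbb{Z})^\times$, one has $$\sum_{\substack{m \in \mathcal{I},\ n \in \mathcal{J} \\ (m,n,c)=1}} \alpha_m \beta_n S(am,n;c) \ll \|\alpha\|\,\|\beta\|\, c^{1+o(1)} \left(\frac{f}{\min(c,d^2)}\right)^{\frac16}.$$
   Context: $\mathbb{Z}_+$ is the set of positive integers; $e(t) := \exp(2\pi i t)$ when $e(\cdot)$ is applied to a real argument. The Kloosterman sum is $S(m,n;c) := \sum_{x \in (\mathbb{Z}/c\mathbb{Z})^\times} e\left(\frac{mx+n\bar{x}}{c}\right)$, where $x\bar{x} \equiv 1 \pmod c$; it depends only on the residues of $m,n$ modulo $c$. $(\cdot,\cdot)$ and $(\cdot,\cdot,\cdot)$ denote greatest common divisors. An interval in $\mathbb{Z}$ is a finite set of consecutive integers, and $|\mathcal{I}|$ is its cardinality. $\|\alpha\| := (\sum_m |\alpha_m|^2)^{1/2}$ and similarly for $\beta$. Asymptotic conventions: $f \ll g$ means $|f| \le K g$ for an absolute constant $K$. A factor $c^{o(1)}$ stands for $c^{\eta(c)}$ with $\eta$ bounded and $\eta(c)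 \to 0$ as $c \to \infty$; a conclusion $X \ll c^{o(1)} Y$ is equivalent to: for every $\varepsilon > 0$ there is a constant $K_\varepsilon$ with $|X| \le K_\varepsilon c^{\varepsilon} Y$, uniformly in all parameters and sequences. A hypothesis $|\mathcal{I}|,|\mathcal{J}| \ll c^{1/2+o(1)}$ means that a constant $A$ and a bounded function $\eta_0$ with $\eta_0(c) \to 0$ as $c \to \infty$ are fixed, and $|\mathcal{I}|,|\mathcal{J}| \le A c^{1/2+\eta_0(c)}$; constants in the conclusion may then also depend on $A$ and $\eta_0$. *)

(* Defs.v *)
From HB Require Import structures.
From mathcomp Require Import all_boot all_order all_algebra.
From mathcomp Require Import finmap.
From mathcomp Require Import all_classical all_reals all_analysis.
From mathcomp Require Import complex.

Set Implicit Arguments.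
Unset Strict Implicit.
Unset Printing Implicit Defensive.

Import Order.TTheory GRing.Theory Num.Theory.
Import numFieldNormedType.Exports.

Local Open Scope ring_scope.

(* exp(2 pi i t), by Euler's formula. *)
Definition e (R : realType) (t : R) : R[i] :=
  Complex (cos (2 * pi * t)) (sin (2 * pi * t)).

(* A Bezout coefficient; see modinvP. *)
Definition modinv (c x : nat) : int := (egcdz x c).1.

Lemma modinvP (c x : nat) :
  coprime x c -> (x%:Z * modinv c x = 1 %[mod c])%Z.
Proof.
rewrite /modinv => cop; case: egcdzP => u v /= uv _.
have xc1 : gcdz x c = 1.
  by rewrite /gcdz /= (eqP cop).
by rewrite -xc1 -uv mulrC addrC modzMDl.
Qed.

(* Indexing the units by representatives x < c, rather than by 'Z_c, also
   covers c = 1, where x = 0 is the only unit. *)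
Definition kloosterman (R : realType) (m n : int) (c : nat) : R[i] :=
  \sum_(x < c | coprime x c)
    e ((m * x%:Z + n * modinv c x)%:~R / c%:R : R).

(* Order-convex finite sets, i.e. finite sets of consecutive integers,
   including the empty one. *)
Definition int_interval (I : {fset int}) : Prop :=
  forall x y z : int, x \in I -> z \in I -> x <= y -> y <= z -> y \in I.

Definition seq_norm (R : realType) (I : {fset int}) (alpha : int -> R[i]) : R :=
  Num.sqrt (\sum_(m <- I) ComplexField.Normc.normc (alpha m) ^+ 2).

(* The exponents eta for which c^{eta(c)} counts as a factor c^{o(1)}. *)
Definition o1_exponent (R : realType) (eta : nat -> R) : Prop :=
  (exists B : R, forall c : nat, `|eta c| <= B) /\
  (eta @ \oo --> (0 : R))%classic.

Definition largest_square_divisor (f N : nat) : Prop :=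
  (f ^ 2 %| N)%N /\ (forall g : nat, (g ^ 2 %| N)%N -> (g <= f)%N).

(* Main.v *)
(* Sort the pairs by delta = gcd(m, c). Peeling the primes of delta off the
   Kloosterman sums reduces to the modulus c/delta and to m a unit; then
   S(am, n; c) sums e((rm + sn)/c) over rs = a, so the bilinear form is
   B = sum_z A(z) B'(a/z), where A, B' are the Fourier transforms of alpha, beta.
   As the intervals are short, A and B' may be replaced by averages over shifts
   z + t, t < T, with T of size about c^(1/2). Viewed on GL2(Z/c) as
   functions u, v of the first column, A and B' turn the shifted form into a matrix
   coefficient <u, M v> of a convolution operator M, supported on the products
   n(s) w n(-t) of unipotents and a Weyl element.

   Right translation by d lower unipotents commutes with M and turns u into nearly
   orthogonal functions invariant under a congruence subgroup of level d, so
   d |<u, M v>|^6 is at most about |v|^6 |u|^4 times a Hilbert-Schmidt norm of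
   M* M M* M M* M. This norm counts the w such that w^-1 g w lies in the subgroup,
   over words g of six steps; the first column of such a w is a zero mod c of a
   binary quadratic form attached to g. There are abnormally many zeros only if g
   is scalar modulo a large q dividing c, which costs the factor f, and such words
   are rare by divisor bounds. *)
Require Import Defs.
From HB Require Import structures.
From mathcomp Require Import all_classical all_reals all_analysis.
From mathcomp Require Import all_boot all_order all_algebra all_fingroup cyclic.
From mathcomp Require Import finmap.
From mathcomp Require Import complex.
From mathcomp Require Import zify ring lra.

Set Implicit Arguments.
Unset Strict Implicit.
Unset Printing Implicit Defensive.

Import Order.TTheory GRing.Theory Num.Theory.
Import numFieldNormedType.Exports.
Import ComplexField.Normc.

Local Open Scope ring_scope.

(** * Counting by fibers *)

(** The [d] translates sit at the points [(c / d) * j]. As [d] kills these points, an upper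
    triangular matrix that is scalar modulo [d] fixes each vector (1, y) up to a unit; this is the
    invariance. Near-orthogonality comes from Parseval applied to their distinct Möbius images,
    after rescaling each frequency by units. The rescaling needs alpha supported on units, and this
    is why gcd(m, c) has to be removed beforehand. The power 6 is that of M M* M, reached by
    log-convexity of the norms. Words that are scalar modulo q number at most about T^6 c^2 (c +
    q^2) / q^3, and a word of level q weighs q, so its share is proportional to c/q^2 + 1. The worst
    case is q = d, and (c + d^2) / (c d^2) is at most 2 / min(c, d^2). Every loss of size c^{o(1)},
    including c / phi(c), is measured by the single quantity [maxdiv c], so that the divisor bound
    is the only asymptotic input. Counts are natural numbers, so moduli are kept as factors on the
    smaller side (such as [N] below) instead of being divided out, which avoids rounding. *)

Lemma card_fibers (T : finType) (I : eqType) (A : {set T}) (k : T -> I)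
    (s : seq I) (N M : nat) :
  (forall x, x \in A -> k x \in s) ->
  (forall i, i \in s -> N * #|[set x in A | k x == i]| <= M)%N ->
  (N * #|A| <= size s * M)%N.
Proof.
elim: s A => [|i s IHs] A kA fibM.
  rewrite (_ : A = set0) ?cards0 ?muln0 //.
  by apply/setP => x; rewrite inE; apply/negP => /kA.
rewrite -(cardsID [set x | k x == i] A) mulnDr mulSn leq_add //.
  apply: leq_trans (fibM i (mem_head _ _)); rewrite leq_mul2l; apply/orP; right.
  by apply: subset_leq_card; apply/subsetP => x; rewrite !inE.
apply: IHs => [x|j js].
  rewrite !inE => /andP[xi /kA]; rewrite inE => /orP[/eqP xi'|//].
  by rewrite xi' eqxx in xi.
apply: leq_trans (fibM j _); last by rewrite inE js orbT.
rewrite leq_mul2l; apply/orP; right.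
by apply: subset_leq_card; apply/subsetP => x; rewrite !inE => /andP[/andP[_ ->]].
Qed.

Lemma card_fibers1 (T : finType) (I : eqType) (A : {set T}) (k : T -> I)
    (s : seq I) (M : nat) :
  (forall x, x \in A -> k x \in s) ->
  (forall i, i \in s -> #|[set x in A | k x == i]| <= M)%N ->
  (#|A| <= size s * M)%N.
Proof.
move=> kA fibM; rewrite -[X in (X <= _)%N]mul1n.
by apply: (card_fibers kA) => i /fibM; rewrite mul1n.
Qed.

Lemma card_key (T T' : finType) (A : {set T}) (S : {set T'}) (k : T -> T')
    (M : nat) :
  (forall x, x \in A -> k x \in S) ->
  (forall i, i \in S -> #|[set x in A | k x == i]| <= M)%N ->
  (#|A| <= #|S| * M)%N.
Proof.
move=> kA fibM; rewrite [#|S|]cardE.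
apply: (card_fibers1 (k := k)) => [x /kA|i]; rewrite mem_enum //.
exact: fibM.
Qed.

Lemma card_inj_seq (T : finType) (I : eqType) (A : {set T}) (k : T -> I)
    (s : seq I) :
  {in A &, injective k} -> (forall x, x \in A -> k x \in s) -> (#|A| <= size s)%N.
Proof.
move=> kI kA; rewrite cardE -(size_map k); apply: uniq_leq_size.
  by rewrite map_inj_in_uniq ?enum_uniq // => x y; rewrite !mem_enum; apply: kI.
by move=> z /mapP[x]; rewrite mem_enum => /kA xs ->.
Qed.

(** Quotients by [q] separate the points: two congruent values with the same quotient differ by less
    than [q], hence agree. *)
Lemma card_congr (T : finType) (A : {set T}) (f : T -> int) (q L : nat)
    (lo : int) :
  (0 < q)%N -> {in A &, injective f} ->
  (forall x, x \in A -> lo <= f x < lo + L%:Z) ->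
  {in A &, forall x y, (q%:Z %| f x - f y)%Z} ->
  (#|A| <= L %/ q + 1)%N.
Proof.
move=> q0 fI fL fq.
have -> : (L %/ q + 1 = size (iota 0 (L %/ q).+1))%N by rewrite size_iota addn1.
apply: (@card_inj_seq _ _ _ (fun x => `|f x - lo| %/ q)%N).
  move=> x y xA yA xy; apply: fI => //.
  have := fq _ _ xA yA; have := fL _ xA; have := fL _ yA.
  have := divn_eq `|f x - lo|%N q; have := divn_eq `|f y - lo|%N q.
  have := ltn_pmod `|f x - lo|%N q0; have := ltn_pmod `|f y - lo|%N q0.
  rewrite -xy; move: (_ %/ q)%N => u.
  move: (_ %% q)%N => r.
  move: (_ %% q)%N => s rq sq ey ex /andP[hy _] /andP[hx _] /dvdzP[k hk].

  have hrs : f x - f y = s%:Z - r%:Z by lia.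
  have k0 : k = 0 by nia.
  by move: hk; rewrite k0; lia.
move=> x /fL hx; rewrite mem_iota /= add0n ltnS.
apply: leq_div2r; lia.
Qed.

Lemma muln_congr_bound (q L : nat) : (q * (L %/ q + 1) <= L + q)%N.
Proof. by rewrite mulnDr muln1 leq_add2r mulnC leq_trunc_div. Qed.

(** A monotone majorant of the divisor function, so that one quantity serves for every integer up to
    [c] and passes from a divisor of [c] to [c]. *)
Definition maxdiv (c : nat) : nat := \max_(n < c.+1) size (divisors n).

Lemma maxdivP (c n : nat) : (n <= c)%N -> (size (divisors n) <= maxdiv c)%N.
Proof.
move=> nc; have nc' : (n < c.+1)%N by [].
by rewrite /maxdiv (bigD1 (Ordinal nc')) //= leq_maxl.
Qed.

Lemma maxdiv_mono (b c : nat) : (b <= c)%N -> (maxdiv b <= maxdiv c)%N.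
Proof.
move=> bc; apply/bigmax_leqP => i _; apply: maxdivP.
by rewrite (leq_trans _ bc) // -ltnS.
Qed.

Lemma maxdiv_gt0 (c : nat) : (0 < c)%N -> (0 < maxdiv c)%N.
Proof. by move=> c0; apply: leq_trans (@maxdivP c 1 c0). Qed.

Lemma totient_dvd_leq (m n : nat) : (0 < n)%N -> (m %| n)%N ->
  (totient m <= totient n)%N.
Proof.
move=> n0 /dvdnP[k nk]; rewrite {}nk in n0 *.
elim/ltn_ind: k n0 => k IHk n0.
have k0 : (0 < k)%N by move: n0; rewrite muln_gt0 => /andP[].
have m0 : (0 < m)%N by move: n0; rewrite muln_gt0 => /andP[].
have [k1|k1] := leqP k 1; first by rewrite (_ : k = 1%N) ?mul1n //; lia.
have pp := pdiv_prime k1; have pk := pdiv_dvd k.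
move: (pdiv k) pp pk => p pp /dvdnP[j kj].
have j0 : (0 < j)%N by move: k0; rewrite kj muln_gt0 => /andP[].
have jk : (j < k)%N by rewrite kj ltn_Pmulr // prime_gt1.
apply: leq_trans (IHk j jk _) _; first by rewrite muln_gt0 j0.
have -> : (k * m = p * (j * m))%N by rewrite kj; ring.
have jm0 : (0 < j * m)%N by rewrite muln_gt0 j0.
move: (j * m)%N jm0 => l l0.
have [s ps ->] := pfactor_coprime pp l0.
rewrite mulnCA -expnS !totient_coprime ?coprimeXr ?leq_mul2l //;
  rewrite 1?coprime_sym //.
apply/orP; right; case: (logn p l) => [|e].
  by rewrite expn0 (leq_trans (_ : totient 1 <= 1)%N) // totient_gt0 expn_gt0 prime_gt0.
rewrite !totient_pfactor //= leq_mul2l; apply/orP; right.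
by rewrite leq_exp2l // prime_gt1.
Qed.

(** The modulus is the sum of phi over its divisors, and phi is monotone under divisibility. This
    crude lower bound for phi costs only a divisor function. *)
Lemma leq_totient_maxdiv (c : nat) : (0 < c)%N -> (c <= totient c * maxdiv c)%N.
Proof.
move=> c0; rewrite -[X in (X <= _)%N](sum_totient_dvd c).
apply: (@leq_trans (\sum_(d < c.+1 | (d %| c)%N) totient c)%N).
  by apply: leq_sum => i ic; apply: totient_dvd_leq.
rewrite sum_nat_const mulnC leq_mul2l; apply/orP; right.
apply: leq_trans (maxdivP (leqnn c)).
rewrite -cardsE; apply: (@card_inj_seq _ _ _ val) => [x y _ _ /val_inj //|x].
by rewrite inE -dvdn_divisors.
Qed.

(** * Zeros of a quadratic form *)

(** Cancel g = gcd(X, q): the square of X / g then divides m (q / g) and is coprime to q / g, so it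
    divides m and X / g is at most f. *)
Lemma square_quotient (m q f X : nat) :
  (0 < m)%N -> (0 < q)%N ->
  (forall g : nat, (g ^ 2 %| m)%N -> (g <= f)%N) ->
  (X ^ 2 %| m * q)%N -> (X <= f * q)%N.
Proof.
move=> m0 q0 fmax Xmq.
have g0 : (0 < gcdn X q)%N by rewrite gcdn_gt0 q0 orbT.
have Xe : X = (X %/ gcdn X q * gcdn X q)%N by rewrite divnK // dvdn_gcdl.
have qe : q = (q %/ gcdn X q * gcdn X q)%N by rewrite divnK // dvdn_gcdr.
have cop : coprime (X %/ gcdn X q) (q %/ gcdn X q).
  move: g0; rewrite /coprime => g0; rewrite -(eqn_pmul2r g0) muln_gcdl -Xe -qe mul1n.
  by [].
move: (gcdn X q) (X %/ _)%N (q %/ _)%N g0 Xe qe cop => g X' q' g0 Xe qe cop.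
have X'f : (X' <= f)%N.
  apply: fmax; rewrite -(@Gauss_dvdl _ _ q'); last by rewrite coprimeXl.
  rewrite -(dvdn_pmul2r g0); apply: dvdn_trans (_ : X' ^ 2 * g * g %| _)%N.
    by rewrite dvdn_mulr.
  move: Xmq; rewrite Xe qe (_ : (X' * g) ^ 2 = X' ^ 2 * g * g)%N ?mulnA //.
  by rewrite -!mulnn; ring.
have q'0 : (0 < q')%N by move: q0; rewrite qe muln_gt0 => /andP[].
rewrite Xe qe mulnA leq_mul2r; apply/orP; right.
by apply: leq_trans X'f _; rewrite leq_pmulr.
Qed.

(* A solution (x, y) determines h = gcd (yE, c) and g = gcd (y, h/gcd(h, q));
   given these there are at most (2c/g)(2h) choices, and the integer h/g has a
   square dividing cq. *)
Lemma card_quadric (c d f E B : nat) (q := gcdn (gcdn E B) c) :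
  (0 < c)%N -> (d %| q)%N ->
  (forall g : nat, (g ^ 2 %| c * d)%N -> (g <= f)%N) ->
  (d * #|[set p : 'I_c * 'I_c | p.2 * (E * p.1) == p.2 * (B * p.2) %[mod c]]|
   <= maxdiv c ^ 2 * (4 * c * f * q))%N.
Proof.
move=> c0 dq fmax.
set A := [set p | _].
have q0 : (0 < q)%N by rewrite /q gcdn_gt0 c0 orbT.
have qc : (q %| c)%N by rewrite dvdn_gcdr.
have d0 : (0 < d)%N by apply: dvdn_gt0 dq.
have tc : (size (divisors c) <= maxdiv c)%N by apply: maxdivP.
pose h (y : nat) := gcdn (y * E) c.
pose h' (y : nat) := (h y %/ gcdn (h y) q)%N.
have hc y : (h y %| c)%N by apply: dvdn_gcdr.
have h0 y : (0 < h y)%N by apply: dvdn_gt0 (hc y).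
have h'h y : (h' y %| h y)%N by rewrite dvdn_div // dvdn_gcdl.
have h'0 y : (0 < h' y)%N by apply: dvdn_gt0 (h'h y).
pose g (y : nat) := gcdn y (h' y).
have g0 y : (0 < g y)%N by rewrite gcdn_gt0 h'0 orbT.
have keyP (p : 'I_c * 'I_c) : p \in A -> (h p.2 %| q * p.2 ^ 2)%N.
  rewrite inE => /eqP pA.
  have hB : (h p.2 %| B * p.2 ^ 2)%N.
    rewrite (_ : B * p.2 ^ 2 = p.2 * (B * p.2))%N; last by rewrite -mulnn; ring.
    rewrite /dvdn -(modn_dvdm _ (hc p.2)) -pA (modn_dvdm _ (hc p.2)).
    by rewrite -/(dvdn _ _) mulnA dvdn_mulr // dvdn_gcdl.
  have hE : (h p.2 %| E * p.2 ^ 2)%N.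
    rewrite (_ : E * p.2 ^ 2 = p.2 * E * p.2)%N; last by rewrite -mulnn; ring.
    by rewrite dvdn_mulr // dvdn_gcdl.
  by rewrite /q !muln_gcdl !dvdn_gcd hB hE dvdn_mulr.
rewrite -mulnn -mulnA; apply: leq_trans (leq_mul tc (leqnn _)).
apply: (card_fibers (k := fun p : 'I_c * 'I_c => h p.2)) => [p _|hv hvc].
  by rewrite -dvdn_divisors.
apply: leq_trans (leq_mul tc (leqnn _)).
apply: (card_fibers (k := fun p : 'I_c * 'I_c => g p.2)) => [p _|gv gvc].
  rewrite -dvdn_divisors //; apply: dvdn_trans (hc p.2).
  by apply: dvdn_trans (h'h _); rewrite dvdn_gcdr.
set S := [set x in _ | _].
have [->|[p0 p0S]] := set_0Vmem S; first by rewrite cards0 muln0.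
have [p0A hp0 gp0] : [/\ p0 \in A, h p0.2 = hv & g p0.2 = gv].
  by move: p0S; rewrite !inE => /andP[/andP[? /eqP ?] /eqP ?].
have gvh : (gv %| hv)%N.
  by rewrite -gp0 -hp0; apply: dvdn_trans (h'h _); rewrite dvdn_gcdr.
have hgf : (d * (hv %/ gv) <= f * q)%N.
  move: (keyP _ p0A) => hq.
  have h'y : (h' p0.2 %| p0.2 ^ 2)%N.
    have m0 : (0 < gcdn (h p0.2) q)%N by rewrite gcdn_gt0 h0.
    have cop : coprime (h' p0.2) (q %/ gcdn (h p0.2) q).
      rewrite /coprime -(eqn_pmul2r m0) muln_gcdl mul1n.
      by rewrite /h' !divnK ?dvdn_gcdl ?dvdn_gcdr.
    rewrite -(Gauss_dvdr _ cop) -(dvdn_pmul2r m0).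
    rewrite mulnAC !divnK ?dvdn_gcdl ?dvdn_gcdr //.
  have h'g : (h' p0.2 %| g p0.2 ^ 2)%N.
    rewrite -mulnn /g muln_gcdl !muln_gcdr !dvdn_gcd mulnn h'y.
    by rewrite dvdn_mull // !dvdn_mulr.
  pose k := (h' p0.2 %/ g p0.2)%N.
  have h'k : h' p0.2 = (k * g p0.2)%N by rewrite divnK // dvdn_gcdr.
  have kg : (k %| g p0.2)%N.
    by move: h'g; rewrite h'k -mulnn dvdn_pmul2r.
  have -> : (hv %/ gv = k * gcdn (h p0.2) q)%N.
    rewrite -hp0 -gp0 -[X in (X %/ _)%N](divnK (dvdn_gcdl (h p0.2) q)).
    by rewrite -/(h' _) h'k mulnAC mulnK.
  rewrite -[X in (_ <= f * X)%N](divnK dq) [X in (_ <= X)%N]mulnA mulnC leq_mul2r; apply/orP; right.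
  (* The square of [k * gcdn h q] divides c q: [k ^ 2] divides [h'], the product of [h'] and
     [gcdn h q] is [h], which divides c, and the second [gcdn h q] divides q. Splitting c q as (c
     d)(q / d) brings in [f] and gains the factor [d]. *)
  apply: (@square_quotient (c * d)) => //.
  - by rewrite muln_gt0 c0.
  - by rewrite divn_gt0 // dvdn_leq.
  rewrite -mulnA [(d * _)%N]mulnC divnK // expnMn.
  have -> : (gcdn (h p0.2) q ^ 2 = gcdn (h p0.2) q * gcdn (h p0.2) q)%N by rewrite mulnn.
  rewrite mulnA dvdn_mul ?dvdn_gcdr //.
  apply: dvdn_trans (hc p0.2).
  rewrite -{2}(divnK (dvdn_gcdl (h p0.2) q)) -/(h' _) dvdn_mul // h'k.
  by rewrite -mulnn dvdn_mul.
pose Y := [set y : 'I_c | gv %| y]%N.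
have cY : (#|Y| <= c %/ gv + 1)%N.
  apply: (@card_congr _ _ (fun y : 'I_c => (nat_of_ord y)%:Z) gv c 0).
  - by rewrite -gp0.
  - by move=> y z _ _ [] /val_inj.
  - by move=> y _ /=; have := ltn_ord y; lia.
  move=> y z; rewrite !inE => gy gz; apply: rpredB; exact: gy || exact: gz.
have gvc' : (gv %| c)%N by apply: dvdn_trans gvh _; rewrite -hp0.
have hvc' : (hv %| c)%N by rewrite -hp0.
have hv0 : (0 < hv)%N by rewrite -hp0.
have gv0 : (0 < gv)%N by rewrite -gp0.
have cS : (#|S| <= (c %/ gv + 1) * (hv + 1))%N.
  apply: leq_trans (leq_mul cY (leqnn _)).
  apply: (card_key (k := fun p : 'I_c * 'I_c => p.2)) => [p|y yY].
    by rewrite !inE => /andP[_ /eqP <-]; rewrite dvdn_gcdl.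
  have -> : (hv + 1 = c %/ (c %/ hv) + 1)%N by rewrite divnA // mulKn.
  apply: (@card_congr _ _ (fun p => (nat_of_ord p.1)%:Z) (c %/ hv) c 0).
  - by rewrite divn_gt0 // dvdn_leq.
  - move=> [x1 y1] [x2 y2]; rewrite !inE /= => /andP[_ /eqP->] /andP[_ /eqP->].
    by move=> [] /val_inj ->.
  - by move=> [[i ic] ?] _ /=; lia.
  move=> [x1 y1] [x2 y2]; rewrite !inE /=.
  move=> /andP[/andP[/andP[/eqP e1 /eqP hy] _] /eqP y1y].
  move=> /andP[/andP[/andP[/eqP e2 _] _] /eqP y2y].
  rewrite y1y y2y in e1 e2 hy.
  have e3 : (y * (E * x1) = y * (E * x2) %[mod c])%N by rewrite e1 e2.
  have : (c%:Z %| (y * E)%:Z * (x1%:Z - x2%:Z))%Z.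
    rewrite mulrBr -!PoszM -!mulnA -eqz_mod_dvd !modz_nat.
    by apply/eqP; congr Posz.
  have -> : c%:Z = (c %/ hv)%:Z * hv%:Z by rewrite -PoszM divnK.
  have -> : (y * E)%:Z = (y * E %/ hv)%:Z * hv%:Z.
    by rewrite -PoszM divnK // -hy dvdn_gcdl.
  rewrite mulrAC dvdz_mul2r; last by rewrite eqz_nat -lt0n hv0.
  rewrite Gauss_dvdzr // /coprimez /gcdz /= eqz_nat.
  rewrite -(eqn_pmul2r hv0) muln_gcdl !divnK //; last by rewrite -hy dvdn_gcdl.
  by rewrite mul1n gcdnC -/(h _) hy.
apply: (@leq_trans (d * ((2 * (c %/ gv)) * (2 * hv))))%N.
  rewrite leq_mul2l; apply/orP; right; apply: leq_trans cS _.
  have : (0 < c %/ gv)%N by rewrite divn_gt0 // dvdn_leq.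
  by move=> ?; apply: leq_mul; lia.
have -> : (d * (2 * (c %/ gv) * (2 * hv)) = 4 * c * (d * (hv %/ gv)))%N.
  rewrite -{1}(divnK gvh) -{2}(divnK gvc').
  by ring.
by rewrite -[X in (_ <= X)%N]mulnA leq_mul.
Qed.

(** * Counting in boxes *)

(** The box [-T, T) contains all differences of two shifts below T. *)
Definition bx (T : nat) (i : 'I_T.*2) : int := i%:Z - T%:Z.

Lemma bx_inj (T : nat) : injective (@bx T).
Proof. by move=> i j; rewrite /bx => ij; apply/val_inj => /=; lia. Qed.

Lemma bx_le (T : nat) (i : 'I_T.*2) : `|bx i| <= T%:Z.
Proof. by case: i => i hi; rewrite /bx /=; lia. Qed.

Definition bp (T : nat) (p : 'I_T.*2 * 'I_T.*2) : int := bx p.1 * bx p.2.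

Lemma bx_prod_le (T c : nat) (p : 'I_T.*2 * 'I_T.*2) : (T ^ 2 <= c)%N ->
  (absz (bp p) <= c)%N.
Proof.
move=> Tc; apply: leq_trans Tc; rewrite /bp abszM -mulnn.
by apply: leq_mul; rewrite -lez_nat abszE bx_le.
Qed.

Lemma card_box_factor (c T : nat) (n : int) : n != 0 -> (`|n|%N <= c)%N ->
  (#|[set p : 'I_T.*2 * 'I_T.*2 | bp p == n]| <= 2 * maxdiv c)%N.
Proof.
move=> n0 nc; apply: leq_trans (leq_mul (leqnn 2) (maxdivP nc)).
have -> : (2 * size (divisors `|n|) =
  size (map (pair true) (divisors `|n|) ++ map (pair false) (divisors `|n|)))%N.
  by rewrite size_cat !size_map mul2n addnn.
apply: (@card_inj_seq _ _ _ (fun p => (0 <= bx p.1, `|bx p.1|%N))).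
  move=> [x y] [x' y']; rewrite !inE /bp /= => /eqP xy /eqP xy' [sx ax].
  have xx : bx x = bx x' by lia.
  have x0 : bx x != 0 by apply: contra n0 => /eqP x0; rewrite -xy x0 mul0r.
  by rewrite (bx_inj xx); congr (_, _); apply/bx_inj/(mulfI x0); rewrite xy xx.
move=> [x y]; rewrite inE /bp /= => /eqP xy.
have xn : `|bx x|%N \in divisors `|n|.
  by rewrite -dvdn_divisors ?absz_gt0 // -xy abszM dvdn_mulr.
by rewrite mem_cat; case: (0 <= bx x); rewrite (map_f (pair _)) ?orbT.
Qed.

(** A nonzero product has few factorizations, and few integers of size at most [c] lie in the class.
    The product 0 is abnormal, with up to 4T pairs; its term keeps the indicator of [q] dividing
    [m], so that it can be discarded later. *)
Lemma card_box_class (c q T : nat) (m : int) :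
  (0 < c)%N -> (q %| c)%N -> (T ^ 2 <= c)%N ->
  (q * #|[set p : 'I_T.*2 * 'I_T.*2 | (q%:Z %| (bp p - m)%R)%Z]|
   <= 8 * c * maxdiv c + q * (4 * T) * (q%:Z %| m)%Z)%N.
Proof.
move=> c0 qc Tc; set A := [set p | _].
have q0 : (0 < q)%N by apply: dvdn_gt0 qc.
rewrite -(cardsID [set p | bp p == 0] A) mulnDr addnC leq_add //.
  pose V := [set j : 'I_(2 * c).+1 | (q%:Z %| (j%:Z - c%:Z) - m)%Z].
  pose s := [seq (val j)%:Z - c%:Z | j in V].
  apply: (@leq_trans (q * (size s * (2 * maxdiv c)))%N).
    rewrite leq_mul2l; apply/orP; right.
    apply: (card_fibers1 (k := fun p : 'I_T.*2 * 'I_T.*2 => bp p)).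
      move=> p; rewrite !inE => /andP[p0 pA].
      have pc := bx_prod_le p Tc.
      have jP : (absz (bp p + c%:Z)%R < (2 * c).+1)%N by lia.
      have jE : (Ordinal jP)%:Z - c%:Z = bp p by rewrite /=; lia.
      apply/imageP; exists (Ordinal jP) => //.
      by rewrite inE jE.
    move=> i /imageP[j jV ->].
    have [j0|j0] := eqVneq ((val j)%:Z - c%:Z) 0.
      rewrite (_ : [set _ in _ | _] = set0) ?cards0 //.
      apply/setP => p; rewrite !inE; apply/negP => /andP[/andP[h1 _] /eqP h2].
      by case/negP: h1; rewrite h2; apply/eqP.
    apply: leq_trans (card_box_factor T j0 _).
      by apply: subset_leq_card; apply/subsetP => p; rewrite !inE => /andP[].
    by have := ltn_ord j; move=> /=; lia.
  have cV : (#|V| <= (2 * c).+1 %/ q + 1)%N.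
    apply: (@card_congr _ _ (fun j : 'I_(2 * c).+1 => (nat_of_ord j)%:Z) q _ 0) => //.
    - by move=> x y _ _ [] /val_inj.
    - by move=> y _ /=; have := ltn_ord y; lia.
    move=> x y; rewrite !inE => hx hy.
    have -> : x%:Z - y%:Z = (x%:Z - c%:Z - m) - (y%:Z - c%:Z - m) by ring.
    exact: rpredB.
  rewrite size_map -cardE.
  have := muln_congr_bound q (2 * c).+1.
  have qlec : (q <= c)%N by apply: dvdn_leq.
  move=> h; apply: (@leq_trans ((q * ((2 * c).+1 %/ q + 1)) * (2 * maxdiv c)))%N.
    by rewrite !mulnA !leq_mul2r leq_mul2l cV !orbT.
  apply: (@leq_trans ((4 * c) * (2 * maxdiv c)))%N; last by lia.
  by rewrite leq_mul2r; apply/orP; right; lia.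
rewrite -mulnA leq_mul2l; apply/orP; right.
case qm : (q%:Z %| m)%Z; last first.
  rewrite muln0 leqn0 cards_eq0; apply/eqP/setP => p; rewrite !inE.
  by apply/negP => /andP[h /eqP p0]; rewrite p0 sub0r rpredN qm in h.
rewrite muln1 (_ : 4 * T = T.*2 + T.*2)%N; last by lia.
apply: (@leq_trans #|[set p : 'I_T.*2 * 'I_T.*2 | bx p.1 == 0] :|:
                     [set p : 'I_T.*2 * 'I_T.*2 | bx p.2 == 0]|).
  apply: subset_leq_card; apply/subsetP => p; rewrite !inE => /andP[_].
  by rewrite /bp mulf_eq0.
apply: leq_trans (leq_card_setU _ _) _; apply: leq_add.
  rewrite -[X in (_ <= X)%N](card_ord T.*2) -cardsT -[X in (_ <= X)%N]muln1.
  apply: (card_key (k := fun p : 'I_T.*2 * 'I_T.*2 => p.2)) => [//|i _].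
  apply/card_le1_eqP => -[x1 y1] [x2 y2]; rewrite !inE /=.
  move=> /andP[/eqP e1 /eqP->] /andP[/eqP e2 /eqP->].
  by rewrite (@bx_inj _ x1 x2) // e1 e2.
rewrite -[X in (_ <= X)%N](card_ord T.*2) -cardsT -[X in (_ <= X)%N]muln1.
apply: (card_key (k := fun p : 'I_T.*2 * 'I_T.*2 => p.1)) => [//|i _].
apply/card_le1_eqP => -[x1 y1] [x2 y2]; rewrite !inE /=.
move=> /andP[/eqP e1 /eqP->] /andP[/eqP e2 /eqP->].
by rewrite (@bx_inj _ y1 y2) // e1 e2.
Qed.

(** With g = gcd(l - 1, q), l is 1 modulo g and -1 modulo q / g. These moduli need not be coprime,
    but together they determine 2l modulo q; as 2l lies in an interval of length 2q, each g allows
    at most 3 values. *)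
Lemma card_sqrt1 (q : nat) : (0 < q)%N ->
  (#|[set l : 'I_q | (q%:Z %| (l%:Z ^+ 2 - 1)%R)%Z]| <= 3 * size (divisors q))%N.
Proof.
move=> q0; rewrite mulnC.
apply: (card_fibers1 (k := fun l : 'I_q => gcdn `|l%:Z - 1|%N q)) => [l _|g gq].
  by rewrite -dvdn_divisors // dvdn_gcdr.
have -> : 3%N = ((2 * q) %/ q + 1)%N by rewrite mulnK.
apply: (@card_congr _ _ (fun l : 'I_q => 2%:Z * l%:Z) q _ 0) => //.
- by move=> x y _ _ h; apply/val_inj => /=; lia.
- by move=> y _ /=; have := ltn_ord y; lia.
have gq' : (g %| q)%N by rewrite dvdn_divisors.
have g0 : (0 < g)%N by apply: dvdn_gt0 gq'.
have fibP (l : int) : (q%:Z %| l ^+ 2 - 1)%Z -> gcdn `|l - 1|%N q = g ->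
    (g%:Z %| l - 1)%Z /\ ((q %/ g)%:Z %| l + 1)%Z.
  move=> ql gl; have gl1 : (g%:Z %| l - 1)%Z.
    by rewrite dvdzE /= -gl dvdn_gcdl.
  split=> //; move: ql.
  have -> : l ^+ 2 - 1 = (l - 1) * (l + 1) by ring.
  rewrite -{1}(divnK gq') PoszM -{1}(divzK gl1) mulrAC dvdz_mul2r; last first.
    by rewrite eqz_nat -lt0n.
  have e1 : absz (l - 1) = (absz ((l - 1) %/ g%:Z)%Z * g)%N.
    by rewrite -{1}(divzK gl1) abszM.
  rewrite Gauss_dvdzr // coprimezE /coprime -(eqn_pmul2r g0) muln_gcdl mul1n.
  by rewrite -e1 /= divnK // gcdnC gl.
move=> x y; rewrite !inE => /andP[qx /eqP gx] /andP[qy /eqP gy].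
have [x1 x2] := fibP _ qx gx; have [y1 y2] := fibP _ qy gy.
have xg : (g%:Z %| x%:Z - y%:Z)%Z.
  have -> : x%:Z - y%:Z = (x%:Z - 1) - (y%:Z - 1) by ring.
  exact: rpredB.
have xg' : ((q %/ g)%:Z %| x%:Z - y%:Z)%Z.
  have -> : x%:Z - y%:Z = (x%:Z + 1) - (y%:Z + 1) by ring.
  exact: rpredB.
have -> : 2 * x%:Z - 2 * y%:Z = (x%:Z + 1) * (x%:Z - y%:Z) - (x%:Z - 1) * (x%:Z - y%:Z).
  by ring.
have -> : q%:Z = (q %/ g)%:Z * g%:Z by rewrite -PoszM divnK.
apply: rpredB; first exact: dvdz_mul.
by rewrite mulrC; apply: dvdz_mul.
Qed.

Lemma card_box_quadruples (c q k T : nat) (a l : int) :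
  (0 < c)%N -> (q %| c)%N -> (k %| q)%N -> (T ^ 2 <= c)%N ->
  coprimez a c%:Z -> (q%:Z %| l ^+ 2 - 1)%Z ->
  (k * q * #|[set s : ('I_T.*2 * 'I_T.*2) * ('I_T.*2 * 'I_T.*2) |
     [&& (k%:Z %| (a + bp s.1)%R)%Z,
         (k%:Z %| (a + bp s.2)%R)%Z &
         (q%:Z %| ((a + bp s.1) - l * (a + bp s.2))%R)%Z]]|
   <= 112 * c ^ 2 * maxdiv c ^ 2)%N.
Proof.
move=> c0 qc kq Tc ac ql; set Q := [set s | _].
set D := maxdiv c; have D0 : (0 < D)%N by apply: maxdiv_gt0.
have q0 : (0 < q)%N by apply: dvdn_gt0 qc.
have k0 : (0 < k)%N by apply: dvdn_gt0 kq.
(* Since l^2 is 1 modulo [q], the last congruence can be solved for the second product, which must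
   be [m p] modulo [q]. *)
pose m (p : 'I_T.*2 * 'I_T.*2) := l * (a + bp p) - a.
have fibP p p' : (p, p') \in Q -> (q%:Z %| bp p' - m p)%Z.
  rewrite inE /= => /and3P[_ _ h].
  set u := a + _ in h; set v := a + _ in h.
  have -> : bp p' - m p = - (l * (u - l * v)) - v * (l ^+ 2 - 1).
    by rewrite /m /u /v; ring.
  by rewrite rpredB ?rpredN ?dvdz_mull.
have fib p : (q * #|[set s in Q | s.1 == p]| <= 8 * c * D + q * (4 * T) * (q%:Z %| m p)%Z)%N.
  apply: leq_trans (card_box_class (m p) c0 qc Tc).
  rewrite leq_mul2l; apply/orP; right.
  rewrite -[X in (_ <= X)%N]muln1.
  apply: (card_key (k := fun s : ('I_T.*2 * 'I_T.*2) * ('I_T.*2 * 'I_T.*2) => s.2)).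
    by move=> [p1 p2]; rewrite inE /= => /andP[/fibP h /eqP <-]; rewrite inE.
  move=> i _; apply/card_le1_eqP => -[x1 y1] [x2 y2]; rewrite 2!inE /=.
  rewrite [in X in _ -> X -> _]inE [in X in _ -> X -> _]inE /=.
  by move=> /andP[/andP[_ /eqP->] /eqP->] /andP[/andP[_ /eqP->] /eqP->].
(* For k = 1 a vanishing second product forces the first pair into [P1], itself a residue class of
   box products, so the extra 4T is paid for few pairs only. *)
have [k1|k1] := leqP k 1.
  have {}k1 : k = 1%N by lia.
  pose P1 := [set p | (q%:Z %| m p)%Z].
  have cP1 : (q * #|P1| <= 8 * c * D + q * (4 * T))%N.
    have b1 := leq_b1 (q%:Z %| (l * a - a)%R)%Z.
    apply: (@leq_trans (8 * c * D + q * (4 * T) * (q%:Z %| (l * a - a)%R)%Z)); last first.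
      by rewrite leq_add2l -[X in (_ <= X)%N]muln1 leq_mul2l b1 orbT.
    apply: leq_trans (card_box_class _ c0 qc Tc); rewrite leq_mul2l.
    apply/orP; right; apply: subset_leq_card; apply/subsetP => p; rewrite !inE => h.
    have -> : bp p - (l * a - a) =
      l * m p - (a + bp p) * (l ^+ 2 - 1) by rewrite /m; ring.
    by rewrite rpredB ?dvdz_mull.
  have cT : (#|[set: 'I_T.*2 * 'I_T.*2]| <= 4 * c)%N.
    by rewrite cardsT card_prod card_ord; move: Tc; rewrite -mulnn; lia.
  have T1c : (T <= c)%N by apply: leq_trans Tc; rewrite -mulnn; nia.
  rewrite k1 mul1n -(cardsID [set s | s.1 \in P1] Q) mulnDr.
  have h1 : (q * #|Q :&: [set s | s.1 \in P1]| <= #|P1| * (8 * c * D + q * (4 * T)))%N.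
    rewrite [X in (_ <= X * _)%N]cardE.
    apply: (card_fibers (k := fun s : ('I_T.*2 * 'I_T.*2) * ('I_T.*2 * 'I_T.*2) => s.1)).
      by move=> s; rewrite inE => /andP[_]; rewrite in_set mem_enum.
    move=> p _; apply: leq_trans (leq_trans (fib p) _).
      rewrite leq_mul2l; apply/orP; right; apply: subset_leq_card.
      by apply/subsetP => s; rewrite in_set in_setI => /andP[/andP[h _] h']; rewrite in_set h h'.
    rewrite leq_add2l -[X in (_ <= X)%N]muln1 leq_mul2l; apply/orP; right.
    exact: leq_b1.
  have h2 : (q * #|Q :\: [set s | s.1 \in P1]| <= #|[set: 'I_T.*2 * 'I_T.*2]| * (8 * c * D))%N.
    rewrite [X in (_ <= X * _)%N]cardE.
    apply: (card_fibers (k := fun s : ('I_T.*2 * 'I_T.*2) * ('I_T.*2 * 'I_T.*2) => s.1)).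
      by move=> s _; rewrite mem_enum in_setT.
    move=> p _; case pP : (p \in P1).
      rewrite (_ : [set _ in _ | _] = set0) ?cards0 ?muln0 //.
      apply/setP => s; rewrite in_set in_set0 in_setD in_set.
      by apply/negP => /andP[/andP[/negP h _] /eqP sp]; rewrite sp pP in h.
    apply: leq_trans (leq_trans (fib p) _).
      rewrite leq_mul2l; apply/orP; right; apply: subset_leq_card.
      by apply/subsetP => s; rewrite in_set in_setD => /andP[/andP[_ h] h']; rewrite in_set h h'.
    by move: pP; rewrite inE => ->; rewrite muln0 addn0.
  have h3 : (#|P1| <= 4 * c)%N by apply: leq_trans (subset_leq_card _) cT; apply/subsetP.
  (* In units of c^2 D^2 the four terms are at most 32, 32, 16 and 32, using T^2 <= c and q <= c;
     their sum is 112. *)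
  apply: leq_trans (leq_add h1 h2) _.
  apply: (@leq_trans (4 * c * (8 * c * D) + 4 * T * (8 * c * D + q * (4 * T)) +
     4 * c * (8 * c * D))%N).
    apply: leq_add; last by rewrite leq_mul2r cT orbT.
    rewrite mulnDr leq_add ?leq_mul2r ?h3 ?orbT // mulnA.
    by rewrite mulnC leq_mul2l [(#|P1| * q)%N]mulnC cP1 orbT.
  have qlec : (q <= c)%N by apply: dvdn_leq.
  have t1 : (T * (c * D) <= c * c * (D * D))%N.
    by rewrite mulnA; apply: leq_mul; [apply: leq_mul|rewrite leq_pmulr].
  have t2 : (c * (c * D) <= c * c * (D * D))%N.
    by rewrite mulnA; apply: leq_mul; [apply: leq_mul|rewrite leq_pmulr].
  have t3 : (T * (q * T) <= c * c * (D * D))%N.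
    rewrite mulnCA mulnn -[X in (X <= _)%N]muln1; apply: leq_mul; last by rewrite muln_gt0 D0.
    exact: leq_mul.
  rewrite -!mulnn; lia.
pose P := [set p : 'I_T.*2 * 'I_T.*2 | (k%:Z %| a + bp p)%Z].
(* For k > 1 the unit [a] is not divisible by [k], which excludes zero products in both coordinates
   and removes the 4T terms. *)
have ka : (k%:Z %| a)%Z = false.
  apply/negP => h; move: ac; rewrite coprimezE /coprime => /eqP ac.
  have : (k %| gcdn `|a|%N c)%N by rewrite dvdn_gcd (dvdn_trans kq qc) andbT.
  by rewrite ac dvdn1; lia.
have cP : (k * #|P| <= 8 * c * D)%N.
  have := card_box_class (- a) c0 (dvdn_trans kq qc) Tc.
  rewrite rpredN ka muln0 addn0 => h; apply: leq_trans h; rewrite leq_mul2l.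
  apply/orP; right; apply: subset_leq_card; apply/subsetP => p; rewrite !inE opprK.
  by rewrite addrC.
have cQ : (q * #|Q| <= #|P| * (8 * c * D))%N.
  rewrite [X in (_ <= X * _)%N]cardE.
  apply: (card_fibers (k := fun s : ('I_T.*2 * 'I_T.*2) * ('I_T.*2 * 'I_T.*2) => s.1)).
    by move=> s; rewrite inE mem_enum inE => /and3P[].
  move=> p _; have [->|[s]] := set_0Vmem [set s in Q | s.1 == p].
    by rewrite cards0 muln0.
  rewrite inE => /andP[]; case: s => p1 p2 sQ /= /eqP p1p; rewrite {}p1p in sQ.
  apply: leq_trans (fib p) _; rewrite -[X in (_ <= X)%N]addn0 leq_add2l leqn0.
  case qm : (q%:Z %| m p)%Z; last by rewrite muln0.
  have kq' : (k%:Z %| q%:Z)%Z by [].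
  have h1 := dvdz_trans kq' (fibP _ _ sQ); have h2 := dvdz_trans kq' qm.
  move: sQ; rewrite inE /= => /and3P[_ h3 _].
  suff : (k%:Z %| a)%Z by rewrite ka.
  have -> : a = (a + bp p2) - (bp p2 - m p) - m p by ring.
  exact: rpredB (rpredB h3 h1) h2.
apply: (@leq_trans (k * #|P| * (8 * c * D))%N).
  by rewrite -mulnA -[X in (_ <= X)%N]mulnA leq_mul2l cQ orbT.
apply: (@leq_trans (8 * c * D * (8 * c * D)))%N; first by rewrite leq_mul2r cP orbT.
have -> : (8 * c * D * (8 * c * D) = 64 * (c ^ 2 * D ^ 2))%N by rewrite -!mulnn; ring.
by rewrite -mulnA leq_mul2r orbT.
Qed.

(* The entries of n(x1) l(z1) n(x2) l(z2) n(x3) l(z3), where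
   n(x) = [1 x; 0 1] and l(z) = [1 0; z 1]. *)
Definition word6 (A : comPzRingType) (x1 z1 x2 z2 x3 z3 : A) : A * A * A * A :=
  let p := 1 + x1 * z1 in let r := x1 + x2 + x1 * z1 * x2 in
  let s := z1 in let t := 1 + z1 * x2 in
  let p' := 1 + x3 * z3 in let r' := x3 in
  let s' := z2 + z3 + z2 * x3 * z3 in let t' := 1 + z2 * x3 in
  (p * p' + r * s', p * r' + r * t', s * p' + t * s', s * r' + t * t').

Definition scalar_mod (q : nat) (l : int) (g : int * int * int * int) : bool :=
  let: (g00, g01, g10, g11) := g in
  [&& (q%:Z %| g00 - l)%Z, (q%:Z %| g01)%Z, (q%:Z %| g10)%Z & (q%:Z %| g11 - l)%Z].

(** Split the word as P Q with three factors each, both of determinant 1. If P Q is l modulo [q],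
    then l^2 = 1 and P = l Q^-1; the last two conclusions compare the first rows, which involve only
    five of the six variables in a simple way. *)
Lemma scalar_mod_word6 (q : nat) (l x1 z1 x2 z2 x3 z3 : int) :
  scalar_mod q l (word6 x1 z1 x2 z2 x3 z3) ->
  [/\ (q%:Z %| l ^+ 2 - 1)%Z, (q%:Z %| (1 + x1 * z1) - l * (1 + z2 * x3))%Z &
      (q%:Z %| (x1 + x2 + x1 * z1 * x2) + l * x3)%Z].
Proof.
rewrite /scalar_mod /word6.
set p := 1 + x1 * z1; set r := x1 + x2 + _; set t := 1 + z1 * x2.
set p' := 1 + x3 * z3; set s' := z2 + z3 + _; set t' := 1 + z2 * x3.
have d1 : p * t - r * z1 = 1 by rewrite /p /t /r; ring.
have d2 : p' * t' - x3 * s' = 1 by rewrite /p' /t' /s'; ring.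
move: p r t p' s' t' d1 d2 => p r t p' s' t' d1 d2 /and4P[h1 h2 h3 h4].
split.
- have -> : l ^+ 2 - 1 = - (l * ((p * p' + r * s') - l) + (p * p' + r * s') * ((z1 * x3 + t * t') - l)
     - (p * x3 + r * t') * (z1 * p' + t * s'))
     + ((p * t - r * z1) * (p' * t' - x3 * s') - 1) by ring.
  rewrite d1 d2 mulr1 subrr addr0 rpredN.
  exact: rpredB (rpredD (dvdz_mull _ h1) (dvdz_mull _ h4)) (dvdz_mull _ h3).
- have -> : p - l * t' = ((p * p' + r * s') - l) * t' - s' * (p * x3 + r * t')
    - p * (p' * t' - x3 * s' - 1) by ring.
  rewrite d2 subrr mulr0 subr0.
  exact: rpredB (dvdz_mulr _ h1) (dvdz_mull _ h2).
have -> : r + l * x3 = p' * (p * x3 + r * t') - x3 * ((p * p' + r * s') - l)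
    - r * (p' * t' - x3 * s' - 1) by ring.
rewrite d2 subrr mulr0 subr0.
exact: rpredB (dvdz_mull _ h2) (dvdz_mull _ h1).
Qed.

(** The first column is affine in the last variable, with the second column of the product of the
    first five factors as coefficients. That product has determinant 1, so the column is unimodular
    and the variable can be recovered. *)
Lemma scalar_mod_word6_last (q : nat) (l x1 z1 x2 z2 x3 z3 w3 : int) :
  scalar_mod q l (word6 x1 z1 x2 z2 x3 z3) ->
  scalar_mod q l (word6 x1 z1 x2 z2 x3 w3) -> (q%:Z %| z3 - w3)%Z.
Proof.
rewrite /scalar_mod /word6 => /and4P[h1 _ h3 _] /and4P[k1 _ k3 _].
have {h1 k1} h1 := rpredB h1 k1; have {h3 k3} h3 := rpredB h3 k3.
set A := _ - _ in h1; set B := _ - _ in h3.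
have -> : z3 - w3 = (1 - z2 * x3) * ((1 + x1 * z1) * B - z1 * A)
   + z2 ^+ 2 * (x3 * ((1 + z1 * x2) * A - (x1 + x2 + x1 * z1 * x2) * B)).
  by rewrite /A /B; ring.
exact: rpredD (dvdz_mull _ (rpredB (dvdz_mull _ h3) (dvdz_mull _ h1)))
  (dvdz_mull _ (dvdz_mull _ (rpredB (dvdz_mull _ h1) (dvdz_mull _ h3)))).
Qed.

(* For fixed l and k = gcd(a + x1 y1, q), the quadruples (x1, y1, x3, y2) are
   few, x2 is determined modulo q/k, and then y3 is determined modulo q. *)
Lemma card_scalar_words (c q T : nat) (a b : int) :
  (0 < c)%N -> (q %| c)%N -> (T ^ 2 <= c)%N -> (c%:Z %| a * b - 1)%Z ->
  (q ^ 3 * #|[set s : ('I_T.*2 * 'I_T.*2) * ('I_T.*2 * 'I_T.*2) * ('I_T.*2 * 'I_T.*2) |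
     [exists l : 'I_q, scalar_mod q l%:Z
       (word6 (bx s.1.1.1) (b * bx s.1.1.2) (bx s.2.1) (b * bx s.1.2.2)
              (bx s.1.2.1) (b * bx s.2.2))]]|
   <= 2688 * maxdiv c ^ 4 * c ^ 2 * (c + q ^ 2))%N.
Proof.
move=> c0 qc Tc cab; set A := [set s | _].
set D := maxdiv c.
pose B6 := (('I_T.*2 * 'I_T.*2) * ('I_T.*2 * 'I_T.*2) * ('I_T.*2 * 'I_T.*2))%type.
have q0 : (0 < q)%N by apply: dvdn_gt0 qc.
have qab : (q%:Z %| a * b - 1)%Z by apply: dvdz_trans cab.
have ac : coprimez a c%:Z.
  apply/coprimezP; case/dvdzP: cab => k hk.
  by exists (b, - k) => /=; rewrite mulNr -hk; ring.
have tq : (size (divisors q) <= D)%N by apply/maxdivP/dvdn_leq.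
pose W (s : B6) l := scalar_mod q l (word6 (bx s.1.1.1) (b * bx s.1.1.2) (bx s.2.1)
   (b * bx s.1.2.2) (bx s.1.2.1) (b * bx s.2.2)) : bool.
pose L := [set l : 'I_q | (q%:Z %| (l%:Z ^+ 2 - 1)%R)%Z].
pose X := (T.*2 + q)%N.
suff main : (q ^ 3 * #|A| <= #|L| * (D * (112 * c ^ 2 * D ^ 2 * X ^ 2)))%N.
  have cL : (#|L| <= 3 * D)%N.
    by apply: leq_trans (card_sqrt1 q0) _; rewrite leq_mul2l tq.
  (* The constant 2688 is 3 * 112 * 8: the square roots of 1, the quadruples, and this bound. *)
  have hX : (X ^ 2 <= 8 * (c + q ^ 2))%N.
    by move: Tc; rewrite /X -!mulnn; nia.
  apply: leq_trans main _; apply: leq_trans (leq_mul cL (leqnn _)) _.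
  apply: (@leq_trans (3 * D * (D * (112 * c ^ 2 * D ^ 2 * (8 * (c + q ^ 2))))))%N.
    by rewrite !leq_mul2l hX !orbT.
  by apply: eq_leq; ring.
rewrite [#|L|]cardE -(size_map (@Some 'I_q)).
apply: (card_fibers (k := fun s : B6 => [pick l : 'I_q | W s l%:Z])).
  move=> s; rewrite inE => sA; case: pickP => [l Wl|n].
    apply: map_f; rewrite mem_enum inE.
    by case: (scalar_mod_word6 Wl).
  by case/existsP: sA => l; rewrite -/(W s l%:Z) n.
move=> _ /mapP[l lL ->].
apply: leq_trans (leq_mul tq (leqnn _)).
pose u (s : B6) := a + bp s.1.1.
apply: (card_fibers (k := fun s : B6 => gcdn `|u s| q)) => [s _|k kq].
  by rewrite -dvdn_divisors // dvdn_gcdr.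
rewrite -dvdn_divisors // in kq.
have k0 : (0 < k)%N by apply: dvdn_gt0 kq.
set S := [set s in _ | _].
have SP s : s \in S -> W s l%:Z /\ gcdn `|u s| q = k.
  rewrite !inE => /andP[/andP[_ /eqP h] /eqP ->]; split=> //.
  by move: h; case: pickP => // l' Wl' [<-].
pose u' (s : B6) := a + bp s.1.2.
have Su s : s \in S -> (q%:Z %| u s - l%:Z * u' s)%Z.
  case/SP => /scalar_mod_word6[_ h _] _.
  rewrite /u /u' /bp.
  set x1 := bx s.1.1.1 in h *; set y1 := bx s.1.1.2 in h *.
  set x3 := bx s.1.2.1 in h *; set y2 := bx s.1.2.2 in h *.
  have -> : a + x1 * y1 - l%:Z * (a + x3 * y2) =
     a * (1 + x1 * (b * y1) - l%:Z * (1 + b * y2 * x3))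
     - (x1 * y1 - l%:Z * y2 * x3) * (a * b - 1) by ring.
  exact: rpredB (dvdz_mull _ h) (dvdz_mull _ qab).
have lL' : (q%:Z %| l%:Z ^+ 2 - 1)%Z by move: lL; rewrite mem_enum inE.
have Qb := card_box_quadruples c0 qc kq Tc ac lL'.
set Q := [set _ | _] in Qb.
pose m2 := (T.*2 %/ (q %/ k) + 1)%N; pose m3 := (T.*2 %/ q + 1)%N.
have cS : (#|S| <= #|Q| * (m2 * m3))%N.
  apply: (card_key (k := fun s : B6 => s.1)) => [s sS|i iQ].
    have uk : (k%:Z %| u s)%Z.
      by rewrite dvdzE /= -(SP _ sS).2 dvdn_gcdl.
    have uu := Su _ sS.
    rewrite inE -/(u s) -/(u' s) uk uu andbT /=.
    have -> : u' s = - (l%:Z * (u s - l%:Z * u' s) - (l%:Z * u s))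
       - u' s * (l%:Z ^+ 2 - 1) by ring.
    have kq' : (k%:Z %| q%:Z)%Z by [].
    apply: rpredB; last by apply/dvdz_mull/(dvdz_trans kq').
    rewrite rpredN.
    exact: rpredB (dvdz_mull _ (dvdz_trans kq' uu)) (dvdz_mull _ uk).
  set F := [set s in S | _].
  have FP s : s \in F -> s \in S /\ s.1 = i by rewrite inE => /andP[? /eqP].
  pose Y := [set s.2.1 | s in F].
  have cY : (#|Y| <= m2)%N.
    apply: (@card_congr _ _ (@bx T) (q %/ k) T.*2 (- T%:Z)).
    - by rewrite divn_gt0 // dvdn_leq.
    - by move=> x y _ _; apply: bx_inj.
    - by move=> [x hx] _; rewrite /bx /=; lia.
    move=> _ _ /imsetP[s /FP[sS si] ->] /imsetP[s' /FP[sS' si'] ->].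
    have [[W1 g1] [W2 _]] := (SP _ sS, SP _ sS').
    have [_ _ h1] := scalar_mod_word6 W1; have [_ _ h2] := scalar_mod_word6 W2.
    rewrite si in h1; rewrite si' in h2.
    have := rpredB h1 h2.
    set x1 := bx i.1.1; set y1 := bx i.1.2; set x2 := bx s.2.1; set x2' := bx s'.2.1.
    move=> h.
    have {h} : (q%:Z %| u s * (x2 - x2'))%Z.
      have -> : u s = a + x1 * y1 by rewrite /u si.
      rewrite (_ : _ * _ = a * (x1 + x2 + x1 * (b * y1) * x2 + l%:Z * bx i.2.1
         - (x1 + x2' + x1 * (b * y1) * x2' + l%:Z * bx i.2.1))
         - x1 * y1 * (x2 - x2') * (a * b - 1)); last by ring.
      exact: rpredB (dvdz_mull _ h) (dvdz_mull _ qab).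
    have ku : (k%:Z %| u s)%Z by rewrite dvdzE /= -g1 dvdn_gcdl.
    have -> : q%:Z = (q %/ k)%:Z * k%:Z by rewrite -PoszM divnK.
    rewrite -{1}(divzK ku) mulrAC dvdz_mul2r; last by rewrite eqz_nat -lt0n.
    rewrite Gauss_dvdzr // coprimezE /coprime -(eqn_pmul2r k0) muln_gcdl mul1n.
    have e1 : absz (u s) = (absz (u s %/ k%:Z)%Z * k)%N.
      by rewrite -{1}(divzK ku) abszM.
    by rewrite -e1 /= divnK // gcdnC g1.
  apply: leq_trans (leq_mul cY (leqnn _)).
  apply: (card_key (k := fun s : B6 => s.2.1)) => [s sF|j _].
    by apply/imsetP; exists s.
  apply: (@card_congr _ _ (fun s : B6 => bx s.2.2) q T.*2 (- T%:Z)) => //.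
  - move=> [s1 [s2 s3]] [t1 [t2 t3]]; rewrite !inE /=.
    move=> /andP[/andP[_ /eqP->] /eqP->] /andP[/andP[_ /eqP->] /eqP->].
    by move=> /bx_inj ->.
  - by move=> [s1 [s2 [x hx]]] _; rewrite /bx /=; lia.
  move=> s t; rewrite in_set => /andP[/FP[sS si] /eqP sj].
  rewrite in_set => /andP[/FP[tS ti] /eqP tj].
  have [[W1 g1] [W2 _]] := (SP _ sS, SP _ tS).
  rewrite /W si sj in W1; rewrite /W ti tj in W2.
  have h := scalar_mod_word6_last W1 W2.
  have -> : bx s.2.2 - bx t.2.2 = a * (b * bx s.2.2 - b * bx t.2.2)
     - (bx s.2.2 - bx t.2.2) * (a * b - 1) by ring.
  exact: rpredB (dvdz_mull _ h) (dvdz_mull _ qab).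
have h2 : (q %/ k * m2 <= X)%N.
  apply: leq_trans (muln_congr_bound _ _) _; rewrite leq_add2l.
  exact: leq_div.
have h3 : (q * m3 <= X)%N by apply: muln_congr_bound.
apply: (@leq_trans (q ^ 3 * (#|Q| * (m2 * m3))))%N; first by rewrite leq_mul2l cS orbT.
(* The factor q^3 is spent as k q on the quadruples, q / k on [x2] and q on the last variable. *)
have -> : (q ^ 3 * (#|Q| * (m2 * m3)) = k * q * #|Q| * ((q %/ k * m2) * (q * m3)))%N.
  transitivity (q %/ k * k * q * q * #|Q| * m2 * m3)%N; last by ring.
  by rewrite divnK //; ring.
rewrite -mulnn; apply: leq_mul => //; exact: leq_mul.
Qed.

(** * Norms and convolution operators *)

Definition nsq (R : rcfType) (z : R[i]) : R := normc z ^+ 2.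

Lemma nsqE (R : rcfType) (z : R[i]) : (nsq z)%:C%C = z * (z^*)%C.
Proof. by rewrite -sqr_normc /nsq rmorphXn. Qed.

Lemma normc_ge0 (R : rcfType) (z : R[i]) : 0 <= normc z.
Proof. by case: z => a b; rewrite /normc sqrtr_ge0. Qed.

Lemma nsq_ge0 (R : rcfType) (z : R[i]) : 0 <= nsq z.
Proof. exact: sqr_ge0. Qed.

Lemma nsq0 (R : rcfType) : nsq (0 : R[i]) = 0.
Proof. by rewrite /nsq normc0 expr0n. Qed.

Lemma nsqM (R : rcfType) (x y : R[i]) : nsq (x * y) = nsq x * nsq y.
Proof. by rewrite /nsq normcM exprMn. Qed.

Lemma normc_conj (R : rcfType) (z : R[i]) : normc (z^*)%C = normc z.
Proof. by case: z => a b; rewrite /normc /= sqrrN. Qed.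

Lemma nsqJ (R : rcfType) (z : R[i]) : nsq (z^*)%C = nsq z.
Proof. by rewrite /nsq normc_conj. Qed.

Lemma normc_real (R : rcfType) (x : R) : normc (x%:C%C) = `|x|.
Proof. by rewrite /normc /= expr0n addr0 sqrtr_sqr. Qed.

Lemma nsq_real (R : rcfType) (x : R) : nsq (x%:C%C) = x ^+ 2.
Proof. by rewrite /nsq normc_real real_normK // num_real. Qed.

Lemma ler_normc_sum (R : rcfType) (I : Type) (r : seq I) (P : pred I)
    (F : I -> R[i]) :
  normc (\sum_(i <- r | P i) F i) <= \sum_(i <- r | P i) normc (F i).
Proof.
elim/big_rec2: _ => [|i y x _ h]; first by rewrite normc0.
by apply: le_trans (le_normcD _ _) _; rewrite lerD2l.
Qed.

Definition norm2 (R : rcfType) (I : finType) (u : I -> R[i]) : R :=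
  \sum_i nsq (u i).

Lemma norm2_ge0 (R : rcfType) (I : finType) (u : I -> R[i]) : 0 <= norm2 u.
Proof. by apply: sumr_ge0 => i _; apply: nsq_ge0. Qed.

Lemma norm2E (R : rcfType) (I : finType) (u : I -> R[i]) :
  (norm2 u)%:C%C = \sum_i u i * (u i)^*%C.
Proof. by rewrite rmorph_sum; apply: eq_bigr => i _; apply: nsqE. Qed.

Lemma cauchy_schwarz_real (R : realFieldType) (I : finType) (x y : I -> R) :
  (\sum_i x i * y i) ^+ 2 <= (\sum_i x i ^+ 2) * (\sum_i y i ^+ 2).
Proof.
have h : 0 <= \sum_i \sum_j (x i * y j - x j * y i) ^+ 2.
  by apply: sumr_ge0 => i _; apply: sumr_ge0 => j _; apply: sqr_ge0.
have e : \sum_i \sum_j (x i * y j - x j * y i) ^+ 2 =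
    ((\sum_i x i ^+ 2) * (\sum_i y i ^+ 2) - (\sum_i x i * y i) ^+ 2) *+ 2.
  have e1 : \sum_i \sum_j (x i * y j) ^+ 2 = (\sum_i x i ^+ 2) * (\sum_i y i ^+ 2).
    rewrite big_distrl; apply: eq_bigr => i _; rewrite big_distrr.
    by apply: eq_bigr => j _; rewrite exprMn.
  have e2 : \sum_i \sum_j (x j * y i) ^+ 2 = (\sum_i x i ^+ 2) * (\sum_i y i ^+ 2).
    by rewrite exchange_big -e1; apply: eq_bigr => i _; apply: eq_bigr => j _.
  have e3 : \sum_i \sum_j (x i * y j) * (x j * y i) = (\sum_i x i * y i) ^+ 2.
    rewrite expr2 big_distrl; apply: eq_bigr => i _; rewrite big_distrr.
    by apply: eq_bigr => j _ /=; ring.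
  rewrite mulrnBl -[in RHS]e3 mulr2n -{1}e1 -e2 -mulr_natl big_distrr /=.
  rewrite -!big_split -sumrB; apply: eq_bigr => i _ /=.
  rewrite -big_split big_distrr -sumrB; apply: eq_bigr => j _ /=.
  by ring.
by rewrite -subr_ge0; move: h; rewrite e pmulrn_lge0.
Qed.

Lemma cauchy_schwarz (R : rcfType) (I : finType) (a b : I -> R[i]) :
  nsq (\sum_i a i * b i) <= norm2 a * norm2 b.
Proof.
apply: le_trans (cauchy_schwarz_real (fun i => normc (a i)) (fun i => normc (b i))).
rewrite /nsq ler_sqr ?nnegrE ?normc_ge0 //; last first.
  by apply: sumr_ge0 => i _; rewrite mulr_ge0 ?normc_ge0.
apply: le_trans (ler_normc_sum _ _ _) _.
by apply: ler_sum => i _; rewrite normcM.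
Qed.

Definition dot (R : rcfType) (I : finType) (u v : I -> R[i]) : R[i] :=
  \sum_i u i * (v i)^*%C.

Lemma nsq_dot (R : rcfType) (I : finType) (u v : I -> R[i]) :
  nsq (dot u v) <= norm2 u * norm2 v.
Proof.
apply: le_trans (cauchy_schwarz _ _) _; rewrite ler_wpM2l ?norm2_ge0 //.
by rewrite le_eqVlt; apply/orP; left; apply/eqP/eq_bigr => i _; rewrite nsqJ.
Qed.

Lemma dotuu (R : rcfType) (I : finType) (u : I -> R[i]) :
  dot u u = (norm2 u)%:C%C.
Proof. by rewrite norm2E. Qed.

(** The duality principle of the large sieve: a matrix and its transpose have the same norm. Opening
    one copy of [S] and using Cauchy-Schwarz bounds [norm2 S ^+ 2] by a multiple of [norm2 S], which
    cancels. *)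
Lemma dual_frame (R : rcfType) (I Y : finType) (U : Y -> I -> R[i]) (Theta : R) :
  0 <= Theta ->
  (forall xi : Y -> R[i],
     norm2 (fun i => \sum_y xi y * U y i) <= Theta * norm2 xi) ->
  forall a : I -> R[i],
    norm2 (fun y => \sum_i a i * U y i) <= Theta * norm2 a.
Proof.
move=> T0 frame a; pose S y := \sum_i a i * U y i.
rewrite -/(norm2 S).
have e : (norm2 S)%:C%C = \sum_i a i * (\sum_y (S y)^*%C * U y i).
  rewrite norm2E; under eq_bigr do rewrite {1}/S big_distrl /=.
  rewrite exchange_big; apply: eq_bigr => i _; rewrite big_distrr.
  by apply: eq_bigr => y _ /=; ring.
have h : norm2 S ^+ 2 <= norm2 a * (Theta * norm2 S).
  rewrite -nsq_real e; apply: le_trans (cauchy_schwarz _ _) _.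
  rewrite ler_wpM2l ?norm2_ge0 //; apply: le_trans (frame _) _.
  rewrite le_eqVlt; apply/orP; left; apply/eqP; congr (_ * _).
  by apply: eq_bigr => y _; rewrite nsqJ.
have [S0|S0] := eqVneq (norm2 S) 0.
  by rewrite S0 mulr_ge0 ?norm2_ge0.
have S1 : 0 < norm2 S by rewrite lt_def S0 norm2_ge0.
rewrite -(ler_pM2r S1) -expr2; apply: le_trans h _.
by rewrite mulrCA mulrA.
Qed.

Definition gop (R : rcfType) (gT : finGroupType) (S : finType) (phi : S -> R[i])
    (p : S -> gT) (u : gT -> R[i]) : gT -> R[i] :=
  fun w => \sum_s phi s * u (p s * w)%g.

Definition gopJ (R : rcfType) (gT : finGroupType) (S : finType) (phi : S -> R[i])
    (p : S -> gT) (u : gT -> R[i]) : gT -> R[i] :=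
  fun w => \sum_s (phi s)^*%C * u ((p s)^-1 * w)%g.

Lemma dot_gop (R : rcfType) (gT : finGroupType) (S : finType) (phi : S -> R[i])
    (p : S -> gT) (u v : gT -> R[i]) :
  dot (gop phi p u) v = dot u (gopJ phi p v).
Proof.
rewrite /dot /gop /gopJ.
under eq_bigr do rewrite big_distrl /=.
under [in RHS]eq_bigr do rewrite rmorph_sum big_distrr /=.
rewrite exchange_big [in RHS]exchange_big; apply: eq_bigr => s _.
rewrite (reindex_inj (mulgI (p s)^-1%g)); apply: eq_bigr => w _ /=.
by rewrite mulKVg rmorphM /= conjcK; ring.
Qed.

Lemma dot_gopJ (R : rcfType) (gT : finGroupType) (S : finType) (phi : S -> R[i])
    (p : S -> gT) (u v : gT -> R[i]) :
  dot (gopJ phi p u) v = dot u (gop phi p v).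
Proof.
rewrite (dot_gop (fun s => (phi s)^*%C)); apply: eq_bigr => w _.
congr (_ * (_)^*%C); apply: eq_bigr => s _; by rewrite conjcK invgK.
Qed.

(** Let a1, a2, a3 be the squared norms of M u, M* M u and M M* M u. Moving one operator across the
    inner product gives a1^2 <= |u|^2 a2 and a2^2 <= a1 a3; eliminate a2. *)
Lemma gop_norm_cube (R : rcfType) (gT : finGroupType) (S : finType)
    (phi : S -> R[i]) (p : S -> gT) (u : gT -> R[i]) :
  norm2 (gop phi p u) ^+ 3 <=
  norm2 u ^+ 2 * norm2 (gop phi p (gopJ phi p (gop phi p u))).
Proof.
set a1 := norm2 _; set a3 := norm2 (gop _ _ (gopJ _ _ _)).
pose a2 := norm2 (gopJ phi p (gop phi p u)).
have h1 : a1 ^+ 2 <= norm2 u * a2.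
  by rewrite -nsq_real -dotuu dot_gop nsq_dot.
have h2 : a2 ^+ 2 <= a1 * a3.
  by rewrite -nsq_real -dotuu dot_gopJ nsq_dot.
have a10 : 0 <= a1 by apply: norm2_ge0.
have a20 : 0 <= a2 by apply: norm2_ge0.
have a30 : 0 <= a3 by apply: norm2_ge0.
have u0 : 0 <= norm2 u by apply: norm2_ge0.
have [a1z|a1z] := eqVneq a1 0.
  by rewrite a1z expr0n /= mulr_ge0 ?exprn_ge0.
have a1P : 0 < a1 by rewrite lt_def a1z a10.
rewrite -(ler_pM2l a1P) -exprS.
have -> : a1 ^+ 4 = (a1 ^+ 2) ^+ 2 by rewrite -exprM.
apply: (@le_trans _ _ ((norm2 u * a2) ^+ 2)).
  by rewrite ler_sqr ?nnegrE ?mulr_ge0 ?exprn_ge0.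
by rewrite exprMn [leRHS]mulrCA ler_wpM2l ?exprn_ge0.
Qed.

(* The functions w |-> u (w * g y) all have the same sixth moment, and the frame
   bound says that they are nearly orthogonal, so the Hilbert-Schmidt norm of
   the operator on right K-invariant functions controls #|Y| times it. *)
Lemma amplification (R : rcfType) (gT : finGroupType) (S Y : finType)
    (phi : S -> R[i]) (p : S -> gT) (g : Y -> gT) (u : gT -> R[i])
    (K : {set gT}) (L : pred gT) (Theta : R) :
  0 <= Theta -> (forall s, normc (phi s) <= 1) ->
  (forall y k w, k \in K -> u (w * k * g y)%g = u (w * g y)%g) ->
  {in K &, forall k k', L (k * k'^-1)%g} ->
  (forall xi : Y -> R[i],
     norm2 (fun w => \sum_y xi y * u (w * g y)%g) <= Theta * norm2 xi) ->
  #|K|%:R * #|Y|%:R * norm2 (gop phi p u) ^+ 3 <=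
  norm2 u ^+ 2 * (Theta * (\sum_(s : S * S * S) \sum_(t : S * S * S)
     #|[set w | L (w^-1 * ((p s.2 * (p s.1.2)^-1 * p s.1.1)^-1
                   * (p t.2 * (p t.1.2)^-1 * p t.1.1)) * w)%g]|)%:R).
Proof.
move=> T0 phi1 uK LK frame.
pose h (s : S * S * S) := (p s.2 * (p s.1.2)^-1 * p s.1.1)%g.
pose c (s : S * S * S) := phi s.1.1 * (phi s.1.2)^*%C * phi s.2.
have c1 s : normc (c s) <= 1.
  rewrite /c !normcM normc_conj -[1]mulr1 ler_pM ?mulr_ge0 ?normc_ge0 //.
  by rewrite -[1]mulr1 ler_pM ?normc_ge0.
pose U y w := u (w * g y)%g.
pose A v := gop phi p (gopJ phi p (gop phi p v)).
have AE v w : A v w = \sum_s c s * v (h s * w)%g.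
  rewrite /A /gop /gopJ.
  rewrite -(pair_bigA _ (fun s1 s2 => c (s1, s2) * v (h (s1, s2) * w)%g)) /=.
  rewrite -(pair_bigA _ (fun s1 s2 => \sum_s c (s1, s2, s) * v (h (s1, s2, s) * w)%g)) /=.
  apply: eq_bigr => s1 _; rewrite big_distrr; apply: eq_bigr => s2 _ /=.
  rewrite big_distrr big_distrr; apply: eq_bigr => s3 _ /=.
  by rewrite /c /h /= !mulgA; ring.
set HS := (\sum_s \sum_t _)%N.
have nU y : norm2 (U y) = norm2 u.
  rewrite /norm2 [RHS](reindex_inj (mulIg (g y))) /=.
  by apply: eq_bigr.
have nPU y : norm2 (gop phi p (U y)) = norm2 (gop phi p u).
  rewrite /norm2 [RHS](reindex_inj (mulIg (g y))) /=.
  apply: eq_bigr => w _; congr nsq; apply: eq_bigr => s _.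
  by rewrite /U mulgA.
have step1 : #|Y|%:R * norm2 (gop phi p u) ^+ 3 <=
    norm2 u ^+ 2 * \sum_y norm2 (A (U y)).
  rewrite mulrC mulr_natr -sumr_const mulr_sumr.
  by apply: ler_sum => y _; rewrite -{1}(nPU y) -(nU y) gop_norm_cube.
(* The kernel of [A] summed over right translates by [K]. Since [U y] is right [K]-invariant,
   pairing it with this kernel multiplies [A (U y) w] by [#|K|], and duality then bounds the sum
   over [y] by the norm of the kernel. *)
pose a w w' := \sum_s c s * (((h s * w)^-1 * w')%g \in K)%:R.
have Ka w : #|K|%:R ^+ 2 * (\sum_y nsq (A (U y) w)) <= Theta * norm2 (a w).
  apply: le_trans (dual_frame T0 frame (a w)).
  rewrite /norm2 mulr_sumr; apply: ler_sum => y _.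
  rewrite -(@ger0_norm _ #|K|%:R) ?ler0n // -normc_real -/(nsq _) -nsqM.
  rewrite le_eqVlt; apply/orP; left; apply/eqP; congr nsq.
  rewrite AE big_distrr /=.
  under [RHS]eq_bigr do rewrite big_distrl /=.
  rewrite exchange_big; apply: eq_bigr => s _ /=.
  rewrite rmorph_nat mulrCA; under [RHS]eq_bigr do rewrite -mulrA.
  rewrite -big_distrr; congr (_ * _).
  rewrite (reindex_inj (mulgI (h s * w)%g)) /=.
  transitivity (\sum_(k in K) u (h s * w * g y)%g).
    by rewrite sumr_const /U mulr_natl.
  rewrite big_mkcond; apply: eq_bigr => k _; rewrite mulKg.
  case: (boolP (k \in K)) => kK; rewrite ?mul1r ?mul0r //.
  by rewrite [RHS]uK.
have na w : norm2 (a w) <= (#|K| * \sum_s \sum_t L (w^-1 * ((h s)^-1 * h t) * w)%g)%N%:R.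
  pose b s w' := ((h s * w)^-1 * w')%g \in K.
  have hb w' : nsq (a w w') <= ((\sum_s b s w') * (\sum_t b t w'))%N%:R.
    rewrite natrM -expr2 /nsq ler_sqr ?nnegrE ?normc_ge0 ?ler0n //.
    apply: le_trans (ler_normc_sum _ _ _) _; rewrite natr_sum; apply: ler_sum => s _.
    rewrite normcM -/(b s w'); case: (b s w').
      by rewrite normc1 mulr1.
    by rewrite normc0 mulr0.
  apply: (@le_trans _ _ (\sum_w' (\sum_s \sum_t (b s w' * b t w')%N)%N%:R)).
    apply: ler_sum => w' _; apply: le_trans (hb w') _.
    by rewrite ler_nat big_distrl leq_sum // => s _; rewrite big_distrr.
  rewrite -natr_sum ler_nat exchange_big big_distrr leq_sum // => s _ /=.
  rewrite exchange_big big_distrr leq_sum // => t _ /=.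
  have cb : (\sum_w' b s w' = #|K|)%N.
    rewrite (reindex_inj (mulgI (h s * w)%g)) /= -sum1_card [RHS]big_mkcond.
    by apply: eq_bigr => w' _; rewrite /b mulKg; case: (_ \in _).
  case Lst : (L _).
    rewrite muln1 -cb; apply: leq_sum => w' _.
    by case: (b s w'); case: (b t w').
  rewrite muln0 leqn0; apply/eqP/big1 => w' _.
  (* If both indicators hold, the quotient of the two elements of [K] is the conjugate of
     [(h s)^-1 * h t] by [w], in which [w'] has cancelled. *)
  case bs : (b s w'); case bt : (b t w') => //.
  have := LK _ _ bs bt.
  have -> : ((h s * w)^-1 * w' * ((h t * w)^-1 * w')^-1 = w^-1 * ((h s)^-1 * h t) * w)%g.
    by rewrite !invMg !invgK -!mulgA mulKVg.
  by rewrite Lst.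
have HSE : (HS = \sum_w \sum_s \sum_t L (w^-1 * ((h s)^-1 * h t) * w)%g)%N.
  rewrite exchange_big; apply: eq_bigr => s _; rewrite exchange_big.
  apply: eq_bigr => t _; rewrite -sum1_card big_mkcond /=.
  by apply: eq_bigr => w _; rewrite inE; case: (L _).
have step2 : #|K|%:R ^+ 2 * \sum_y norm2 (A (U y)) <= Theta * (#|K| * HS)%N%:R.
  rewrite /norm2 exchange_big mulr_sumr HSE big_distrr natr_sum mulr_sumr.
  apply: ler_sum => w _; apply: le_trans (Ka w) _.
  by rewrite ler_wpM2l.
have [K0|K0] := eqVneq #|K| 0%N.
  rewrite K0 !mul0r mulr_ge0 ?exprn_ge0 ?norm2_ge0 // mulr_ge0 //.
have KP : 0 < #|K|%:R :> R by rewrite ltr0n lt0n.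
move: step2; rewrite natrM mulrCA expr2 -mulrA ler_pM2l // => step2.
rewrite -mulrA; apply: le_trans (ler_wpM2l (ltW KP) step1) _.
by rewrite mulrCA ler_wpM2l // exprn_ge0 // norm2_ge0.
Qed.

(** * Functions on GL2 of a finite ring *)

(** The third clause is primitivity: distinct frequencies give orthogonal characters. *)
Definition add_char (R : rcfType) (A : finComUnitRingType) (psi : A -> R[i]) :=
  [/\ forall x y, psi (x + y) = psi x * psi y, forall x, normc (psi x) = 1 &
      forall r, r != 0 -> \sum_x psi (r * x) = 0].

Lemma add_char0 (R : rcfType) (A : finComUnitRingType) (psi : A -> R[i]) :
  add_char psi -> psi 0 = 1.
Proof.
move=> [psiD psi1 _]; have h := psiD 0 0; rewrite addr0 in h.
have nz : psi 0 != 0.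
  by apply/eqP => h0; have := psi1 0; rewrite h0 normc0 => /eqP; rewrite eq_sym oner_eq0.
by apply: (mulfI nz); rewrite -h mulr1.
Qed.

Lemma add_charB (R : rcfType) (A : finComUnitRingType) (psi : A -> R[i]) x y :
  add_char psi -> psi (x - y) = psi x * (psi y)^*%C.
Proof.
move=> psiP; have [psiD psi1 _] := psiP.
have h : psi y * psi (- y) = 1 by rewrite -psiD subrr add_char0.
have h' : psi y * (psi y)^*%C = 1 by rewrite -nsqE /nsq psi1 expr1n.
rewrite psiD; congr (_ * _).
rewrite -[LHS]mulr1 -h' mulrCA [psi (- y) * _]mulrC mulrA.
by rewrite [psi y * _]mulrC -mulrA h mulr1.
Qed.

Definition fourier (R : rcfType) (A : finComUnitRingType) (psi alpha : A -> R[i])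
  (z : A) : R[i] := \sum_r alpha r * psi (r * z).

Lemma parseval (R : rcfType) (A : finComUnitRingType) (psi : A -> R[i])
    (J : finType) (Q : pred J) (P : J -> A) (xi : J -> R[i]) :
  add_char psi -> {in Q &, injective P} ->
  norm2 (fun z => \sum_(y | Q y) xi y * psi (P y * z)) =
  #|A|%:R * \sum_(y | Q y) nsq (xi y).
Proof.
move=> psiP Pinj; have [_ _ orth] := psiP.
apply: (@complexI R); rewrite norm2E rmorphM rmorph_nat rmorph_sum mulr_sumr.
transitivity (\sum_(y | Q y) \sum_(y' | Q y') xi y * (xi y')^*%C *
    \sum_z psi ((P y - P y') * z)).
  under eq_bigr do rewrite rmorph_sum big_distrl /=.
  rewrite exchange_big; apply: eq_bigr => y Qy.
  under eq_bigr do rewrite big_distrr /=.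
  rewrite exchange_big; apply: eq_bigr => y' Qy'.
  rewrite big_distrr; apply: eq_bigr => z _ /=.
  by rewrite rmorphM /= mulrBl (add_charB _ _ psiP); ring.
apply: eq_bigr => y Qy; rewrite (bigD1 y) //= [X in _ + X]big1 ?addr0.
  under eq_bigr do rewrite subrr mul0r add_char0 //.
  by rewrite sumr_const -nsqE mulrC.
move=> y' /andP[Qy' yy']; rewrite orth ?mulr0 // subr_eq0.
by apply: contra yy' => /eqP h; apply/eqP/esym/Pinj.
Qed.

Lemma norm2_fourier (R : rcfType) (A : finComUnitRingType) (psi alpha : A -> R[i]) :
  add_char psi -> norm2 (fourier psi alpha) = #|A|%:R * norm2 alpha.
Proof. by move=> psiP; rewrite (parseval (Q := predT) (P := id)). Qed.

Definition mat2 (A : pzRingType) (a b c d : A) : 'M[A]_2 :=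
  \matrix_(i, j) if i == 0 then if j == 0 then a else b
                 else if j == 0 then c else d.

Lemma mat2E (A : pzRingType) (a b c d : A) :
  (mat2 a b c d 0 0 = a) * (mat2 a b c d 0 1 = b) *
  (mat2 a b c d 1 0 = c) * (mat2 a b c d 1 1 = d).
Proof. by rewrite !mxE. Qed.

Lemma mat2P (A : pzRingType) (M N : 'M[A]_2) :
  M 0 0 = N 0 0 -> M 0 1 = N 0 1 -> M 1 0 = N 1 0 -> M 1 1 = N 1 1 -> M = N.
Proof.
move=> h00 h01 h10 h11; apply/matrixP => i j.
have h (k : 'I_2) : k = 0 \/ k = 1.
  by case: k => [[|[|k]]] //= hk; [left|right]; apply/val_inj.
by case: (h i) => ->; case: (h j) => ->.
Qed.

Lemma mulmx2E (A : pzRingType) (M N : 'M[A]_2) i j :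
  (M *m N) i j = M i 0 * N 0 j + M i 1 * N 1 j.
Proof. by rewrite mxE big_ord_recl big_ord1; congr (_ + M _ _ * N _ _); apply/val_inj. Qed.

(** Total by default value: the identity when the determinant is not a unit. *)
Definition gl2 (A : finComUnitRingType) (a b c d : A) : {'GL_2[A]} :=
  insubd (1%g : {'GL_2[A]}) (mat2 a b c d : 'M[A]_2.-1.+1).

Lemma det2 (A : comPzRingType) (M : 'M[A]_2) :
  \det M = M 0 0 * M 1 1 - M 0 1 * M 1 0.
Proof.
rewrite (expand_det_row _ 0) big_ord_recl big_ord1 /cofactor !det_mx11 !mxE /=.
rewrite expr0 expr1 mul1r mulN1r mulrN.
by congr (_ * M _ _ - M _ _ * M _ _); apply/val_inj.
Qed.

Lemma gl2_val (A : finComUnitRingType) (a b c d : A) :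
  a * d - b * c \is a GRing.unit -> GLval (gl2 a b c d) = mat2 a b c d.
Proof.
move=> u; rewrite /gl2; apply: (@insubdK _ _ _ (1%g : {'GL_2[A]})).
by rewrite -[X in is_true X]/(mat2 a b c d \in unitmx) unitmxE det2 !mat2E.
Qed.

Lemma GL2_det (A : finComUnitRingType) (w : {'GL_2[A]}) :
  GLval w 0 0 * GLval w 1 1 - GLval w 0 1 * GLval w 1 0 \is a GRing.unit.
Proof. by have := GL_unitmx w; rewrite unitmxE det2. Qed.

Lemma GL2_mul (A : finComUnitRingType) (w v : {'GL_2[A]}) i j :
  GLval (w * v)%g i j = GLval w i 0 * GLval v 0 j + GLval w i 1 * GLval v 1 j.
Proof. by rewrite GL_MxE mulmx2E. Qed.

Lemma GL2_inj (A : finComUnitRingType) (w v : {'GL_2[A]}) :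
  GLval w 0 0 = GLval v 0 0 -> GLval w 0 1 = GLval v 0 1 ->
  GLval w 1 0 = GLval v 1 0 -> GLval w 1 1 = GLval v 1 1 -> w = v.
Proof. by move=> *; apply/val_inj/mat2P. Qed.

Definition upper (A : finComUnitRingType) (t : A) := gl2 1 t 0 1.
Definition lower (A : finComUnitRingType) (t : A) := gl2 1 0 t 1.

Lemma upperE (A : finComUnitRingType) (t : A) : GLval (upper t) = mat2 1 t 0 1.
Proof. by rewrite gl2_val // mulr1 mulr0 subr0 unitr1. Qed.

Lemma lowerE (A : finComUnitRingType) (t : A) : GLval (lower t) = mat2 1 0 t 1.
Proof. by rewrite gl2_val // mulr1 mul0r subr0 unitr1. Qed.

(* A function on the affine line, extended by 0 to the projective line and
   pulled back to GL2 along w |-> (first column of w). *)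
Definition lift (R : rcfType) (A : finComUnitRingType) (f : A -> R[i])
  (w : {'GL_2[A]}) : R[i] :=
  if GLval w 1 0 \is a GRing.unit then f (GLval w 0 0 / GLval w 1 0) else 0.

Lemma lift_upper (R : rcfType) (A : finComUnitRingType) (f : A -> R[i]) t w :
  lift f (upper t * w)%g = lift (fun z => f (z + t)) w.
Proof.
rewrite /lift !GL2_mul upperE !mat2E !mul1r mul0r add0r.
by case: ifP => // wu; rewrite mulrDl mulrK.
Qed.

Lemma sum_constE (R : pzRingType) (I : finType) (x : R) :
  \sum_(i : I) x = #|{: I}|%:R * x.
Proof. by rewrite sumr_const mulr_natl. Qed.

(** Average over left translation by upper unipotents, which move the affine coordinate by z -> z +
    t and so sweep all of [A] for each [w]. Equality fails only where the lower left entry is not a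
    unit and the lift vanishes. *)
Lemma norm2_lift (R : rcfType) (A : finComUnitRingType) (f : A -> R[i]) :
  #|A|%:R * norm2 (lift f) <= #|{: {'GL_2[A]}}|%:R * norm2 f.
Proof.
rewrite -!sum_constE.
have -> : \sum_(t : A) norm2 (lift f) = \sum_w \sum_t nsq (lift f (upper t * w)%g).
  rewrite [RHS]exchange_big; apply: eq_bigr => t _.
  by rewrite /norm2 (reindex_inj (mulgI (upper t))).
apply: ler_sum => w _.
have -> : \sum_t nsq (lift f (upper t * w)%g) = \sum_t nsq (lift (fun z => f (z + t)) w).
  by apply: eq_bigr => t _; rewrite (lift_upper f t w).
rewrite /lift; case: (GLval w 1 0 \is a GRing.unit); last by rewrite big1 ?norm2_ge0 // => t _; rewrite nsq0.
by rewrite /norm2 [leRHS](reindex_inj (addrI (GLval w 0 0 / GLval w 1 0))).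
Qed.

Definition units (A : finComUnitRingType) : {set A} := [set x | x \is a GRing.unit].

(** Average over left translation by the affine group z -> s z + t. The sum over t separates the
    frequencies r by Parseval. On the support of alpha, r is a unit, so after completing s to all of
    [A] the product r s also runs over [A], and a second Parseval applies in that variable. *)
Lemma lift_frame (R : rcfType) (A : finComUnitRingType) (psi alpha : A -> R[i])
    (Y : finType) (y : Y -> A) (xi : Y -> R[i]) :
  add_char psi -> injective y ->
  (forall r, alpha r != 0 -> r \is a GRing.unit) ->
  #|units A|%:R * norm2 (fun w => \sum_j xi j * lift (fourier psi alpha) (w * lower (y j))%g)
  <= #|{: {'GL_2[A]}}|%:R * #|A|%:R * norm2 alpha * norm2 xi.
Proof.
move=> psiP yinj asupp.
set Q := fun w : {'GL_2[A]} => \sum_j xi j * lift _ (w * lower (y j))%g.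
have A0 : 0 < #|A|%:R :> R by rewrite ltr0n; apply/card_gt0P; exists 0.
rewrite -(ler_pM2l A0) -sum_constE.
have -> : \sum_(t : A) #|units A|%:R * norm2 Q =
    \sum_w \sum_(s in units A) \sum_t nsq (Q (gl2 s t 0%R 1%R * w)%g).
  rewrite [RHS]exchange_big; transitivity (\sum_(s in units A) \sum_(t : A) norm2 Q).
    rewrite [RHS]exchange_big; apply: eq_bigr => t _.
    by rewrite sumr_const mulr_natl.
  apply: eq_bigr => s _; rewrite [RHS]exchange_big; apply: eq_bigr => t _.
  by rewrite /norm2 (reindex_inj (mulgI (gl2 s t 0 1))).
rewrite -!mulrA mulrCA -sum_constE; apply: ler_sum => w _.
pose c j := GLval w 1 0 + GLval w 1 1 * y j.
pose P j := (GLval w 0 0 + GLval w 0 1 * y j) / c j.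
pose U j := c j \is a GRing.unit.
(* [P j] is the image of [y j] under the Möbius map of [w] (with the two coordinates in swapped
   roles). Cross-multiplying leaves det w times the difference of the points, and det w is a
   unit. *)
have Pinj : {in U &, injective P}.
  move=> i j; rewrite !unfold_in => Ui Uj Pij; apply: yinj.
  have e : (GLval w 0 0 + GLval w 0 1 * y i) * c j = (GLval w 0 0 + GLval w 0 1 * y j) * c i.
    have e1 : GLval w 0 0 + GLval w 0 1 * y i = P i * c i by rewrite divrK.
    have e2 : GLval w 0 0 + GLval w 0 1 * y j = P j * c j by rewrite divrK.
    by rewrite e1 e2 Pij mulrAC.
  apply: (mulrI (GL2_det w)); apply/eqP; rewrite -subr_eq0.
  move/eqP: e; rewrite eq_sym -subr_eq0 /c => /eqP e; apply/eqP; rewrite -[RHS]e; ring.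
have Qst s t : s \in units A -> Q (gl2 s t 0%R 1%R * w)%g =
    \sum_r (alpha r * \sum_(j | U j) xi j * psi (P j * (r * s))) * psi (r * t).
  rewrite inE => su.
  transitivity (\sum_(j | U j) xi j * fourier psi alpha (s * P j + t)).
    rewrite /Q [RHS]big_mkcond; apply: eq_bigr => j _.
    rewrite /lift -mulgA !GL2_mul lowerE !mat2E.
    rewrite gl2_val; last by rewrite mulr1 mulr0 subr0.
    rewrite !mat2E !mul0r !mulr1 !add0r !mul1r -/(c j) -/(U j).
    case: ifP => [Uj|_]; last by rewrite mulr0.
    congr (_ * fourier _ _ _); rewrite /P.
    by rewrite mulrDl mulrK // mulrA.
  rewrite /fourier; under eq_bigr do rewrite big_distrr /=.
  rewrite exchange_big; apply: eq_bigr => r _ /=.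
  rewrite big_distrr big_distrl; apply: eq_bigr => j _ /=.
  have [psiD _ _] := psiP.
  rewrite mulrDr psiD (_ : r * (s * P j) = P j * (r * s)); last by ring.
  by ring.
apply: (@le_trans _ _ (\sum_(s in units A) #|A|%:R * \sum_r nsq (alpha r) *
     nsq (\sum_(j | U j) xi j * psi (P j * (r * s))))).
  apply: ler_sum => s su; under eq_bigr do rewrite Qst //.
  rewrite -/(norm2 _) (parseval (Q := predT) (P := id)) //.
  by rewrite ler_pM2l //; apply: ler_sum => r _; rewrite nsqM.
rewrite -mulr_sumr ler_pM2l // exchange_big mulrCA {1}/norm2 mulr_suml.
apply: ler_sum => r _; rewrite -mulr_sumr.
have [->|r0] := eqVneq (alpha r) 0; first by rewrite nsq0 !mul0r.
have ru := asupp _ r0.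
rewrite ler_wpM2l ?nsq_ge0 //.
apply: (@le_trans _ _ (\sum_s nsq (\sum_(j | U j) xi j * psi (P j * (r * s))))).
  by rewrite [leRHS](bigID [in units A]) /= lerDl sumr_ge0 // => s _; apply: nsq_ge0.
have <- : \sum_z nsq (\sum_(j | U j) xi j * psi (P j * z)) =
    \sum_s nsq (\sum_(j | U j) xi j * psi (P j * (r * s))).
  by rewrite (reindex_inj (mulrI ru)).
rewrite -/(norm2 _) parseval // ler_pM2l // [leRHS](bigID U) /= lerDl.
by apply: sumr_ge0 => j _; apply: nsq_ge0.
Qed.

Definition in_ideal (A : finComUnitRingType) (q : nat) (x : A) : bool :=
  [exists z : A, x == q%:R * z].

Lemma in_idealP (A : finComUnitRingType) (q : nat) (x : A) :
  reflect (exists z, x = q%:R * z) (in_ideal q x).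
Proof. by apply: (iffP existsP) => -[z /eqP]; exists z => //; apply/eqP. Qed.

Lemma in_ideal0 (A : finComUnitRingType) (q : nat) : in_ideal q (0 : A).
Proof. by apply/in_idealP; exists 0; rewrite mulr0. Qed.

Lemma in_idealD (A : finComUnitRingType) (q : nat) (x y : A) :
  in_ideal q x -> in_ideal q y -> in_ideal q (x + y).
Proof.
move=> /in_idealP[u ->] /in_idealP[v ->]; apply/in_idealP.
by exists (u + v); rewrite mulrDr.
Qed.

Lemma in_idealM (A : finComUnitRingType) (q : nat) (x y : A) :
  in_ideal q x -> in_ideal q (y * x).
Proof.
by move=> /in_idealP[u ->]; apply/in_idealP; exists (y * u); rewrite mulrCA.
Qed.

Lemma in_idealMU (A : finComUnitRingType) (q : nat) (x y : A) :
  y \is a GRing.unit -> in_ideal q (y * x) -> in_ideal q x.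
Proof. by move=> yu /(in_idealM y^-1); rewrite mulKr. Qed.

Lemma in_idealB (A : finComUnitRingType) (q : nat) (x y : A) :
  in_ideal q x -> in_ideal q y -> in_ideal q (x - y).
Proof. by move=> hx hy; rewrite -[- y]mulN1r in_idealD // in_idealM. Qed.

(** On the affine coordinate it acts by z -> a / z, the relation between the two Fourier
    arguments. *)
Definition weyl (A : finComUnitRingType) (a : A) : {'GL_2[A]} := gl2 0 a 1 0.

Lemma weylE (A : finComUnitRingType) (a : A) :
  a \is a GRing.unit -> GLval (weyl a) = mat2 0 a 1 0.
Proof. by move=> au; rewrite gl2_val // mul0r mulr1 sub0r unitrN. Qed.

Definition base_fiber (A : finComUnitRingType) : {set {'GL_2[A]}} :=
  [set w : {'GL_2[A]} | (GLval w 1 0 \is a GRing.unit) && (GLval w 0 0 == 0)].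

Lemma card_base_fiber (A : finComUnitRingType) :
  (#|units A| ^ 2 * #|A| <= #|base_fiber A|)%N.
Proof.
pose f (x : A * A * A) : {'GL_2[A]} := gl2 0 x.1.1 x.1.2 x.2.
have fE x : x \in setX (setX (units A) (units A)) setT ->
    GLval (f x) = mat2 0 x.1.1 x.1.2 x.2.
  rewrite !inE andbT => /andP[u1 u2]; rewrite gl2_val //.
  by rewrite mul0r sub0r unitrN unitrM u1 u2.
have <- : #|setX (setX (units A) (units A)) [set: A]| = (#|units A| ^ 2 * #|A|)%N.
  by rewrite !cardsX cardsT mulnn.
rewrite -(card_in_imset (f := f)).
  apply: subset_leq_card; apply/subsetP => _ /imsetP[x xS ->].
  move: (xS); rewrite !inE andbT => /andP[u1 u2].
  by rewrite fE // !mat2E u2 eqxx.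
move=> [[x1 x2] x3] [[y1 y2] y3] xS yS xy.
have := congr1 (fun w => GLval w) xy; rewrite !fE //= => e.
congr (_, _, _).
- by have := congr1 (fun M : 'M[A]_2 => M 0 1) e; rewrite !mat2E.
- by have := congr1 (fun M : 'M[A]_2 => M 1 0) e; rewrite !mat2E.
by have := congr1 (fun M : 'M[A]_2 => M 1 1) e; rewrite !mat2E.
Qed.

(** The fibers of the affine coordinate are the translates of [base_fiber] by [upper z], so all have
    the same size. Non-units z drop out because the lift at [weyl a * w] vanishes there. *)
Lemma lift_bilinear (R : rcfType) (A : finComUnitRingType) (f g : A -> R[i]) (a : A) :
  a \is a GRing.unit ->
  \sum_w lift f w * lift g (weyl a * w)%g =
  #|base_fiber A|%:R * \sum_(z in units A) f z * g (a / z).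
Proof.
move=> au.
pose H z := if z \is a GRing.unit then f z * g (a / z) else 0.
have e1 w : lift f w * lift g (weyl a * w)%g =
    if GLval w 1 0 \is a GRing.unit then H (GLval w 0 0 / GLval w 1 0) else 0.
  rewrite /lift !GL2_mul weylE // !mat2E !mul0r !add0r addr0 mul1r.
  case u : (GLval w 1 0 \is a GRing.unit); last by rewrite mul0r.
  rewrite /H unitrM unitrV u andbT.
  case v : (GLval w 0 0 \is a GRing.unit); last by rewrite mulr0.
  congr (_ * g _); rewrite invrM ?unitrV // invrK; ring.
under eq_bigr do rewrite e1.
rewrite -big_mkcond /= (partition_big (fun w : {'GL_2[A]} => GLval w 0 0 / GLval w 1 0) xpredT) //=.
rewrite mulr_sumr big_mkcond [RHS]big_mkcond /=; apply: eq_bigr => z _.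
transitivity (\sum_(w in base_fiber A) H z).
  rewrite (reindex_inj (mulgI (upper z))) /=; apply: eq_big => [w|w].
    rewrite !GL2_mul upperE !mat2E !mul1r mul0r add0r inE.
    case u : (_ \is a GRing.unit) => //=.
    rewrite mulrDl mulrK // -subr_eq0 addrK.
    apply/eqP/eqP => [h|->]; last by rewrite mul0r.
    by rewrite -[LHS](divrK u) h mul0r.
  by move=> /andP[_ /eqP ->].
rewrite sumr_const /H inE; case: ifP => _; rewrite ?mul0rn // -[LHS]mulr_natl; ring.
Qed.

Definition level_group (A : finComUnitRingType) (d : nat) : {set {'GL_2[A]}} :=
  [set w : {'GL_2[A]} | [&& GLval w 1 0 == 0, in_ideal d (GLval w 0 1) &
            in_ideal d (GLval w 0 0 - GLval w 1 1)]].

Lemma level_groupP (A : finComUnitRingType) (d : nat) (w : {'GL_2[A]}) :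
  w \in level_group A d ->
  [/\ GLval w 1 0 = 0, in_ideal d (GLval w 0 1),
      in_ideal d (GLval w 0 0 - GLval w 1 1),
      GLval w 0 0 \is a GRing.unit & GLval w 1 1 \is a GRing.unit].
Proof.
rewrite inE => /and3P[/eqP h1 h2 h3]; split=> //.
  by have := GL2_det w; rewrite h1 mulr0 subr0 unitrM => /andP[].
by have := GL2_det w; rewrite h1 mulr0 subr0 unitrM => /andP[].
Qed.

Lemma level_group_div (A : finComUnitRingType) (d : nat) :
  {in level_group A d &, forall k k', (k * k'^-1)%g \in level_group A d}.
Proof.
move=> k k' /level_groupP[k10 k01 k0 _ _] /level_groupP[k'10 k'01 k'0 u0 u1].
set m := (k * k'^-1)%g.
have mk : (m * k')%g = k by rewrite mulgKV.
have e i j : GLval k i j = GLval m i 0 * GLval k' 0 j + GLval m i 1 * GLval k' 1 j.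
  by rewrite -GL2_mul mk.
have e00 := e 0 0; have e01 := e 0 1; have e10 := e 1 0; have e11 := e 1 1.
rewrite k'10 ?mulr0 ?addr0 in e00 e10.
have m10 : GLval m 1 0 = 0.
  by apply: (mulIr u0); rewrite mul0r -e10.
rewrite m10 mul0r add0r in e11.
rewrite inE m10 eqxx /=; apply/andP; split.
  apply: (in_idealMU u1).
  have -> : GLval k' 1 1 * GLval m 0 1 = GLval k 0 1 - GLval m 0 0 * GLval k' 0 1.
    by rewrite e01; ring.
  by rewrite in_idealB // in_idealM.
apply: (in_idealMU u0).
have -> : GLval k' 0 0 * (GLval m 0 0 - GLval m 1 1) =
    (GLval k 0 0 - GLval k 1 1) - GLval m 1 1 * (GLval k' 0 0 - GLval k' 1 1).
  by rewrite e00 e11; ring.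
by rewrite in_idealB // in_idealM.
Qed.

(** When d y = 0, the vector (1, y) is an eigenvector of every [k] in the level group, with a unit
    eigenvalue, and a lift depends on the first column only up to a unit. *)
Lemma lift_level (R : rcfType) (A : finComUnitRingType) (d : nat) (f : A -> R[i])
    (y : A) (k w : {'GL_2[A]}) :
  d%:R * y = 0 -> k \in level_group A d ->
  lift f (w * k * lower y)%g = lift f (w * lower y)%g.
Proof.
move=> dy /level_groupP[k10 /in_idealP[u k01] /in_idealP[v k0] k0u _].
have e1 : GLval k 0 1 * y = 0 by rewrite k01 mulrAC dy mul0r.
have e2 : GLval k 1 1 * y = GLval k 0 0 * y.
  have -> : GLval k 1 1 = GLval k 0 0 - d%:R * v by rewrite -k0; ring.
  by rewrite mulrBl mulrAC dy mul0r subr0.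
have e i : GLval (w * k * lower y)%g i 0 = GLval k 0 0 * GLval (w * lower y)%g i 0.
  rewrite -mulgA !GL2_mul lowerE !mat2E !mulr1 k10 add0r e1 addr0 e2; ring.
rewrite /lift !e unitrM k0u /=; case u' : (_ \is a GRing.unit) => //.
congr f; have u2 : GLval k 0 0 * GLval (w * lower y)%g 1 0 \is a GRing.unit.
  by rewrite unitrM k0u u'.
by apply: (mulIr u2); rewrite divrK // mulrCA divrK.
Qed.

(** * Counting fixed points modulo c *)

Lemma val_natr (n k : nat) : val (k%:R : 'I_n.+2) = (k %% n.+2)%N.
Proof. by rewrite Zp_nat. Qed.

Lemma natr_val (n : nat) (x : 'I_n.+2) : (val x)%:R = x.
Proof. by apply/val_inj; rewrite val_natr modn_small ?ltn_ord. Qed.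

Lemma natr_char (n : nat) : (n.+2)%:R = 0 :> 'I_n.+2.
Proof. by apply/val_inj; rewrite val_natr modnn. Qed.

Lemma in_ideal_val (n q : nat) (x : 'I_n.+2) : (q %| n.+2)%N ->
  in_ideal q x = (q %| val x)%N.
Proof.
move=> qc; apply/in_idealP/idP => [[z ->]|/dvdnP[k xk]].
  rewrite -(natr_val z) -natrM val_natr.
  by rewrite /dvdn (modn_dvdm _ qc) -/(dvdn _ _) dvdn_mulr.
by exists k%:R; rewrite -natrM mulnC -xk natr_val.
Qed.

Lemma in_ideal_int (n q : nat) (z : int) : (q %| n.+2)%N ->
  in_ideal q (z%:~R : 'I_n.+2) = (q%:Z %| z)%Z.
Proof.
move=> qc; have q0 : (0 < q)%N by apply: dvdn_gt0 qc.
have [r rE] : exists r : nat, (z %% q%:Z)%Z = r%:Z.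
  have : 0 <= (z %% q%:Z)%Z by apply: modz_ge0; rewrite eqz_nat -lt0n.
  by case: (z %% q%:Z)%Z => // r _; exists r.
have rq : (r < q)%N.
  by rewrite -ltz_nat -rE ltz_pmod // ltz_nat.
have zE : (z%:~R : 'I_n.+2) = q%:R * (z %/ q%:Z)%Z%:~R + r%:R.
  by rewrite {1}(divz_eq z q%:Z) rE rmorphD rmorphM /= mulrC.
have rI : in_ideal q (z%:~R : 'I_n.+2) = in_ideal q (r%:R : 'I_n.+2).
  have hI : in_ideal q (q%:R * (z %/ q%:Z)%Z%:~R : 'I_n.+2).
    by apply/in_idealP; exists ((z %/ q%:Z)%Z%:~R).
  apply/idP/idP => h; last by rewrite zE in_idealD.
  have -> : (r%:R : 'I_n.+2) = z%:~R - q%:R * (z %/ q%:Z)%Z%:~R by rewrite zE; ring.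
  exact: in_idealB.
rewrite rI in_ideal_val // val_natr modn_small; last first.
  by apply: leq_trans rq (dvdn_leq _ qc).
apply/idP/dvdz_mod0P; rewrite rE; last by case=> ->.
by move/dvdnP => [[|k]]; [move=> ->|rewrite mulSn => h; lia].
Qed.

Lemma unit_val (n : nat) (x : 'I_n.+2) :
  (x \is a GRing.unit) = coprime (val x) n.+2.
Proof. by rewrite coprime_sym -[in LHS](natr_val x) (@unitZpE n.+2). Qed.

Lemma card_units (n : nat) : #|units 'I_n.+2| = totient n.+2.
Proof.
rewrite totient_count_coprime big_mkord -sum1_card big_mkcond /=.
by apply: eq_bigr => x _; rewrite inE unit_val coprime_sym; case: coprime.
Qed.

Lemma card_ideal (n d : nat) : (d %| n.+2)%N ->
  (n.+2 <= d * #|[set b : 'I_n.+2 | in_ideal d b]|)%N.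
Proof.
move=> dc; have d0 : (0 < d)%N by apply: dvdn_gt0 dc.
pose m := (n.+2 %/ d)%N.
have mc : (m * d)%N = n.+2 by rewrite divnK.
have jP (j : 'I_m) : (d * j < n.+2)%N by rewrite -mc mulnC ltn_pmul2r.
rewrite -{1}mc mulnC leq_mul2l; apply/orP; right.
rewrite -{1}(card_ord m) -(@card_imset _ _ (fun j : 'I_m => Ordinal (jP j))).
  apply: subset_leq_card; apply/subsetP => _ /imsetP[j _ ->].
  by rewrite inE in_ideal_val //= dvdn_mulr.
move=> i j [] /eqP; rewrite eqn_pmul2l // => /eqP; exact: val_inj.
Qed.

(** Cauchy-Schwarz over the [d] residue classes: no information about how the units are distributed
    modulo [d] is required. *)
Lemma card_congruent_units (n d : nat) : (d %| n.+2)%N ->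
  (totient n.+2 ^ 2 <= d * #|[set x : 'I_n.+2 * 'I_n.+2 |
     [&& x.1 \is a GRing.unit, x.2 \is a GRing.unit & in_ideal d (x.1 - x.2)%R]]|)%N.
Proof.
move=> dc; have d0 : (0 < d)%N by apply: dvdn_gt0 dc.
pose m (r : 'I_d) := (\sum_(x in units 'I_n.+2) (val x %% d == r))%N.
have tm : totient n.+2 = (\sum_r m r)%N.
  rewrite exchange_big -card_units -sum1_card; apply: eq_bigr => x _ /=.
  have xd : (val x %% d < d)%N by rewrite ltn_pmod.
  rewrite (bigD1 (Ordinal xd)) //= eqxx big1 // => r rx.
  by case: eqP => // h; case/eqP: rx; apply/val_inj; rewrite /= h.
have cs := cauchy_schwarz_real (fun r : 'I_d => 1 : rat) (fun r => (m r)%:R).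
have {}cs : ((\sum_r m r) ^ 2 <= d * \sum_r m r ^ 2)%N.
  rewrite -(ler_nat rat) natrX natrM !natr_sum.
  apply: le_trans (le_trans cs _); rewrite le_eqVlt; apply/orP; left; apply/eqP.
    by congr (_ ^+ 2); apply: eq_bigr => r _; rewrite mul1r.
  congr (_ * _); last by apply: eq_bigr => r _; rewrite natrX.
  by rewrite (eq_bigr (fun=> 1)) ?sumr_const ?card_ord // => r _; rewrite expr1n.
rewrite tm; apply: leq_trans cs _; rewrite leq_mul2l; apply/orP; right.
set P := [set x | _].
have -> : #|P| = (\sum_x \sum_y ((x, y) \in P))%N.
  rewrite pair_bigA -sum1_card big_mkcond; apply: eq_bigr => -[x y] _ /=.
  by case: (_ \in P).
rewrite (eq_bigr (fun r : 'I_d => \sum_(x : 'I_n.+2) \sum_(y : 'I_n.+2) [&& x \in units 'I_n.+2, y \in units 'I_n.+2,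
    val x %% d == r & val y %% d == r]))%N; last first.
  move=> r _; rewrite /m -mulnn big_distrlr /= big_mkcond.
  apply: eq_bigr => x _; case: ifP => xu; last by rewrite big1.
  rewrite big_mkcond; apply: eq_bigr => y _ /=.
  by case: ifP => //= _; rewrite mulnb.
rewrite exchange_big leq_sum // => x _; rewrite exchange_big leq_sum // => y _.
rewrite [(x, y) \in P]in_set /= -[x \is a GRing.unit]in_set -[y \is a GRing.unit]in_set.
rewrite -/(units _); case: (x \in units _) => /=; last by rewrite big1.
case: (y \in units _) => /=; last by rewrite big1.
have xd : (val x %% d < d)%N by rewrite ltn_pmod.
rewrite (bigD1 (Ordinal xd)) //= eqxx big1 ?addn0; last first.
  move=> r rx; rewrite andbC; case: eqP => //= h; case: eqP => // h'.
  by case/eqP: rx; apply/val_inj; rewrite /= h'.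
case: eqP => // yx; rewrite (_ : in_ideal _ _) //.
have -> : x - y = (val x)%:Z%:~R - (val y)%:Z%:~R by rewrite -!pmulrn !natr_val.
rewrite -rmorphB in_ideal_int //= -eqz_mod_dvd !modz_nat.
by apply/eqP; congr Posz.
Qed.

Lemma card_level_group (n d : nat) : (d %| n.+2)%N ->
  (totient n.+2 ^ 2 * n.+2 <= d ^ 2 * #|level_group 'I_n.+2 d|)%N.
Proof.
move=> dc.
set P := [set x : 'I_n.+2 * 'I_n.+2 |
     [&& x.1 \is a GRing.unit, x.2 \is a GRing.unit & in_ideal d (x.1 - x.2)%R]].
set B := [set b : 'I_n.+2 | in_ideal d b].
have PE x : x \in setX P B -> GLval (gl2 x.1.1 x.2 0 x.1.2) = mat2 x.1.1 x.2 0 x.1.2.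
  rewrite !inE => /andP[/and3P[u1 u2 _] _]; rewrite gl2_val //.
  by rewrite mulr0 subr0 unitrM u1.
have cPB : (#|setX P B| <= #|level_group 'I_n.+2 d|)%N.
  rewrite -(card_in_imset (f := fun x => gl2 x.1.1 x.2 0 x.1.2)).
    apply: subset_leq_card; apply/subsetP => _ /imsetP[x xS ->].
    rewrite inE PE // !mat2E eqxx.
    by move: xS; rewrite !inE => /andP[/and3P[_ _ ->] ->].
  move=> [[x1 x2] x3] [[y1 y2] y3] xS yS xy.
  have e i j : mat2 x1 x3 0 x2 i j = mat2 y1 y3 0 y2 i j.
    by rewrite -(PE _ xS) -(PE _ yS) xy.
  have := e 0 0; have := e 0 1; have := e 1 1; rewrite !mat2E.
  by move=> -> -> ->.
apply: (@leq_trans (d * (d * #|setX P B|))); last first.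
  by rewrite mulnA mulnn leq_mul2l cPB orbT.
rewrite cardsX; apply: leq_trans (leq_mul (card_congruent_units dc) (card_ideal dc)) _.
by apply: eq_leq; rewrite -/P -/B; ring.
Qed.

Lemma card_GL2 (n : nat) : (#|{: {'GL_2['I_n.+2]}}| <= n.+2 ^ 4)%N.
Proof.
apply: (@leq_trans #|{: 'M['I_n.+2]_2}|).
  by rewrite -(card_imset (mem predT) (@val_inj _ _ {'GL_2['I_n.+2]})) max_card.
by rewrite card_mx card_ord.
Qed.

Definition scalar_mod_GL (A : finComUnitRingType) (q : nat) (w : {'GL_2[A]}) : bool :=
  [&& in_ideal q (GLval w 0 1), in_ideal q (GLval w 1 0) &
      in_ideal q (GLval w 0 0 - GLval w 1 1)].

Lemma scalar_mod_GLP (A : finComUnitRingType) (q : nat) (w : {'GL_2[A]}) :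
  reflect (exists l (h : 'M[A]_2), GLval w = l%:M + q%:R *: h) (scalar_mod_GL q w).
Proof.
apply: (iffP and3P) => [[]|[l [h wE]]].
  move=> /in_idealP[u hu] /in_idealP[v hv] /in_idealP[t ht].
  exists (GLval w 1 1), (mat2 t u v 0).
  apply: mat2P; rewrite !mxE /=; rewrite ?hu ?hv ?mulr1n ?mulr0n ?mulr0 ?add0r ?addr0 //.
  by rewrite -ht; ring.
rewrite wE !mxE /= !mulr1n !mulr0n !add0r.
split; apply/in_idealP; [exists (h 0 1)|exists (h 1 0)|exists (h 0 0 - h 1 1)] => //.
ring.
Qed.

Lemma scalar_mod_GLJ (A : finComUnitRingType) (q : nat) (w x : {'GL_2[A]}) :
  scalar_mod_GL q (x^-1 * w * x)%g -> scalar_mod_GL q w.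
Proof.
move=> /scalar_mod_GLP[l [h e]]; apply/scalar_mod_GLP.
have wE : w = (x * (x^-1 * w * x) * x^-1)%g by rewrite !mulgA mulgV mul1g mulgK.
have xV : (GLval x : 'M[A]_2) *m GLval x^-1%g = 1%:M.
  by rewrite -[LHS]/(GLval (x * x^-1)%g) mulgV.
exists l, ((GLval x : 'M[A]_2) *m h *m GLval x^-1%g).
transitivity ((GLval x : 'M[A]_2) *m (l%:M + q%:R *: h) *m GLval x^-1%g).
  by rewrite -e -[RHS]/(GLval (x * (x^-1 * w * x) * x^-1)%g) -wE.
by rewrite mulmxDr mulmxDl -scalemxAr -scalemxAl scalar_mxC -[l%:M *m _ *m _]mulmxA xV mulmx1.
Qed.

(** The first column of [x] is an eigenvector of [g]. Eliminating the eigenvalue gives the form y (E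
    x - B y); the factor y stays, as it may be a zero divisor. *)
Lemma upper_triangular_eigenvector (A : finComUnitRingType) (g x m : {'GL_2[A]}) :
  (g * x = x * m)%g -> GLval g 1 0 = 0 -> GLval m 1 0 = 0 ->
  GLval x 1 0 * ((GLval g 1 1 - GLval g 0 0) * GLval x 0 0) =
  GLval x 1 0 * (GLval g 0 1 * GLval x 1 0).
Proof.
move=> e g10 m10.
have a0 := GL2_mul g x 0 0; have b0 := GL2_mul x m 0 0.
have a1 := GL2_mul g x 1 0; have b1 := GL2_mul x m 1 0.
rewrite e b0 m10 mulr0 addr0 in a0; rewrite e b1 m10 g10 mulr0 addr0 mul0r add0r in a1.
have -> : GLval g 0 1 * GLval x 1 0 =
    GLval x 0 0 * GLval m 0 0 - GLval g 0 0 * GLval x 0 0 by rewrite a0; ring.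
transitivity (GLval x 0 0 * (GLval g 1 1 * GLval x 1 0)
    - GLval g 0 0 * GLval x 0 0 * GLval x 1 0); first by ring.
by rewrite -a1; ring.
Qed.

Lemma val_Zp_mul (n : nat) (x y : 'I_n.+2) :
  val (x * y) = ((val x * val y) %% n.+2)%N.
Proof. by []. Qed.

Lemma val_Zp_eq (n : nat) (x y z t : 'I_n.+2) : x * (y * z) = x * (t * x) ->
  (val x * (val y * val z) = val x * (val t * val x) %[mod n.+2])%N.
Proof. by move/(congr1 val); rewrite !val_Zp_mul !modnMmr. Qed.

(* A conjugate of g lies in the level group only if the first column (x, y) of
   the conjugating matrix is an eigenvector of g, i.e. a zero of a quadratic
   form; in a basis containing one eigenvector the form is y (E x - B y). *)
Lemma card_conj_level (n d f : nat) (g : {'GL_2['I_n.+2]}) (c := n.+2) :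
  (d %| c)%N -> (forall k : nat, (k ^ 2 %| c * d)%N -> (k <= f)%N) ->
  (d * #|[set w | (w^-1 * g * w)%g \in level_group 'I_n.+2 d]|
   <= 4 * c ^ 3 * f * maxdiv c ^ 2 *
      \sum_(q <- divisors c | (d %| q) && scalar_mod_GL q g) q)%N.
Proof.
move=> dc fmax; set S := [set w | _].
have [->|[w0 w0S]] := set_0Vmem S; first by rewrite cards0 muln0.
set g0 := (w0^-1 * g * w0)%g.
have g0L : g0 \in level_group 'I_n.+2 d by move: w0S; rewrite inE.
have [g10 g01 gd _ _] := level_groupP g0L.
set B := GLval g0 0 1; set E := GLval g0 1 1 - GLval g0 0 0.
(* The form y (E x - B y) vanishes identically modulo this [q], and modulo the same [q] the
   triangular [g0], hence [g], is scalar. *)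
pose q := gcdn (gcdn (val E) (val B)) c.
have qc : (q %| c)%N by rewrite dvdn_gcdr.
have Ed : in_ideal d E by rewrite /E -opprB -mulN1r in_idealM.
have dq : (d %| q)%N.
  by rewrite !dvdn_gcd dc andbT -!in_ideal_val // Ed.
have gq : scalar_mod_GL q g.
  apply: (@scalar_mod_GLJ _ _ _ w0); rewrite -/g0 /scalar_mod_GL g10 in_ideal0 /=.
  rewrite (_ : _ - _ = - 1 * E); last by rewrite /E; ring.
  rewrite in_idealM ?andbT.
    by rewrite in_ideal_val // /q (dvdn_trans (dvdn_gcdl _ _)) // dvdn_gcdr.
  by rewrite in_ideal_val // /q (dvdn_trans (dvdn_gcdl _ _)) // dvdn_gcdl.
have qsum : (q <= \sum_(q <- divisors c | (d %| q) && scalar_mod_GL q g) q)%N.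
  rewrite (big_rem q) /=; last by rewrite -dvdn_divisors.
  by rewrite dq gq leq_addr.
apply: leq_trans (leq_mul (leqnn _) qsum).
have := card_quadric (c := c) (d := d) (f := f) (E := val E) (B := val B) isT dq fmax.
rewrite -/q; set P := [set p | _] => cP.
(* The first column of [w0^-1 * w] is a zero of the form; the second column is free and costs
   c^2. *)
suff cS : (#|S| <= #|P| * c ^ 2)%N.
  apply: (@leq_trans (d * #|P| * c ^ 2)); first by rewrite -mulnA leq_mul2l cS orbT.
  apply: leq_trans (leq_mul cP (leqnn _)) _.
  by apply: eq_leq; ring.
apply: (card_key (k := fun w : {'GL_2['I_n.+2]} =>
    (GLval (w0^-1 * w)%g 0 0, GLval (w0^-1 * w)%g 1 0))) => [w|p _].
  rewrite inE => /level_groupP[m10 _ _ _ _].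
  set x := (w0^-1 * w)%g; set m := (w^-1 * g * w)%g in m10.
  have e : (g0 * x)%g = (x * m)%g.
    by rewrite /g0 /x /m !mulgA !mulgK.
  have h := upper_triangular_eigenvector e g10 m10; rewrite -/E -/B in h.
  by rewrite in_set; apply/eqP/(val_Zp_eq h).
have -> : (c ^ 2 = size (enum [set: 'I_n.+2 * 'I_n.+2]))%N.
  by rewrite -cardE cardsT card_prod card_ord mulnn.
apply: (@card_inj_seq _ _ _ (fun w : {'GL_2['I_n.+2]} =>
    (GLval (w0^-1 * w)%g 0 1, GLval (w0^-1 * w)%g 1 1))); last first.
  by move=> w _; rewrite mem_enum in_setT.
move=> w v; rewrite !in_set => /andP[_ /eqP h1] /andP[_ /eqP h2] [h3 h4].
apply: (mulgI w0^-1%g).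
move: h1 h2 => <- [h5 h6].
by apply: GL2_inj.
Qed.

(** * Products of six steps *)

Lemma upperD (A : finComUnitRingType) (x y : A) :
  (upper x * upper y)%g = upper (x + y).
Proof.
apply: GL2_inj; rewrite !GL2_mul !upperE !mat2E; ring.
Qed.

Lemma upper0 (A : finComUnitRingType) : upper (0 : A) = 1%g.
Proof. by apply: (mulgI (upper 0)); rewrite upperD addr0 mulg1. Qed.

Lemma upperV (A : finComUnitRingType) (x : A) : ((upper x)^-1)%g = upper (- x).
Proof. by apply: (mulgI (upper x)); rewrite mulgV upperD subrr upper0. Qed.

Lemma weyl_conj_upper (A : finComUnitRingType) (a t : A) : a \is a GRing.unit ->
  (weyl a * upper t * (weyl a)^-1)%g = lower (t / a).
Proof.
move=> au; apply: (canLR (mulgK _)).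
apply: GL2_inj; rewrite !GL2_mul !upperE lowerE weylE // !mat2E; try ring.
by rewrite divrK //; ring.
Qed.

Definition step (A : finComUnitRingType) (T : nat) (a : A) (s : 'I_T * 'I_T) :
    {'GL_2[A]} :=
  (upper s.1%:R%R * (weyl a)^-1 * upper (- s.2%:R)%R)%g.

Lemma word6_product (A : finComUnitRingType) (q : nat) (x1 z1 x2 z2 x3 z3 : A) :
  scalar_mod_GL q (upper x1 * lower z1 * upper x2 * lower z2 * upper x3 * lower z3)%g ->
  let: (g00, g01, g10, g11) := word6 x1 z1 x2 z2 x3 z3 in
  [/\ in_ideal q g01, in_ideal q g10 & in_ideal q (g00 - g11)].
Proof.
have e : (upper x1 * lower z1 * upper x2 * lower z2 * upper x3 * lower z3
   = (upper x1 * lower z1 * upper x2) * (lower z2 * upper x3 * lower z3))%g.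
  by rewrite !mulgA.
rewrite {}e.
set P := (upper x1 * lower z1 * upper x2)%g; set Q := (lower z2 * upper x3 * lower z3)%g.
rewrite /scalar_mod_GL => /and3P[].
rewrite (GL2_mul P Q 0 0) (GL2_mul P Q 0 1) (GL2_mul P Q 1 0) (GL2_mul P Q 1 1).
have E1 i j : GLval P i j =
   mat2 (1 + x1 * z1) (x1 + x2 + x1 * z1 * x2) z1 (1 + z1 * x2) i j.
  congr (fun_of_matrix _ i j); apply: mat2P; rewrite /P /Q !GL2_mul !upperE !lowerE !mat2E; ring.
have E2 i j : GLval Q i j =
   mat2 (1 + x3 * z3) x3 (z2 + z3 + z2 * x3 * z3) (1 + z2 * x3) i j.
  congr (fun_of_matrix _ i j); apply: mat2P; rewrite /P /Q !GL2_mul !upperE !lowerE !mat2E; ring.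
by rewrite !E1 !E2 !mat2E.
Qed.

(* In the product of six steps the Weyl elements cancel in pairs and turn
   every other unipotent into a lower one, so up to conjugation only the
   differences of neighbouring shifts survive. *)
Lemma six_steps (A : finComUnitRingType) (T q : nat) (a : A)
    (s t : ('I_T * 'I_T) * ('I_T * 'I_T) * ('I_T * 'I_T)) :
  a \is a GRing.unit ->
  scalar_mod_GL q ((step a s.2 * (step a s.1.2)^-1 * step a s.1.1)^-1
                   * (step a t.2 * (step a t.1.2)^-1 * step a t.1.1))%g ->
  let: (g00, g01, g10, g11) :=
    word6 (s.1.1.2%:R - t.1.1.2%:R) (a^-1 * (s.1.2.1%:R - s.1.1.1%:R))
          (s.2.2%:R - s.1.2.2%:R) (a^-1 * (t.2.1%:R - s.2.1%:R))
          (t.1.2.2%:R - t.2.2%:R) (a^-1 * (t.1.1.1%:R - t.1.2.1%:R)) in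
  [/\ in_ideal q g01, in_ideal q g10 & in_ideal q (g00 - g11)].
Proof.
move=> au; case: s => [[[t1 s1] [t2 s2]] [t3 s3]]; case: t => [[[t1' s1'] [t2' s2']] [t3' s3']] /=.
move=> h; apply: word6_product; rewrite ![a^-1 * _]mulrC -!weyl_conj_upper //.
apply: (@scalar_mod_GLJ _ _ _ (upper (- s1'%:R))); move: h.
have d x y : upper (y - x) = (upper (- x) * upper y)%g by rewrite upperD addrC.
congr (is_true (scalar_mod_GL q _)).
rewrite /step /= !d !invMg !upperV !opprK !invgK !mulgA upperD subrr upper0 mul1g.
by [].
Qed.

Lemma ord_diff_subproof (T : nat) (i j : 'I_T) : (i + T - j < T.*2)%N.
Proof. by have := ltn_ord i; have := ltn_ord j; lia. Qed.

Definition ord_diff (T : nat) (i j : 'I_T) : 'I_T.*2 := Ordinal (ord_diff_subproof i j).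

Lemma bx_ord_diff (T : nat) (i j : 'I_T) : bx (ord_diff i j) = i%:Z - j%:Z.
Proof. by rewrite /bx /=; have := ltn_ord j; lia. Qed.

Lemma ord_diff_injl (T : nat) (i i' j : 'I_T) : ord_diff i j = ord_diff i' j -> i = i'.
Proof.
move=> h; have := congr1 (@bx T) h; rewrite !bx_ord_diff => e.
by apply/val_inj => /=; lia.
Qed.

Lemma word6_scalar_mod (n q : nat) (x1 z1 x2 z2 x3 z3 : int) : (q %| n.+2)%N ->
  (let: (g00, g01, g10, g11) := word6 (x1%:~R : 'I_n.+2) z1%:~R x2%:~R z2%:~R x3%:~R z3%:~R in
   [/\ in_ideal q g01, in_ideal q g10 & in_ideal q (g00 - g11)]) ->
  [exists l : 'I_q, scalar_mod q l%:Z (word6 x1 z1 x2 z2 x3 z3)].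
Proof.
move=> qc; rewrite /word6.
set g01 := _ * _ + _ * _; set g10 := _ * _ + _ * _.
set g00 := (X in in_ideal q (X - _)); set g11 := (X in in_ideal q (_ - X)).
set h00 := (X in (X, _, _, _)); set h01 := (X in (_, X, _, _)).
set h10 := (X in (_, _, X, _)); set h11 := (X in (_, _, _, X)).
have q0 : (0 < q)%N by apply: dvdn_gt0 qc.
have -> : g01 = h01%:~R by rewrite /g01 /h01 !(rmorphD, rmorphM, rmorph1).
have -> : g10 = h10%:~R by rewrite /g10 /h10 !(rmorphD, rmorphM, rmorph1).
have -> : g00 - g11 = (h00 - h11)%:~R.
  by rewrite rmorphB /g00 /h00 /g11 /h11 !(rmorphD, rmorphM, rmorph1).
rewrite !in_ideal_int // => -[d01 d10 d00].
have [r rE] : exists r : nat, (h00 %% q%:Z)%Z = r%:Z.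
  have : 0 <= (h00 %% q%:Z)%Z by apply: modz_ge0; rewrite eqz_nat -lt0n.
  by case: (h00 %% q%:Z)%Z => // r _; exists r.
have rq : (r < q)%N by rewrite -ltz_nat -rE ltz_pmod // ltz_nat.
have dr : (q%:Z %| h00 - r%:Z)%Z.
  by rewrite -rE -eqz_mod_dvd modz_mod.
apply/existsP; exists (Ordinal rq); rewrite /scalar_mod /= dr d01 d10 /=.
have -> : h11 - r%:Z = (h00 - r%:Z) - (h00 - h11) by ring.
exact: rpredB.
Qed.

(** Twelve shifts enter only through six differences. A difference and one of its ends determine the
    other end, so each box point has at most T^6 preimages. *)
Lemma card_scalar_six_steps (n q T : nat) (a : 'I_n.+2) (c := n.+2) :
  a \is a GRing.unit -> (q %| c)%N -> (T ^ 2 <= c)%N ->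
  (q ^ 3 * #|[set st : (('I_T * 'I_T) * ('I_T * 'I_T) * ('I_T * 'I_T)) *
                       (('I_T * 'I_T) * ('I_T * 'I_T) * ('I_T * 'I_T)) |
      scalar_mod_GL q ((step a st.1.2 * (step a st.1.1.2)^-1 * step a st.1.1.1)^-1
                   * (step a st.2.2 * (step a st.2.1.2)^-1 * step a st.2.1.1))%g]|
   <= T ^ 6 * (2688 * maxdiv c ^ 4 * c ^ 2 * (c + q ^ 2)))%N.
Proof.
move=> au qc Tc; set X := [set st | _].
pose b := (val a^-1)%:Z; pose a' := (val a)%:Z.
have bE : b%:~R = a^-1 :> 'I_n.+2 by rewrite /b -pmulrn natr_val.
have aE : a'%:~R = a :> 'I_n.+2 by rewrite /a' -pmulrn natr_val.
have cab : (c%:Z %| a' * b - 1)%Z.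
  rewrite -(@in_ideal_int n c) // rmorphB rmorphM /= aE bE divrr // subrr.
  exact: in_ideal0.
have := card_scalar_words (isT : 0 < c)%N qc Tc cab.
set A := [set s | _] => cA.
suff cX : (#|X| <= #|A| * T ^ 6)%N.
  apply: (@leq_trans (q ^ 3 * #|A| * T ^ 6)); first by rewrite -mulnA leq_mul2l cX orbT.
  by rewrite mulnC leq_mul2l cA orbT.
pose S6 := (('I_T * 'I_T) * ('I_T * 'I_T) * ('I_T * 'I_T))%type.
pose key (st : S6 * S6) :=
  (((ord_diff st.1.1.1.2 st.2.1.1.2, ord_diff st.1.1.2.1 st.1.1.1.1),
    (ord_diff st.2.1.2.2 st.2.2.2, ord_diff st.2.2.1 st.1.2.1)),
   (ord_diff st.1.2.2 st.1.1.2.2, ord_diff st.2.1.1.1 st.2.1.2.1)).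
have castE (i j : 'I_T) : i%:R - j%:R = (bx (ord_diff i j))%:~R :> 'I_n.+2.
  by rewrite bx_ord_diff rmorphB /= -!pmulrn.
apply: (card_key (k := key)) => [st|i _].
  rewrite [st \in X]in_set => /(six_steps au) h; rewrite in_set.
  by rewrite !castE -bE -!rmorphM /= in h; apply: word6_scalar_mod qc h.
have -> : (T ^ 6 = size (enum [set: 'I_T * 'I_T * ('I_T * 'I_T) * ('I_T * 'I_T)]))%N.
  by rewrite -cardE cardsT !card_prod card_ord; ring.
apply: (@card_inj_seq _ _ _ (fun st : S6 * S6 =>
   ((st.2.1.1.2, st.1.1.1.1), (st.1.1.2.2, st.1.2.1), (st.2.2.2, st.2.1.2.1)))); last first.
  by move=> st _; rewrite mem_enum in_setT.
move=> st st'; rewrite !in_set => /andP[_ /eqP h] /andP[_ /eqP h'].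
move: h'; rewrite -{}h {i}.
move: st st' => [[[[t1 s1] [t2 s2]] [t3 s3]] [[[u1 v1] [u2 v2]] [u3 v3]]].
move=> [[[[t1' s1'] [t2' s2']] [t3' s3']] [[[u1' v1'] [u2' v2']] [u3' v3']]].
rewrite /key /= => h e.
case: e h => -> -> -> -> -> -> h.
have k1 := congr1 (fun k => k.1.1.1) h; have k2 := congr1 (fun k => k.1.1.2) h.
have k3 := congr1 (fun k => k.1.2.1) h; have k4 := congr1 (fun k => k.1.2.2) h.
have k5 := congr1 (fun k => k.2.1) h; have k6 := congr1 (fun k => k.2.2) h.
rewrite /= in k1 k2 k3 k4 k5 k6.
by rewrite (ord_diff_injl k1) (ord_diff_injl k2) (ord_diff_injl k3) (ord_diff_injl k4)
  (ord_diff_injl k5) (ord_diff_injl k6).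
Qed.

Lemma leq_sum_seq_const (I : eqType) (r : seq I) (P : pred I) (F : I -> nat) (B : nat) :
  (forall i, i \in r -> P i -> F i <= B)%N ->
  (\sum_(i <- r | P i) F i <= size r * B)%N.
Proof.
elim: r => [|i r IHr] h; first by rewrite big_nil.
rewrite big_cons mulSn; case: ifP => Pi.
  apply: leq_add; first by apply: h; rewrite ?mem_head.
  by apply: IHr => j jr; apply: h; rewrite inE jr orbT.
apply: leq_trans (leq_addl _ _); apply: IHr => j jr; apply: h.
by rewrite inE jr orbT.
Qed.

(** Exchange the sum over words with the sum over the levels q of scalarity. The weight of level q
    is proportional to (c + q^2) / q^2, which decreases in q, so that each of the divisors q is
    bounded by the value at q = d. The exponent of the divisor function is 2 + 1 + 4: fixed points,
    choice of q, words. *)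
Lemma hilbert_schmidt_count (n d f T : nat) (a : 'I_n.+2) (c := n.+2) :
  a \is a GRing.unit -> (d %| c)%N -> (T ^ 2 <= c)%N ->
  (forall k : nat, (k ^ 2 %| c * d)%N -> (k <= f)%N) ->
  (d ^ 3 * \sum_(s : ('I_T * 'I_T) * ('I_T * 'I_T) * ('I_T * 'I_T))
     \sum_(t : ('I_T * 'I_T) * ('I_T * 'I_T) * ('I_T * 'I_T))
     #|[set w | (w^-1 * ((step a s.2 * (step a s.1.2)^-1 * step a s.1.1)^-1
                   * (step a t.2 * (step a t.1.2)^-1 * step a t.1.1)) * w)%g
          \in level_group 'I_n.+2 d]|
   <= 4 * 2688 * maxdiv c ^ 7 * c ^ 5 * f * T ^ 6 * (c + d ^ 2))%N.
Proof.
move=> au dc Tc fmax.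
have d0 : (0 < d)%N by apply: dvdn_gt0 dc.
set D := maxdiv c; rewrite pair_bigA /=.
pose g (st : (('I_T * 'I_T) * ('I_T * 'I_T) * ('I_T * 'I_T)) *
                       (('I_T * 'I_T) * ('I_T * 'I_T) * ('I_T * 'I_T))) :=
  ((step a st.1.2 * (step a st.1.1.2)^-1 * step a st.1.1.1)^-1
                   * (step a st.2.2 * (step a st.2.1.2)^-1 * step a st.2.1.1))%g.
pose N q := #|[set st | scalar_mod_GL q (g st)]|.
have h1 : (d * \sum_st #|[set w | (w^-1 * g st * w)%g \in level_group 'I_n.+2 d]| <=
    4 * c ^ 3 * f * D ^ 2 * \sum_(q <- divisors c | d %| q) q * N q)%N.
  rewrite big_distrr /=.
  apply: leq_trans (leq_sum _ (fun st _ => card_conj_level (g st) dc fmax)) _.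
  rewrite -big_distrr leq_mul2l /=; apply/orP; right.
  rewrite (exchange_big_dep (fun q => d %| q)%N) /=; last by move=> st q _ /andP[].
  apply: leq_sum => q dq; under eq_bigl do rewrite dq.
  by rewrite sum_nat_const mulnC /N cardsE.
pose M := (T ^ 6 * (2688 * D ^ 4 * c ^ 2))%N.
have h2 : (d ^ 2 * \sum_(q <- divisors c | d %| q) q * N q <= D * (M * (c + d ^ 2)))%N.
  rewrite big_distrr /=.
  apply: leq_trans (leq_mul (maxdivP (leqnn c)) (leqnn _)).
  apply: leq_sum_seq_const => q; rewrite -dvdn_divisors // => qc dq.
  have q0 : (0 < q)%N by apply: dvdn_gt0 qc.
  have dleq : (d <= q)%N by apply: dvdn_leq.
  have := card_scalar_six_steps au qc Tc; rewrite -/(N q) -/c -/D mulnA -/M => h.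
  have q20 : (0 < q ^ 2)%N by rewrite expn_gt0 q0.
  rewrite -(leq_pmul2l q20).
  apply: (@leq_trans (d ^ 2 * (M * (c + q ^ 2)))).
    apply: leq_trans (leq_mul (leqnn (d ^ 2)) h).
    by apply: eq_leq; ring.
  have -> : (q ^ 2 * (M * (c + d ^ 2)) = M * (q ^ 2 * c + q ^ 2 * d ^ 2))%N by ring.
  have -> : (d ^ 2 * (M * (c + q ^ 2)) = M * (d ^ 2 * c + q ^ 2 * d ^ 2))%N by ring.
  by rewrite leq_mul2l leq_add2r leq_mul2r leq_exp2r // dleq !orbT.
rewrite expnSr -mulnA.
apply: leq_trans (leq_mul (leqnn (d ^ 2)) h1) _; rewrite mulnCA.
apply: leq_trans (leq_mul (leqnn _) h2) _.
rewrite /M; set X := (c + d ^ 2)%N; move: (X) (D) (c) => X' D' c'.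
by apply: eq_leq; ring.
Qed.

(** * The shifted bilinear form *)

Definition shifted_form (R : rcfType) (A : finComUnitRingType) (T : nat)
    (phi : 'I_T * 'I_T -> R[i]) (f g : A -> R[i]) (a : A) : R[i] :=
  \sum_s phi s * \sum_(z in units A) f (z + s.1%:R) * g (a / z + s.2%:R).

(** Substitute [upper s.2 * weyl a * w] for [w]: the step then collapses to [upper s.1], and both
    unipotents become additive shifts inside [lift_bilinear]. *)
Lemma shifted_formE (R : rcfType) (A : finComUnitRingType) (T : nat)
    (phi : 'I_T * 'I_T -> R[i]) (f g : A -> R[i]) (a : A) :
  a \is a GRing.unit ->
  #|base_fiber A|%:R * shifted_form phi f g a =
  \sum_w lift g w * gop phi (step a) (lift f) w.
Proof.
move=> au; rewrite /shifted_form /gop mulr_sumr.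
under [RHS]eq_bigr do rewrite mulr_sumr.
rewrite [RHS]exchange_big; apply: eq_bigr => s _.
rewrite mulrCA -(lift_bilinear (fun z => f (z + s.1%:R)) (fun z => g (z + s.2%:R)) au).
rewrite mulr_sumr [RHS](reindex_inj (mulgI (upper s.2%:R%R * weyl a)%g)) /=.
apply: eq_bigr => w _.
have -> : (step a s * (upper s.2%:R%R * weyl a * w) = upper s.1%:R%R * w)%g.
  rewrite /step -!mulgA (mulgA (upper (- _))) upperD addNr upper0 mul1g.
  by rewrite mulKg.
by rewrite -[(upper _ * weyl a * w)%g]mulgA !lift_upper; ring.
Qed.

Lemma minn_harmonic (c m : nat) : (minn c m * (c + m) <= 2 * (c * m))%N.
Proof.
have [h|h] := leqP c m; first by rewrite mulnDr mul2n -addnn leq_add2r leq_mul2l h orbT.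
by rewrite mulnDr mul2n -addnn [(m * c)%N]mulnC leq_add2l leq_mul2r (ltnW h) orbT.
Qed.

Lemma shifted_form_bound0 (R : rcfType) (n d f T : nat) (psi alpha beta : 'I_n.+2 -> R[i])
    (phi : 'I_T * 'I_T -> R[i]) (a : 'I_n.+2) (c := n.+2) :
  add_char psi -> (forall r, alpha r != 0 -> r \is a GRing.unit) ->
  a \is a GRing.unit -> (forall s, normc (phi s) <= 1) ->
  (d %| c)%N -> (T ^ 2 <= c)%N ->
  (forall k : nat, (k ^ 2 %| c * d)%N -> (k <= f)%N) ->
  nsq (shifted_form phi (fourier psi alpha) (fourier psi beta) a) ^+ 3
    * (totient c ^ 15 * d ^ 2)%N%:R
  <= (c ^ 18 * (4 * 2688 * maxdiv c ^ 7 * c ^ 5 * f * T ^ 6 * (c + d ^ 2)))%N%:R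
     * norm2 alpha ^+ 3 * norm2 beta ^+ 3.
Proof.
move=> psiP asupp au phi1 dc Tc fmax.
have d0 : (0 < d)%N by apply: dvdn_gt0 dc.
set B := shifted_form _ _ _ _.
have HSd := hilbert_schmidt_count au dc Tc fmax.
set HS := (\sum_s \sum_t _)%N in HSd; set H := (4 * 2688 * _ * _ * _ * _ * _)%N in HSd *.
pose u : {'GL_2['I_n.+2]} -> R[i] := lift (fourier psi alpha).
pose v : {'GL_2['I_n.+2]} -> R[i] := lift (fourier psi beta).
pose G : R := #|{: {'GL_2['I_n.+2]}}|%:R.
pose K := level_group 'I_n.+2 d.
pose N0 : R := #|base_fiber 'I_n.+2|%:R.
pose F : R := (totient c)%:R.
have F0 : 0 < F by rewrite ltr0n totient_gt0.
have c0 : 0 < c%:R :> R by rewrite ltr0n.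
have cardc : #|'I_n.+2| = c by rewrite card_ord.
(* The [d] elements annihilated by [d], as [lift_level] demands. *)
pose y (j : 'I_d) : 'I_n.+2 := (c %/ d * j)%:R.
have yinj : injective y.
  move=> i j /(congr1 val); rewrite !val_natr.
  have ylt (k : 'I_d) : (c %/ d * k < n.+2)%N.
    by rewrite -[X in (_ < X)%N](divnK dc) ltn_pmul2l // divn_gt0 // dvdn_leq.
  rewrite !modn_small ?ylt // => /eqP; rewrite eqn_pmul2l; last first.
    by rewrite divn_gt0 // dvdn_leq.
  by move/eqP/val_inj.
have dy j : d%:R * y j = 0.
  by rewrite -natrM mulnA [(d * _)%N]mulnC divnK // natrM natr_char mul0r.
pose Theta := G * c%:R * norm2 alpha / F.
have na := norm2_ge0 alpha; have nb := norm2_ge0 beta.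
have G0 : 0 <= G by rewrite ler0n.
have T0 : 0 <= Theta by rewrite divr_ge0 ?(ltW F0) // mulr_ge0 // mulr_ge0 // ltW.
have frame (xi : 'I_d -> R[i]) :
    norm2 (fun w => \sum_j xi j * u (w * lower (y j))%g) <= Theta * norm2 xi.
  have := lift_frame xi psiP yinj asupp; rewrite card_units cardc -/F -/G => h.
  by rewrite -(ler_pM2l F0); apply: le_trans h _; rewrite /Theta mulrA mulrCA divff ?mulr1 ?gt_eqF.
have amp := amplification (step a) T0 phi1 (fun j k w kK => lift_level (fourier psi alpha) w (dy j) kK)
  (@level_group_div _ d) frame.
rewrite -/HS -/K card_ord in amp.
have normu : norm2 u <= G * norm2 alpha.
  rewrite -(ler_pM2l c0) -{1}cardc; apply: le_trans (norm2_lift _) _.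
  by rewrite norm2_fourier // cardc -/G mulrCA.
have normv : norm2 v <= G * norm2 beta.
  rewrite -(ler_pM2l c0) -{1}cardc; apply: le_trans (norm2_lift _) _.
  by rewrite norm2_fourier // cardc -/G mulrCA.
set X := norm2 (gop phi (step a) u) in amp.
have hB : nsq (N0%:C%C * B) <= norm2 v * X.
  by rewrite /N0 rmorph_nat shifted_formE //; exact: cauchy_schwarz.
have X0 : 0 <= X by apply: norm2_ge0.
have nu0 : 0 <= norm2 u by apply: norm2_ge0.
have nv0 : 0 <= norm2 v by apply: norm2_ge0.
have B0 : 0 <= nsq B by apply: nsq_ge0.
have hN0 : F ^+ 2 * c%:R <= N0.
  have := card_base_fiber 'I_n.+2; rewrite card_units cardc.
  by rewrite -natrX -natrM ler_nat.
have hK : F ^+ 2 * c%:R <= d%:R ^+ 2 * #|K|%:R.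
  have := card_level_group dc.
  by rewrite -!natrX -!natrM ler_nat.
have hG : G <= c%:R ^+ 4.
  by rewrite -natrX ler_nat card_GL2.
have hHS : d%:R ^+ 3 * HS%:R <= H%:R :> R.
  by rewrite -natrX -natrM ler_nat.
have HS0 : 0 <= HS%:R :> R by rewrite ler0n.
have step1 : N0 ^+ 6 * nsq B ^+ 3 * (#|K|%:R * d%:R) <=
    (G ^+ 6 * (c%:R / F) * norm2 alpha ^+ 3 * norm2 beta ^+ 3) * HS%:R.
  have e : N0 ^+ 6 * nsq B ^+ 3 = nsq (N0%:C%C * B) ^+ 3.
    by rewrite nsqM nsq_real; ring.
  rewrite e; apply: (@le_trans _ _ ((norm2 v * X) ^+ 3 * (#|K|%:R * d%:R))).
    rewrite ler_wpM2r ?mulr_ge0 ?ler0n //.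
    by apply: lerXn2r; rewrite ?nnegrE ?nsq_ge0 ?mulr_ge0.
  have -> : (norm2 v * X) ^+ 3 * (#|K|%:R * d%:R) =
    norm2 v ^+ 3 * (#|K|%:R * d%:R * X ^+ 3) by ring.
  apply: le_trans (ler_wpM2l (exprn_ge0 _ nv0) amp) _.
  apply: (@le_trans _ _ ((G * norm2 beta) ^+ 3 * ((G * norm2 alpha) ^+ 2 * (Theta * HS%:R)))).
    apply: ler_pM; first exact: exprn_ge0.
    - by rewrite mulr_ge0 ?exprn_ge0 // mulr_ge0.
    - by apply: lerXn2r; rewrite ?nnegrE ?mulr_ge0.
    apply: ler_wpM2r; first by rewrite mulr_ge0.
    by apply: lerXn2r; rewrite ?nnegrE ?mulr_ge0.
  by rewrite le_eqVlt; apply/orP; left; apply/eqP; rewrite /Theta; ring.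
have F1 : F != 0 by rewrite gt_eqF.
have d1 : d%:R != 0 :> R by rewrite pnatr_eq0 -lt0n.
have dR : 0 < d%:R :> R by rewrite ltr0n.
(* Of the fifteen powers of the totient, twelve come from [N0 ^+ 6], two from the level group and
   one from [Theta]. The net d^2 is d from the number of translates and d^3 from the count, less d^2
   for the size of the level group. *)
have step2 : (F ^+ 2 * c%:R) ^+ 6 * nsq B ^+ 3 * (F ^+ 2 * c%:R * d%:R ^+ 2) <=
   (c%:R ^+ 4) ^+ 6 * (c%:R / F) * norm2 alpha ^+ 3 * norm2 beta ^+ 3 * H%:R.
  have Fc : 0 <= F ^+ 2 * c%:R by rewrite mulr_ge0 ?exprn_ge0 ?(ltW F0) ?(ltW c0).
  have W0 : 0 <= norm2 alpha ^+ 3 * norm2 beta ^+ 3 by rewrite mulr_ge0 ?exprn_ge0.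
  have cF0 : 0 <= c%:R / F by rewrite divr_ge0 ?ltW.
  apply: (@le_trans _ _ (N0 ^+ 6 * nsq B ^+ 3 * ((d%:R ^+ 2 * #|K|%:R) * d%:R ^+ 2))).
    have B30 : 0 <= nsq B ^+ 3 by apply: exprn_ge0.
    have d20 : 0 <= d%:R ^+ 2 :> R by apply: exprn_ge0; apply: ltW.
    apply: ler_pM.
    - by rewrite mulr_ge0 // exprn_ge0.
    - by rewrite mulr_ge0.
    - by apply: ler_wpM2r => //; apply: lerXn2r; rewrite ?nnegrE // ler0n.
    exact: ler_wpM2r.
  have -> : N0 ^+ 6 * nsq B ^+ 3 * (d%:R ^+ 2 * #|K|%:R * d%:R ^+ 2) =
    d%:R ^+ 3 * (N0 ^+ 6 * nsq B ^+ 3 * (#|K|%:R * d%:R)) by ring.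
  apply: le_trans (ler_wpM2l (exprn_ge0 3 (ltW dR)) step1) _.
  rewrite mulrCA; apply: ler_pM; last by [].
  - by rewrite -(mulrA (G ^+ 6 * _)) mulr_ge0 // mulr_ge0 // exprn_ge0.
  - by rewrite mulr_ge0 // exprn_ge0 // ltW.
  do 2 (apply: ler_wpM2r; first exact: exprn_ge0).
  apply: ler_wpM2r => //; apply: lerXn2r; last by [].
    by rewrite nnegrE.
  by rewrite nnegrE; exact: exprn_ge0 (ltW c0).
rewrite -(ler_pM2r (exprn_gt0 7 c0)).
rewrite -(ler_pM2r F0) in step2.
apply: le_trans (le_trans step2 _); rewrite le_eqVlt; apply/orP; left; apply/eqP.
  by rewrite natrM !natrX -/F; ring.
rewrite (natrM _ (c ^ 18) H) (natrX _ c 18).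
by field.
Qed.

Lemma shifted_form_bound (R : rcfType) (n d f T : nat) (psi alpha beta : 'I_n.+2 -> R[i])
    (phi : 'I_T * 'I_T -> R[i]) (a : 'I_n.+2) (c := n.+2) :
  add_char psi -> (forall r, alpha r != 0 -> r \is a GRing.unit) ->
  a \is a GRing.unit -> (forall s, normc (phi s) <= 1) ->
  (d %| c)%N -> (T ^ 2 <= c)%N ->
  (forall k : nat, (k ^ 2 %| c * d)%N -> (k <= f)%N) ->
  nsq (shifted_form phi (fourier psi alpha) (fourier psi beta) a) ^+ 3
    * (minn c (d ^ 2))%:R
  <= (8 * 2688)%:R * (maxdiv c)%:R ^+ 22 * c%:R ^+ 9 * f%:R * T%:R ^+ 6
     * norm2 alpha ^+ 3 * norm2 beta ^+ 3.
Proof.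
move=> psiP asupp au phi1 dc Tc fmax.
have d0 : (0 < d)%N by apply: dvdn_gt0 dc.
have := shifted_form_bound0 beta psiP asupp au phi1 dc Tc fmax.
set b := nsq _ ^+ 3; rewrite -/c.
have b0 : 0 <= b by rewrite exprn_ge0 // nsq_ge0.
have na := norm2_ge0 alpha; have nb := norm2_ge0 beta.
move: na nb; set x := norm2 alpha; set y := norm2 beta => x0 y0.
(* Trading the totients for powers of c adds 15 to the exponent 7 of the divisor function, whence
   22. *)
have tD : (c ^ 15 <= totient c ^ 15 * maxdiv c ^ 15)%N.
  by rewrite -expnMn leq_exp2r // leq_totient_maxdiv.
have mh := minn_harmonic c (d ^ 2).
have c0 : (0 < c)%N by [].
clearbody c b x y; clear -d0 b0 x0 y0 tD mh c0.
set D := maxdiv c in tD *; set m := minn _ _ in mh *; set t := totient c in tD *.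
clearbody D m t.
have cR : 0 < c%:R :> R by rewrite ltr0n.
have dR : 0 < d%:R :> R by rewrite ltr0n.
move=> h.
rewrite -(ler_pM2r (exprn_gt0 15 cR)) -(ler_pM2r (exprn_gt0 2 dR)).
apply: (@le_trans _ _ (b * (t ^ 15 * d ^ 2)%N%:R * (m%:R * D%:R ^+ 15))).
  have -> : b * m%:R * c%:R ^+ 15 * d%:R ^+ 2 = b * m%:R * d%:R ^+ 2 * (c ^ 15)%N%:R.
    by rewrite natrX; ring.
  have -> : b * (t ^ 15 * d ^ 2)%N%:R * (m%:R * D%:R ^+ 15) =
     b * m%:R * d%:R ^+ 2 * (t ^ 15 * D ^ 15)%N%:R.
    by rewrite !(natrM _ (t ^ 15)) !natrX; ring.
  by rewrite ler_wpM2l ?ler_nat // mulr_ge0 ?exprn_ge0 ?ler0n // mulr_ge0.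
apply: le_trans (ler_wpM2r _ h) _; first by rewrite mulr_ge0 ?exprn_ge0.
have -> : (c ^ 18 * (4 * 2688 * D ^ 7 * c ^ 5 * f * T ^ 6 * (c + d ^ 2)))%N%:R
    * x ^+ 3 * y ^+ 3 * (m%:R * D%:R ^+ 15) =
   (4 * 2688)%:R * D%:R ^+ 22 * c%:R ^+ 23 * f%:R * T%:R ^+ 6 * x ^+ 3 * y ^+ 3
     * (m * (c + d ^ 2))%N%:R.
  by rewrite !(natrX, natrM, natrD); ring.
have -> : (8 * 2688)%:R * D%:R ^+ 22 * c%:R ^+ 9 * f%:R * T%:R ^+ 6 * x ^+ 3 * y ^+ 3
    * c%:R ^+ 15 * d%:R ^+ 2 =
   (4 * 2688)%:R * D%:R ^+ 22 * c%:R ^+ 23 * f%:R * T%:R ^+ 6 * x ^+ 3 * y ^+ 3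
     * (2 * (c * d ^ 2))%N%:R.
  by rewrite !(natrX, natrM, natrD); ring.
move: (4 * 2688)%:R (ler0n R (4 * 2688)) => K K0.
by apply: ler_wpM2l; rewrite ?ler_nat // !mulr_ge0 ?exprn_ge0 ?ler0n.
Qed.

(** * Kloosterman sums *)

Lemma eD (R : realType) (x y : R) : e (x + y) = e x * e y.
Proof.
rewrite /e mulrDr cosD sinD; apply/eqP; rewrite eq_complex /=.
by rewrite [sin _ * cos _ + _]addrC eqxx eqxx.
Qed.

Lemma e0 (R : realType) : e (0 : R) = 1.
Proof. by rewrite /e mulr0 cos0 sin0. Qed.

Lemma normc_e (R : realType) (x : R) : normc (e x) = 1.
Proof. by rewrite /e /normc cos2Dsin2 sqrtr1. Qed.

Lemma e_int (R : realType) (k : int) : e (k%:~R : R) = 1.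
Proof.
have e1 : e (1 : R) = 1.
  by rewrite /e mulr1 mulr_natl cos2pi sin2pi.
have en (j : nat) : e (j%:R : R) = 1.
  elim: j => [|j IHj]; first exact: e0.
  by rewrite -addn1 natrD eD IHj e1 mulr1.
case: k => j; first exact: en.
have h : e (- j.+1%:R : R) * e (j.+1%:R) = 1 by rewrite -eD addNr e0.
by move: h; rewrite en mulr1 NegzE mulrNz.
Qed.

Lemma e_neq1 (R : realType) (x : R) : 0 < x < 1 -> e x != 1.
Proof.
move=> /andP[x0 x1]; apply/eqP; rewrite /e => -[cx _].
have s0 : 0 < sin (trigo.pi * x) :> R.
  apply: sin_gt0_pi; rewrite mulr_gt0 ?pi_gt0 //=.
  by rewrite -[ltRHS]mulr1 ltr_pM2l ?pi_gt0.
have := cos2Dsin2 (trigo.pi * x).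
move: cx; rewrite -mulrA mulr_natl cos_mulr2n => cx h.
have : sin (trigo.pi * x) ^+ 2 = 0 by lra.
by move/eqP; rewrite sqrf_eq0 gt_eqF.
Qed.

(** Only signs are used: cos is positive at the angle and at its double, so 2 cos^2 > 1 and cos >
    1/2, without a numerical estimate of pi. *)
Lemma Re_e_ge (R : realType) (x : R) : 16 * `|x| <= 1 -> 2^-1 <= complex.Re (e x).
Proof.
rewrite /e /= => hx.
have hp := pi_gt0 R.
have xb : - (16^-1) <= x <= 16^-1 by rewrite -ler_norml; lra.
move: xb => /andP[xb1 xb2].
have c1 : 0 < cos (2 * trigo.pi * x).
  by apply: cos_gt0_pihalf; apply/andP; split; nra.
have c2 : 0 < cos ((2 * trigo.pi * x) *+ 2).
  by apply: cos_gt0_pihalf; apply/andP; split; rewrite -mulr_natl; nra.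
by rewrite cos_mulr2n in c2; nra.
Qed.

Definition echar (R : realType) (c : nat) (k : int) : R[i] := e (k%:~R / c%:R).

Lemma echarD (R : realType) (c : nat) (k l : int) :
  echar R c (k + l) = echar R c k * echar R c l.
Proof. by rewrite /echar rmorphD mulrDl eD. Qed.

Lemma echar_dvd (R : realType) (c : nat) (k : int) :
  (0 < c)%N -> (c%:Z %| k)%Z -> echar R c k = 1.
Proof.
move=> c0 /dvdzP[j ->]; rewrite /echar rmorphM /= -pmulrn mulfK ?e_int //.
by rewrite pnatr_eq0 -lt0n.
Qed.

Lemma echar_mod (R : realType) (c : nat) (k l : int) :
  (0 < c)%N -> (c%:Z %| k - l)%Z -> echar R c k = echar R c l.
Proof.
by move=> c0 h; rewrite -[k](subrK l) echarD echar_dvd // mul1r.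
Qed.

Lemma echar_scale (R : realType) (p c : nat) (k : int) :
  (0 < p)%N -> echar R (p * c) (p%:Z * k) = echar R c k.
Proof.
move=> p0; rewrite /echar rmorphM natrM /= -pmulrn; congr e.
by rewrite -mulf_div divff ?mul1r // pnatr_eq0 -lt0n.
Qed.

Lemma echar_neq1 (R : realType) (c : nat) (k : int) :
  (0 < c)%N -> ~~ (c%:Z %| k)%Z -> echar R c k != 1.
Proof.
move=> c0 ck.
have cz : c%:Z != 0 by rewrite eqz_nat -lt0n.
rewrite (@echar_mod _ c _ (k %% c%:Z)%Z) //; last by rewrite -eqz_mod_dvd modz_mod.
have r0 : 0 <= (k %% c%:Z)%Z by apply: modz_ge0.
have r1 : (k %% c%:Z)%Z < c%:Z by rewrite ltz_pmod // ltz_nat.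
have r2 : (k %% c%:Z)%Z != 0 by apply: contra ck => /eqP h; apply/dvdz_mod0P.
have cR : 0 < c%:R :> R by rewrite ltr0n.
apply: e_neq1; rewrite divr_gt0 //=; last by rewrite ltr0z lt_def r2.
by rewrite ltr_pdivrMr // mul1r -(ltr_int R) in r1 *.
Qed.

Definition Zp_char (R : realType) (n : nat) (x : 'I_n.+2) : R[i] :=
  echar R n.+2 (val x)%:Z.

Lemma Zp_char_int (R : realType) (n : nat) (k : int) :
  Zp_char R (k%:~R : 'I_n.+2) = echar R n.+2 k.
Proof.
apply: echar_mod => //.
rewrite -(@in_ideal_int n n.+2) // rmorphB /= -pmulrn natr_val subrr.
exact: in_ideal0.
Qed.

Lemma Zp_char_add_char (R : realType) (n : nat) : add_char (@Zp_char R n).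
Proof.
have D x y : Zp_char R (x + y : 'I_n.+2) = Zp_char R x * Zp_char R y.
  rewrite -[x in LHS]natr_val -[y in LHS]natr_val !pmulrn -rmorphD Zp_char_int.
  by rewrite echarD.
split=> [//|x|r r0]; first exact: normc_e.
have r1 : Zp_char R r != 1.
  apply: echar_neq1 => //; apply: contra r0; rewrite dvdzE /= => h.
  move/dvdnP: h => [k h].
  by rewrite -[r]natr_val (_ : val r = (k * n.+2)%N) // natrM natr_char mulr0.
set S := \sum_x _.
have SE : S = Zp_char R r * S.
  rewrite {1}/S (reindex_inj (addrI 1)) /= /S mulr_sumr.
  by apply: eq_bigr => x _; rewrite mulrDr mulr1 D.
apply/eqP; have : (1 - Zp_char R r) * S = 0 by rewrite mulrBl mul1r -SE subrr.
by move/eqP; rewrite mulf_eq0 subr_eq0 eq_sym (negPf r1).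
Qed.

Lemma modinv_int (n : nat) (x : 'I_n.+2) : x \is a GRing.unit ->
  (modinv n.+2 (val x))%:~R = x^-1.
Proof.
move=> xu; have cop : coprime (val x) n.+2 by rewrite -unit_val.
have := modinvP cop; move: (modinv _ _) => k /eqP; rewrite eqz_mod_dvd.
rewrite -(@in_ideal_int n n.+2) // => /in_idealP[z]; rewrite natr_char mul0r.
rewrite rmorphB rmorphM /= -pmulrn natr_val => /eqP; rewrite subr_eq0 => /eqP h.
by apply: (mulrI xu); rewrite h divrr.
Qed.

Lemma kloosterman_Zp (R : realType) (n : nat) (k l : int) :
  kloosterman R k l n.+2 =
  \sum_(x in units 'I_n.+2) Zp_char R (k%:~R * x + l%:~R * x^-1).
Proof.
rewrite /kloosterman; apply: eq_big => [x|x cop].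
  by rewrite inE unit_val.
rewrite -/(echar R n.+2 _) -Zp_char_int rmorphD !rmorphM /=.
by rewrite modinv_int ?unit_val // -pmulrn natr_val.
Qed.

(** * Averaging over shifts *)

Lemma ler_Re_normc (R : rcfType) (z : R[i]) : complex.Re z <= normc z.
Proof.
case: z => a b; rewrite /normc /=; apply: le_trans (ler_norm a) _.
by rewrite -sqrtr_sqr ler_wsqrtr // lerDl sqr_ge0.
Qed.

Definition dirichlet_sum (R : realType) (c T : nat) (k : int) : R[i] :=
  \sum_(t < T) echar R c (k * t%:Z).

(** The alternative T = 1 is the trivial average, available even for an interval too long compared
    with [c]. Otherwise the phases stay within 1/16 of 0. *)
Definition near_residue (c T : nat) (m0 r : int) : Prop :=
  T = 1%N \/ exists m : int, (c%:Z %| m - r)%Z /\ (16 * T * absz (m - m0) <= c)%N.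

Lemma dirichlet_sum_ge (R : realType) (c T : nat) (m0 r : int) :
  (0 < c)%N -> near_residue c T m0 r ->
  T%:R / 2 <= normc (dirichlet_sum R c T (r - m0)).
Proof.
move=> c0 [->|[m [cm hm]]].
  rewrite /dirichlet_sum big_ord1 echar_dvd ?normc1 //=; first by lra.
  by rewrite mulr0 dvdz0.
apply: le_trans (ler_Re_normc _).
have -> : dirichlet_sum R c T (r - m0) = \sum_(t < T) echar R c ((m - m0) * t%:Z).
  apply: eq_bigr => t _; apply: echar_mod => //; rewrite -mulrBl dvdz_mulr //.
  by rewrite (_ : _ - _ = - (m - r)) ?rpredN //; ring.
rewrite raddf_sum.
apply: (@le_trans _ _ (\sum_(t < T) 2^-1)); first by rewrite sumr_const card_ord mulr_natl.
apply: ler_sum => t _; apply: Re_e_ge.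
have cR : 0 < c%:R :> R by rewrite ltr0n.
rewrite normrM normfV (gtr0_norm cR) mulrA ler_pdivrMr // mul1r.
rewrite -intr_norm -natr_absz -[16]/(16%:R) -natrM ler_nat abszM /=.
apply: leq_trans hm; rewrite -mulnA leq_mul2l mulnC leq_mul2r.
by rewrite (ltnW (ltn_ord t)) orbT.
Qed.

(** An exact identity: a shift by t twists the frequency r by e(rt/c), the phase recentres at [m0],
    and the sum over t is the Dirichlet sum by which alpha was divided. *)
Lemma fourier_smoothing (R : realType) (n T : nat) (m0 : int)
    (alpha alpha' : 'I_n.+2 -> R[i]) (z : 'I_n.+2) :
  (forall r, alpha r = alpha' r * dirichlet_sum R n.+2 T ((val r)%:Z - m0)) ->
  \sum_(t < T) echar R n.+2 (- (m0 * t%:Z)) *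
     fourier (@Zp_char R n) alpha' (z + t%:R) =
  fourier (@Zp_char R n) alpha z.
Proof.
move=> aE; have [D _ _] := Zp_char_add_char R n.
rewrite /fourier; under eq_bigr do rewrite mulr_sumr.
rewrite exchange_big; apply: eq_bigr => r _ /=.
rewrite aE /dirichlet_sum mulrAC mulr_sumr; apply: eq_bigr => t _.
have -> : Zp_char R (r * (z + t%:R)) = Zp_char R (r * z) * echar R n.+2 ((val r)%:Z * t%:Z).
  rewrite mulrDr D; congr (_ * _).
  by rewrite -Zp_char_int rmorphM /= -!pmulrn natr_val.
rewrite mulrBl echarD; ring.
Qed.

Definition unsmooth (R : realType) (c T : nat) (m0 : int) (alpha : 'I_c -> R[i])
  (r : 'I_c) : R[i] := alpha r / dirichlet_sum R c T ((val r)%:Z - m0).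

Lemma unsmoothP (R : realType) (c T : nat) (m0 : int) (alpha : 'I_c -> R[i]) :
  (0 < c)%N -> (0 < T)%N ->
  (forall r, alpha r != 0 -> near_residue c T m0 (val r)%:Z) ->
  (forall r, alpha r = unsmooth T m0 alpha r * dirichlet_sum R c T ((val r)%:Z - m0)) /\
  norm2 (unsmooth T m0 alpha) * T%:R ^+ 2 <= 4 * norm2 alpha.
Proof.
move=> c0 T0 near; have TR : 0 < T%:R :> R by rewrite ltr0n.
have dge r : alpha r != 0 -> T%:R / 2 <= normc (dirichlet_sum R c T ((val r)%:Z - m0)).
  by move=> /near; apply: dirichlet_sum_ge.
split=> [r|].
  rewrite /unsmooth; have [->|r0] := eqVneq (alpha r) 0; first by rewrite !mul0r.
  rewrite divfK //; apply/eqP => h; have := dge r r0; rewrite h normc0.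
  by rewrite leNgt divr_gt0.
rewrite /norm2 mulr_suml mulr_sumr; apply: ler_sum => r _.
have [r0|r0] := eqVneq (alpha r) 0; first by rewrite /unsmooth r0 mul0r !nsq0 mul0r mulr0.
have h := dge r r0; set D := dirichlet_sum _ _ _ _ in h *.
have D0 : 0 < normc D by apply: lt_le_trans h; rewrite divr_gt0.
rewrite /unsmooth -/D nsqM [nsq D^-1]/nsq normcV exprVn mulrAC.
rewrite ler_pdivrMr ?exprn_gt0 // [leRHS]mulrAC [leRHS]mulrC.
apply: ler_wpM2l; first exact: nsq_ge0.
have : (T%:R / 2) ^+ 2 <= normc D ^+ 2 by rewrite lerXn2r // nnegrE ltW // divr_gt0.
by rewrite expr_div_n; lra.
Qed.

(** Put z = a x in the Kloosterman sum, so that the inverse of x is a / z and the sums over r and s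
    decouple. *)
Lemma kloosterman_form_fourier (R : realType) (n : nat) (alpha beta : 'I_n.+2 -> R[i])
    (a : int) : (a%:~R : 'I_n.+2) \is a GRing.unit ->
  \sum_r \sum_s alpha r * beta s * kloosterman R (a * (val r)%:Z) (val s)%:Z n.+2 =
  \sum_(z in units 'I_n.+2) fourier (@Zp_char R n) alpha z
     * fourier (@Zp_char R n) beta (a%:~R / z).
Proof.
move=> au; have [D _ _] := Zp_char_add_char R n.
transitivity (\sum_r \sum_s \sum_(z in units 'I_n.+2)
   alpha r * beta s * Zp_char R (r * z + s * (a%:~R / z))).
  apply: eq_bigr => r _; apply: eq_bigr => s _; rewrite kloosterman_Zp mulr_sumr.
  rewrite [RHS](reindex_inj (mulrI au)) /=; apply: eq_big => [x|x xu].
    by rewrite !inE unitrM au.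
  congr (_ * Zp_char R _); rewrite rmorphM /= -!pmulrn !natr_val.
  move: xu; rewrite inE => xu.
  have -> : a%:~R / (a%:~R * x) = x^-1 by rewrite invrM // mulrCA divrr // mulr1.
  by congr (_ + _); ring.
under eq_bigr do rewrite exchange_big.
rewrite exchange_big; apply: eq_bigr => z _ /=.
rewrite /fourier mulr_suml; apply: eq_bigr => r _.
by rewrite mulr_sumr; apply: eq_bigr => s _; rewrite D; ring.
Qed.

Lemma kloosterman_form_bound (R : realType) (c d f T : nat)
    (alpha beta : 'I_c -> R[i]) (m0 n0 a : int) :
  (0 < c)%N -> (0 < T)%N -> (T ^ 2 <= c)%N -> (d %| c)%N ->
  (forall k : nat, (k ^ 2 %| c * d)%N -> (k <= f)%N) ->
  coprimez a c%:Z ->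
  (forall r, alpha r != 0 -> coprime (val r) c) ->
  (forall r, alpha r != 0 -> near_residue c T m0 (val r)%:Z) ->
  (forall s, beta s != 0 -> near_residue c T n0 (val s)%:Z) ->
  normc (\sum_r \sum_s alpha r * beta s * kloosterman R (a * (val r)%:Z) (val s)%:Z c) ^+ 6
    * ((minn c (d ^ 2))%:R * T%:R ^+ 6) <=
  (8 * 2688)%:R * 4 ^+ 6 * (maxdiv c)%:R ^+ 22 * c%:R ^+ 9 * f%:R
     * norm2 alpha ^+ 3 * norm2 beta ^+ 3.
Proof.
case: c alpha beta => [//|[|n]] alpha beta.
  (* The ring ['I_n.+2] leaves out the modulus 1, where the form is a single product. *)
  move=> _ T0 T1 d1 fmax _ _ _ _.
  have {T0 T1}-> : T = 1%N by move: T1; rewrite -mulnn; lia.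
  have {d1}-> : d = 1%N by apply/eqP; rewrite -dvdn1.
  have f1 : (1 <= f)%N by apply: fmax.
  have D1 : (1 <= maxdiv 1)%N by apply: maxdiv_gt0.
  rewrite !big_ord1 /norm2 !big_ord1 /kloosterman big_mkcond big_ord1 /= ?coprimen1.
  rewrite !normcM normc_e (_ : minn 1 (1 ^ 2) = 1)%N // /nsq.
  set x := normc (alpha _); set y := normc (beta _).
  have X0 : 0 <= x ^+ 6 * y ^+ 6 by rewrite mulr_ge0 // exprn_ge0 // normc_ge0.
  have fR : 1 <= f%:R :> R by rewrite ler1n.
  have DR : 1 <= (maxdiv 1)%:R ^+ 22 :> R by rewrite exprn_ege1 // ler1n.
  have h : 1 <= (8 * 2688)%:R * (4 ^+ 6) :> R.
    by rewrite -natrX -natrM ler1n muln_gt0 expn_gt0.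
  apply: (@le_trans _ _ (1 * (x ^+ 6 * y ^+ 6))).
    by rewrite le_eqVlt; apply/orP; left; apply/eqP; ring.
  apply: (@le_trans _ _ ((8 * 2688)%:R * 4 ^+ 6 * (maxdiv 1)%:R ^+ 22 * f%:R * (x ^+ 6 * y ^+ 6))).
    apply: ler_wpM2r => //.
    exact: mulr_ege1 (mulr_ege1 h DR) fR.
  by rewrite le_eqVlt; apply/orP; left; apply/eqP; ring.
set c := n.+2 => c0 T0 Tc dc fmax ac acop anear bnear.
have TR : 0 < T%:R :> R by rewrite ltr0n.
have au : (a%:~R : 'I_n.+2) \is a GRing.unit.
  case/coprimezP: ac => -[u v] /= uv.
  apply/unitrP; exists u%:~R.
  have h : u%:~R * a%:~R = 1 :> 'I_n.+2.
    have := congr1 (fun z : int => z%:~R : 'I_n.+2) uv.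
    by rewrite rmorphD !rmorphM /= -[c%:~R]pmulrn natr_char mulr0 addr0.
  by rewrite [a%:~R * _]mulrC h.
have [aE na] := unsmoothP c0 T0 anear; have [bE nb] := unsmoothP c0 T0 bnear.
set alpha' := unsmooth _ _ alpha in aE na; set beta' := unsmooth _ _ beta in bE nb.
pose phi (s : 'I_T * 'I_T) := echar R c (- (m0 * (val s.1)%:Z)) * echar R c (- (n0 * (val s.2)%:Z)).
have phi1 s : normc (phi s) <= 1 by rewrite normcM !normc_e mulr1.
have a'supp r : alpha' r != 0 -> r \is a GRing.unit.
  move=> r0; rewrite unit_val acop //; apply: contra r0 => /eqP h.
  by rewrite /alpha' /unsmooth h mul0r.
have := shifted_form_bound beta' (Zp_char_add_char R n) a'supp au phi1 dc Tc fmax.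
have -> : shifted_form phi (fourier (@Zp_char R n) alpha') (fourier (@Zp_char R n) beta') a%:~R
  = \sum_r \sum_s alpha r * beta s * kloosterman R (a * (val r)%:Z) (val s)%:Z c.
  rewrite kloosterman_form_fourier // /shifted_form.
  under eq_bigr do rewrite mulr_sumr.
  rewrite exchange_big; apply: eq_bigr => z _ /=.
  rewrite -(fourier_smoothing z aE) -(fourier_smoothing (a%:~R / z) bE).
  rewrite mulr_suml -(pair_bigA _ (fun t s : 'I_T => phi (t, s) *
    (fourier (@Zp_char R n) alpha' (z + t%:R) * fourier (@Zp_char R n) beta' (a%:~R / z + s%:R)))) /=.
  apply: eq_bigr => t _; rewrite mulr_sumr; apply: eq_bigr => s _.
  by rewrite /phi /=; ring.
rewrite -/c /nsq -exprM; set X := normc _ ^+ _.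
have X0 : 0 <= X by rewrite exprn_ge0 // normc_ge0.
set C := _%:R * _ * _ * _; set m := (minn _ _)%:R.
have C0 : 0 <= C.
  exact: mulr_ge0 (mulr_ge0 (mulr_ge0 (ler0n _ _) (exprn_ge0 _ (ler0n _ _)))
    (exprn_ge0 _ (ler0n _ _))) (ler0n _ _).
move=> h; rewrite mulrA -(ler_pM2r (exprn_gt0 6 TR)).
have na3 : (norm2 alpha' * T%:R ^+ 2) ^+ 3 <= (4 * norm2 alpha) ^+ 3.
  by rewrite lerXn2r // nnegrE mulr_ge0 ?norm2_ge0 ?exprn_ge0.
have nb3 : (norm2 beta' * T%:R ^+ 2) ^+ 3 <= (4 * norm2 beta) ^+ 3.
  by rewrite lerXn2r // nnegrE mulr_ge0 ?norm2_ge0 ?exprn_ge0.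
have na0 : 0 <= (norm2 alpha' * T%:R ^+ 2) ^+ 3.
  by rewrite exprn_ge0 // mulr_ge0 ?norm2_ge0 ?exprn_ge0.
have nb0 : 0 <= (norm2 beta' * T%:R ^+ 2) ^+ 3.
  by rewrite exprn_ge0 // mulr_ge0 ?norm2_ge0 ?exprn_ge0.
have hab := ler_pM na0 nb0 na3 nb3.
(* Unsmoothing both sequences gains T^12 at the price of 4^6, against T^6 in the bound for the
   shifted form; the net gain is T^6. *)
apply: (@le_trans _ _ ((C * T%:R ^+ 6 * norm2 alpha' ^+ 3 * norm2 beta' ^+ 3) * (T%:R ^+ 6 * T%:R ^+ 6))).
  rewrite -[leLHS]mulrA.
  by apply: ler_wpM2r => //; rewrite mulr_ge0 ?exprn_ge0 ?ltW.
apply: (@le_trans _ _ (C * T%:R ^+ 6 * ((4 * norm2 alpha) ^+ 3 * (4 * norm2 beta) ^+ 3))).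
  apply: le_trans (ler_wpM2l _ hab); last by rewrite mulr_ge0 // exprn_ge0 ltW.
  by rewrite le_eqVlt; apply/orP; left; apply/eqP; ring.
by rewrite le_eqVlt; apply/orP; left; apply/eqP; rewrite /C; move: (8 * 2688)%:R => K; ring.
Qed.

(** * Peeling primes off Kloosterman sums *)

Lemma modinv_dvd (c x : nat) : coprime x c -> (c%:Z %| x%:Z * modinv c x - 1)%Z.
Proof. by move=> cop; rewrite -eqz_mod_dvd; apply/eqP/modinvP. Qed.

Lemma modinv_uniq (c x : nat) (k : int) : coprime x c ->
  (c%:Z %| x%:Z * k - 1)%Z -> (c%:Z %| k - modinv c x)%Z.
Proof.
move=> cop h; have h' := modinv_dvd cop.
have -> : k - modinv c x = modinv c x * (x%:Z * k - 1) - k * (x%:Z * modinv c x - 1).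
  by ring.
exact: rpredB (dvdz_mull _ h) (dvdz_mull _ h').
Qed.

Lemma kloosterman_sym (R : realType) (m n : int) (c : nat) :
  kloosterman R m n c = kloosterman R n m c.
Proof.
case: c => [|[|c]]; first by rewrite /kloosterman !big_ord0.
  rewrite /kloosterman; apply: eq_bigr => x _.
  by rewrite -!/(echar R 1 _) !echar_dvd.
rewrite !kloosterman_Zp (reindex_inj (@invr_inj _)) /=; apply: eq_big => [x|x _].
  by rewrite !inE unitrV.
by rewrite invrK addrC.
Qed.

Lemma coprime_mod_dvd (x c c1 : nat) : (c1 %| c)%N ->
  coprime (x %% c) c1 = coprime x c1.
Proof. by move=> h; rewrite -coprime_modl (modn_dvdm _ h) coprime_modl. Qed.

(** The summand of the sum with coefficients p m and n modulo p c1. The inverse is taken modulo [c1]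
    only, so the term also makes sense when p divides x. *)
Definition peel_term (R : realType) (p c1 : nat) (m n : int) (x : nat) : R[i] :=
  echar R c1 (m * modinv c1 x) * echar R (p * c1) (n * x%:Z).

Lemma peel_term_mod (R : realType) (p c1 : nat) (m n : int) (x y : nat) :
  (0 < p * c1)%N -> coprime y c1 -> (x = y %[mod p * c1])%N ->
  peel_term R p c1 m n x = peel_term R p c1 m n y.
Proof.
move=> pc0 ycop /eqP xy.
have c10 : (0 < c1)%N by move: pc0; rewrite muln_gt0 => /andP[].
have {}xy : ((p * c1)%:Z %| x%:Z - y%:Z)%Z.
  by rewrite -eqz_mod_dvd !modz_nat; apply/eqP; congr Posz; apply/eqP.
have xy1 : (c1%:Z %| x%:Z - y%:Z)%Z.
  by apply: dvdz_trans xy; rewrite dvdzE /= dvdn_mull.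
have xcop : coprime x c1.
  move: xy1; rewrite -eqz_mod_dvd !modz_nat => /eqP[h].
  by rewrite -coprime_modl h coprime_modl.
rewrite /peel_term; congr (_ * _); apply: echar_mod => //.
  rewrite -mulrBr dvdz_mull // modinv_uniq //.
  have -> : y%:Z * modinv c1 x - 1 = (x%:Z * modinv c1 x - 1) - (x%:Z - y%:Z) * modinv c1 x.
    by ring.
  exact: rpredB (modinv_dvd xcop) (dvdz_mulr _ xy1).
by rewrite -mulrBr dvdz_mull.
Qed.

Lemma peel_term_shift (R : realType) (p c1 : nat) (m n : int) (x : nat) :
  (0 < p * c1)%N -> coprime x c1 ->
  peel_term R p c1 m n (c1 + x) = echar R p n * peel_term R p c1 m n x.
Proof.
move=> pc0 xcop; have c10 : (0 < c1)%N by move: pc0; rewrite muln_gt0 => /andP[].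
have xcop' : coprime (c1 + x) c1 by rewrite -coprime_modl modnDl coprime_modl.
rewrite /peel_term PoszD mulrDr echarD mulrC -!mulrA; congr (_ * _).
  by rewrite mulnC mulrC echar_scale.
rewrite mulrC; congr (_ * _); apply: echar_mod => //.
rewrite -mulrBr dvdz_mull // modinv_uniq //.
have -> : x%:Z * modinv c1 (c1 + x) - 1 =
   ((c1 + x)%N%:Z * modinv c1 (c1 + x) - 1) - c1%:Z * modinv c1 (c1 + x).
  by rewrite PoszD; ring.
exact: rpredB (modinv_dvd xcop') (dvdz_mulr _ (dvdzz _)).
Qed.

(** The shift x -> x + c1 permutes the terms and multiplies each by e(n/p), which is not 1. *)
Lemma sum_peel_term (R : realType) (p c1 : nat) (m n : int) :
  (0 < p * c1)%N -> ~~ (p%:Z %| n)%Z ->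
  \sum_(x < p * c1 | coprime x c1) peel_term R p c1 m n x = 0.
Proof.
move=> pc0 pn; have p0 : (0 < p)%N by move: pc0; rewrite muln_gt0 => /andP[].
have hp := echar_neq1 R p0 pn.
set S := \sum_(x < _ | _) _.
suff SE : S = echar R p n * S.
  apply/eqP; have : (1 - echar R p n) * S = 0 by rewrite mulrBl mul1r -SE subrr.
  by move/eqP; rewrite mulf_eq0 subr_eq0 eq_sym (negPf hp).
pose h (x : 'I_(p * c1)) : 'I_(p * c1) := Ordinal (ltn_pmod (c1 + x) pc0).
have hI : injective h.
  move=> x y /(congr1 val) /= /eqP; rewrite eqn_modDl !modn_small ?ltn_ord // => /eqP.
  exact: val_inj.
have hcop (x : 'I_(p * c1)) : coprime (h x) c1 = coprime x c1.
  by rewrite /= coprime_mod_dvd ?dvdn_mull // -coprime_modl modnDl coprime_modl.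
rewrite {1}/S (reindex_inj hI) /= mulr_sumr; apply: eq_big => [x|x].
  exact: hcop.
rewrite -/(nat_of_ord (h x)) hcop => xcop; rewrite -peel_term_shift //.
by apply: peel_term_mod; rewrite ?modn_mod // -coprime_modl modnDl coprime_modl.
Qed.

Lemma kloosterman_peel_term (R : realType) (p c1 : nat) (m n : int) :
  (0 < p * c1)%N ->
  kloosterman R (p%:Z * m) n (p * c1) =
  \sum_(x < p * c1 | coprime x (p * c1)) peel_term R p c1 m n x.
Proof.
move=> pc0; have p0 : (0 < p)%N by move: pc0; rewrite muln_gt0 => /andP[].
have c10 : (0 < c1)%N by move: pc0; rewrite muln_gt0 => /andP[].
rewrite kloosterman_sym; apply: eq_bigr => x xcop.
rewrite -/(echar R _ _) echarD mulrC; congr (_ * _).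
rewrite -mulrA echar_scale //; apply: echar_mod => //.
have xcop1 : coprime x c1 by move: xcop; rewrite coprimeMr => /andP[].
rewrite -mulrBr dvdz_mull // modinv_uniq //.
by apply: dvdz_trans (modinv_dvd xcop); rewrite dvdzE /= dvdn_mull.
Qed.

(** When p divides c1, being coprime to c1 already means being coprime to p c1, so the vanishing sum
    is the whole Kloosterman sum. *)
Lemma kloosterman_peel_square (R : realType) (p c1 : nat) (m n : int) :
  prime p -> (0 < c1)%N -> (p %| c1)%N -> ~~ (p%:Z %| n)%Z ->
  kloosterman R (p%:Z * m) n (p * c1) = 0.
Proof.
move=> pp c10 pc1 pn; have pc0 : (0 < p * c1)%N by rewrite muln_gt0 prime_gt0.
rewrite kloosterman_peel_term // -[RHS](sum_peel_term R m pc0 pn).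
apply: eq_bigl => x; rewrite coprimeMr andbC.
case cop : (coprime x c1) => //=.
by apply: coprime_dvdr cop.
Qed.

(** The vanishing sum exceeds the Kloosterman sum by the terms with p | x; writing x = p x', these
    form a Kloosterman sum modulo c1, whence the minus sign. *)
Lemma kloosterman_peel (R : realType) (p c1 : nat) (m n u : int) :
  prime p -> (0 < c1)%N -> ~~ (p %| c1)%N -> ~~ (p%:Z %| n)%Z ->
  (c1%:Z %| p%:Z * u - 1)%Z ->
  kloosterman R (p%:Z * m) n (p * c1) = - kloosterman R (u * m) n c1.
Proof.
move=> pp c10 pc1 pn pu; have p0 := prime_gt0 pp.
have pc0 : (0 < p * c1)%N by rewrite muln_gt0 p0.
have cop : coprime p c1 by rewrite prime_coprime.
apply/eqP; rewrite -addr_eq0 -(sum_peel_term R m pc0 pn) eq_sym; apply/eqP.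
rewrite (bigID (fun x : 'I_(p * c1) => (p %| x)%N)) /= addrC; congr (_ + _).
  rewrite kloosterman_peel_term //; apply: eq_bigl => x.
  rewrite coprimeMr [coprime x p]coprime_sym (prime_coprime _ pp).
  by rewrite andbC.
have mulP (x : 'I_c1) : (p * x < p * c1)%N by rewrite ltn_pmul2l.
have divP (x : 'I_(p * c1)) : (x %/ p < c1)%N by rewrite ltn_divLR // (mulnC c1).
rewrite kloosterman_sym (reindex_onto (fun x : 'I_c1 => Ordinal (mulP x))
  (fun y => Ordinal (divP y))) /=; last first.
  by move=> x /andP[_ px]; apply/val_inj; rewrite /= mulnC divnK.
apply: eq_big => [x|x].
  rewrite dvdn_mulr // andbT coprimeMl cop /=.
  by rewrite (_ : (_ == x) = true) ?andbT //; apply/eqP/val_inj; rewrite /= mulKn.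
rewrite dvdn_mulr // andbT coprimeMl cop /= => /andP[xcop _].
rewrite -/(echar R c1 _) echarD [RHS]mulrC /peel_term; congr (_ * _).
  apply: echar_mod => //; rewrite [u * m]mulrC -mulrA -mulrBr dvdz_mull //.
  rewrite -opprB rpredN modinv_uniq ?coprimeMl ?cop //.
  have h := modinv_dvd xcop.
  have -> : (p * x)%N%:Z * (u * modinv c1 x) - 1 =
     x%:Z * modinv c1 x * (p%:Z * u - 1) + (x%:Z * modinv c1 x - 1).
    by rewrite PoszM; ring.
  exact: rpredD (dvdz_mull _ pu) h.
by rewrite PoszM mulrCA echar_scale.
Qed.

(** Induction on [delta], one prime at a time. The alternative, the twist [b] and the sign [s]
    depend on [delta] and [c] alone, so they can be pulled out of the bilinear form. *)
Lemma kloosterman_peel_gcd (R : realType) (delta c : nat) :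
  (0 < c)%N -> (delta %| c)%N ->
  (forall m n : int, gcdn (absz m) c = delta -> coprime delta (absz n) ->
     kloosterman R m n c = 0) \/
  exists (b : int) (s : R[i]),
    [/\ normc s = 1, coprimez b (c %/ delta)%:Z &
     forall m n : int, gcdn (absz m) c = delta -> coprime delta (absz n) ->
     kloosterman R m n c = s * kloosterman R (b * (m %/ delta%:Z)%Z) n (c %/ delta)].
Proof.
elim/ltn_ind: delta c => delta IH c c0 dc.
have d0 : (0 < delta)%N by apply: dvdn_gt0 dc.
have [d1|d1] := leqP delta 1.
  have -> : delta = 1%N by lia.
  right; exists 1, 1; split; first exact: normc1.
    by rewrite coprimezE /= coprime1n.
  by move=> m n _ _; rewrite divz1 divn1 !mul1r.
have pp := pdiv_prime d1; have pd := pdiv_dvd delta.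
move: (pdiv delta) pp pd => p pp pd; have p0 := prime_gt0 pp.
have /dvdnP[delta' dE] := pd; have /dvdnP[c1 cE] := dvdn_trans pd dc.
rewrite mulnC in dE; rewrite mulnC in cE.
have pz : p%:Z != 0 by rewrite eqz_nat -lt0n.
have mE (m : int) : gcdn (absz m) c = delta ->
    m = p%:Z * (m %/ p%:Z)%Z /\ gcdn (absz (m %/ p%:Z)%Z) c1 = delta'.
  move=> mg; have pm : (p%:Z %| m)%Z.
    by rewrite dvdzE /= (dvdn_trans pd) // -mg dvdn_gcdl.
  have e : m = p%:Z * (m %/ p%:Z)%Z by rewrite mulrC divzK.
  split=> //; apply/eqP; rewrite -(eqn_pmul2l p0) muln_gcdr -dE -mg cE.
  by rewrite {2}e abszM.
have nP (n : int) : coprime delta (absz n) -> ~~ (p%:Z %| n)%Z.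
  move=> nd; rewrite dvdzE /= -prime_coprime //; exact: coprime_dvdl nd.
have c10 : (0 < c1)%N by move: c0; rewrite cE muln_gt0 => /andP[].
have [pc1|pc1] := boolP (p %| c1)%N.
  left=> m n mg nd; have [-> _] := mE m mg.
  by rewrite cE kloosterman_peel_square // nP.
have cop : coprimez p%:Z c1%:Z by rewrite coprimezE /= prime_coprime.
have /coprimezP[[u v] /= uv] := cop.
have pu : (c1%:Z %| p%:Z * u - 1)%Z.
  by rewrite -uv; apply/dvdzP; exists (- v); ring.
have ucop : coprimez u c1%:Z by apply/coprimezP; exists (p%:Z, v) => /=; rewrite mulrC.
have d'c1 : (delta' %| c1)%N by rewrite -(dvdn_pmul2l p0) -dE -cE.
have d'd : (delta' < delta)%N.
  rewrite dE ltn_Pmull ?prime_gt1 //; apply: dvdn_gt0 d'c1 => //.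
have cdE : (c %/ delta = c1 %/ delta')%N by rewrite cE dE divnMl.
have step (m n : int) : gcdn (absz m) c = delta -> coprime delta (absz n) ->
    [/\ kloosterman R m n c = - kloosterman R (u * (m %/ p%:Z)%Z) n c1,
        gcdn (absz (u * (m %/ p%:Z)%Z)) c1 = delta' & coprime delta' (absz n)].
  move=> mg nd; have [e g] := mE m mg; split.
  - by rewrite {1}e cE (kloosterman_peel R _ pp c10 pc1 (nP n nd) pu).
  - rewrite abszM gcdnC Gauss_gcdr 1?gcdnC // coprime_sym.
    by move: ucop; rewrite coprimezE.
  by apply: coprime_dvdl nd; rewrite dE dvdn_mull.
case: (IH delta' d'd c1 c10 d'c1) => [z|[b [s [s1 bc h]]]].
  by left=> m n mg nd; have [-> g nd'] := step m n mg nd; rewrite z ?oppr0.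
right; exists (b * u), (- s); split.
- by rewrite normcN.
- rewrite cdE coprimezMl bc /=; move: ucop; rewrite !coprimezE /=.
  exact/coprime_dvdr/dvdn_div.
move=> m n mg nd; have [-> g nd'] := step m n mg nd.
rewrite h // cdE mulNr; congr (- (_ * kloosterman _ _ _ _)).
have [e g'] := mE m mg.
have dm : (delta'%:Z %| (m %/ p%:Z)%Z)%Z by rewrite dvdzE /= -g' dvdn_gcdl.
rewrite -mulrA; congr (_ * _).
have -> : (m %/ delta%:Z)%Z = ((m %/ p%:Z)%Z %/ delta'%:Z)%Z.
  by rewrite dE PoszM {1}e divzMpl.
by rewrite -(mulz_divA _ dm).
Qed.

(** * The divisor bound *)

(** Take k-th powers in a + 1 <= k (floor(a/k) + 1) <= k 2^floor(a/k). *)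
Lemma succ_expn_bound (k a : nat) : (0 < k)%N -> (a.+1 ^ k <= k ^ k * 2 ^ a)%N.
Proof.
move=> k0; apply: (@leq_trans ((k * 2 ^ (a %/ k)) ^ k)%N).
  rewrite leq_exp2r //; apply: (@leq_trans (k * (a %/ k).+1)%N).
    by rewrite {1}(divn_eq a k) -addnS mulnSr mulnC leq_add2l ltn_pmod.
  by rewrite leq_mul2l ltn_expl ?orbT.
by rewrite expnMn leq_mul2l -expnM leq_exp2l // leq_trunc_div orbT.
Qed.

Lemma size_divisors_pfactor (p a m : nat) : prime p -> (0 < m)%N -> coprime p m ->
  (size (divisors (p ^ a * m)) <= a.+1 * size (divisors m))%N.
Proof.
move=> pp m0 pm; have n0 : (0 < p ^ a * m)%N by rewrite muln_gt0 expn_gt0 prime_gt0.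
pose f (d : nat) := (logn p d, d %/ p ^ logn p d)%N.
have fK d : (p ^ (f d).1 * (f d).2 = d)%N.
  by rewrite /f /= mulnC divnK // pfactor_dvdnn.
rewrite -(size_map f) -(size_iota 0 a.+1) -(size_allpairs pair).
apply: uniq_leq_size.
  rewrite map_inj_uniq ?divisors_uniq // => d d' dd'.
  by rewrite -(fK d) dd' fK.
move=> x /mapP[d]; rewrite -dvdn_divisors // => dn ->.
have d0 : (0 < d)%N by apply: dvdn_gt0 dn.
apply/allpairsP; exists (f d); split=> //.
  rewrite mem_iota /= add0n ltnS.
  have : (p ^ logn p d %| p ^ a * m)%N by apply: dvdn_trans dn; apply: pfactor_dvdnn.
  rewrite Gauss_dvdl ?coprimeXl // => /dvdn_leq; rewrite expn_gt0 prime_gt0 // => /(_ isT).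
  by rewrite leq_exp2l // prime_gt1.
rewrite -dvdn_divisors //.
have cop : coprime (f d).2 (p ^ a).
  by rewrite coprimeXr // coprime_sym /f /=; have [e pe ->] := pfactor_coprime pp d0;
     rewrite logn_Gauss // pfactorK // mulnK // expn_gt0 prime_gt0.
by rewrite -(Gauss_dvdr _ cop); apply: dvdn_trans dn; rewrite -{2}(fK d) dvdn_mull.
Qed.

(* Only the primes below 2^k can contribute a factor larger than 1 to
   (size (divisors n))^k / n, and each contributes at most k^k. *)
Lemma divisor_bound (k n : nat) : (0 < k)%N -> (0 < n)%N ->
  (size (divisors n) ^ k <= (k ^ k) ^ (\sum_(q < 2 ^ k) (val q \in primes n)) * n)%N.
Proof.
move=> k0; elim/ltn_ind: n => n IH n0.
have [n1|n1] := leqP n 1.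
  have -> : n = 1%N by lia.
  by rewrite exp1n muln1 expn_gt0 expn_gt0 k0.
have pp := pdiv_prime n1; have pn := pdiv_dvd n.
move: (pdiv n) pp pn => p pp pn; have p1 := prime_gt1 pp.
have [m pm nE] := pfactor_coprime pp n0.
have m0 : (0 < m)%N by move: n0; rewrite nE muln_gt0 => /andP[].
move: nE; have a0 : (0 < logn p n)%N by rewrite logn_gt0 mem_primes pp n0.
move: (logn p n) a0 => a a0 nE.
have mn : (m < n)%N.
  by rewrite nE ltn_Pmulr // -(expn0 p) ltn_exp2l.
(* For p >= 2^k the power p^a alone dominates (2^a)^k, so no constant is paid. *)
have key : (a.+1 ^ k <= (k ^ k) ^ (p < 2 ^ k)%N * p ^ a)%N.
  have [hp|hp] := ltnP p (2 ^ k).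
    rewrite expn1; apply: leq_trans (succ_expn_bound a k0) _.
    by rewrite leq_mul2l leq_exp2r // p1 orbT.
  rewrite expn0 mul1n; apply: (@leq_trans ((2 ^ a) ^ k)%N).
    by rewrite leq_exp2r // ltn_expl.
  by rewrite -expnM mulnC expnM leq_exp2r.
apply: (@leq_trans ((a.+1 * size (divisors m)) ^ k)%N).
  by rewrite leq_exp2r // nE mulnC size_divisors_pfactor.
rewrite expnMn; apply: leq_trans (leq_mul key (IH m mn m0)) _.
rewrite mulnACA -expnD [(p ^ a * m)%N]mulnC -nE leq_mul2r; apply/orP; right.
apply: leq_pexp2l; first by rewrite expn_gt0 k0.
have -> : ((p < 2 ^ k)%N : nat) = (\sum_(q < 2 ^ k) (val q == p))%N.
  have [hp|hp] := ltnP p (2 ^ k).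
    rewrite (bigD1 (Ordinal hp)) //= eqxx big1 // => q qp.
    by case: eqP => // h; case/eqP: qp; apply/val_inj.
  rewrite big1 // => q _; case: eqP => // h.
  by have := ltn_ord q; rewrite -[nat_of_ord q]/(val q) h ltnNge hp.
rewrite -big_split leq_sum // => q _ /=.
rewrite !mem_primes n0 m0 /=; case: eqP => [->|_].
  by move: pm; rewrite prime_coprime // => /negPf ->; rewrite pp pn.
rewrite add0n; case: (prime q) => //=.
by case qm : (q %| m)%N => //; rewrite nE dvdn_mulr.
Qed.

Lemma maxdiv_bound (k : nat) : (0 < k)%N ->
  exists C : nat, forall c : nat, (0 < c)%N -> (maxdiv c ^ k <= C * c)%N.
Proof.
move=> k0; exists ((k ^ k) ^ (2 ^ k))%N => c c0.
have kk : (0 < k ^ k)%N by rewrite expn_gt0 k0.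
have cc : (0 < #|'I_c.+1|)%N by rewrite card_ord.
rewrite /maxdiv; have [n ->] := bigop.eq_bigmax (fun n : 'I_c.+1 => size (divisors n)) cc.
have [n0|n0] := posnP n.
  rewrite n0 (_ : size (divisors 0) = 1)%N // exp1n muln_gt0 c0 expn_gt0 kk.
  by [].
apply: leq_trans (divisor_bound k0 n0) _; apply: leq_mul; last by rewrite -ltnS.
apply: leq_pexp2l => //.
rewrite -[X in (_ <= X)%N]card_ord -sum1_card; apply: leq_sum => q _.
exact: leq_b1.
Qed.

(** * Reduction of the general form *)

Lemma kloosterman_congr (R : realType) (c : nat) (m m' n n' : int) : (0 < c)%N ->
  (c%:Z %| m - m')%Z -> (c%:Z %| n - n')%Z ->
  kloosterman R m n c = kloosterman R m' n' c.
Proof.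
move=> c0 hm hn; apply: eq_bigr => x _; apply: echar_mod => //.
have -> : m * x%:Z + n * modinv c x - (m' * x%:Z + n' * modinv c x) =
  (m - m') * x%:Z + (n - n') * modinv c x by ring.
exact: rpredD (dvdz_mulr _ hm) (dvdz_mulr _ hn).
Qed.

Lemma ord_residue_subproof (c : nat) (k : int) : (0 < c)%N -> (absz (k %% c%:Z)%Z < c)%N.
Proof.
move=> c0; have cz : c%:Z != 0 by rewrite eqz_nat -lt0n.
by rewrite -ltz_nat gez0_abs ?modz_ge0 // ltz_pmod // ltz_nat.
Qed.

Definition ord_residue (c : nat) (c0 : (0 < c)%N) (k : int) : 'I_c :=
  Ordinal (ord_residue_subproof k c0).

Lemma ord_residueE (c : nat) (c0 : (0 < c)%N) (k : int) :
  (c%:Z %| k - (val (ord_residue c0 k))%:Z)%Z.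
Proof.
have cz : c%:Z != 0 by rewrite eqz_nat -lt0n.
by rewrite /= gez0_abs ?modz_ge0 // -eqz_mod_dvd modz_mod.
Qed.

Lemma ord_residue_eq (c : nat) (c0 : (0 < c)%N) (k l : int) :
  ord_residue c0 k = ord_residue c0 l -> (c%:Z %| k - l)%Z.
Proof.
move=> h; have hk := ord_residueE c0 k; have hl := ord_residueE c0 l.
rewrite h in hk; have -> : k - l = (k - (val (ord_residue c0 l))%:Z) - (l - (val (ord_residue c0 l))%:Z).
  by ring.
exact: rpredB.
Qed.

Definition push (R : rcfType) (T I : finType) (P : pred T) (key : T -> I)
  (alpha : T -> R[i]) (r : I) : R[i] := \sum_(x | P x && (key x == r)) alpha x.

Lemma norm2_push (R : rcfType) (T I : finType) (P : pred T) (key : T -> I)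
    (alpha : T -> R[i]) (nu : nat) :
  (forall r, #|[set x | P x && (key x == r)]| <= nu)%N ->
  norm2 (push P key alpha) <= nu%:R * norm2 alpha.
Proof.
move=> hnu; rewrite {2}/norm2 (partition_big key xpredT) //= mulr_sumr.
apply: ler_sum => r _; set Q := fun x => P x && (key x == r).
have -> : push P key alpha r = \sum_x (Q x)%:R * (alpha x * (Q x)%:R).
  rewrite /push big_mkcond; apply: eq_bigr => x _; rewrite -/(Q x).
  by case: (Q x); rewrite ?mul1r ?mulr1 ?mul0r.
apply: le_trans (cauchy_schwarz _ _) _.
have -> : norm2 (fun x => (Q x)%:R : R[i]) = #|[set x | Q x]|%:R.
  rewrite /norm2 -sum1_card natr_sum big_mkcond [in RHS]big_mkcond /=.
  apply: eq_bigr => x _; rewrite inE.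
  by case: (Q x); rewrite ?nsq0 // /nsq normc1 expr1n.
apply: ler_pM; rewrite ?ler0n ?norm2_ge0 ?ler_nat //; first exact: hnu.
rewrite /norm2 [leRHS]big_mkcond; apply: ler_sum => x _.
rewrite /Q nsqM; case: (P x); case: (key x == r); rewrite ?nsq0 ?mulr0 ?nsq_ge0 //=.
by rewrite /nsq normc1 expr1n mulr1.
Qed.

Lemma sum_push (R : rcfType) (T I : finType) (P : pred T) (key : T -> I)
    (alpha : T -> R[i]) (h : I -> R[i]) :
  \sum_(x | P x) alpha x * h (key x) = \sum_r push P key alpha r * h r.
Proof.
rewrite (partition_big key xpredT) //=; apply: eq_bigr => r _.
by rewrite /push mulr_suml; apply: eq_bigr => x /andP[_ /eqP->].
Qed.

Lemma push_neq0 (R : rcfType) (T I : finType) (P : pred T) (key : T -> I)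
    (alpha : T -> R[i]) (r : I) :
  push P key alpha r != 0 -> exists2 x, P x & key x = r.
Proof.
move=> h; case: (pickP (fun x => P x && (key x == r))) => [x /andP[Px /eqP kx]|n0].
  by exists x.
by case/eqP: h; rewrite /push big_pred0.
Qed.

(** Take T maximal. If T + 1 violates the first condition then c <= 4 T^2; if it violates the second
    then c <= 32 T H, and 1024 is 32^2. *)
Lemma exists_shift_length (c H : nat) : (0 < c)%N -> exists T : nat,
  [/\ (0 < T)%N, (T ^ 2 <= c)%N, T = 1%N \/ (16 * T * H <= c)%N &
      (c ^ 2 <= T ^ 2 * (4 * c + 1024 * H ^ 2))%N].
Proof.
move=> c0; pose P T := (T ^ 2 <= c)%N && ((T <= 1)%N || (16 * T * H <= c)%N).
have P1 : exists T, P T by exists 1%N; rewrite /P exp1n c0.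
have Pc T : P T -> (T <= c)%N.
  by move=> /andP[h _]; apply: leq_trans h; rewrite -mulnn; case: T => // T; rewrite leq_pmulr.
case: (ex_maxnP P1 Pc) => T /andP[T2 TH] Tmax.
have T0 : (0 < T)%N by apply: Tmax; rewrite /P exp1n c0.
exists T; split=> //.
  by case/orP: TH => h; [left; lia|right].
have : ~~ P T.+1 by apply/negP => /Tmax; rewrite ltnn.
rewrite /P negb_and negb_or -!ltnNge => /orP[h|/andP[_ h]].
  have h1 : (c <= T ^ 2 * 4)%N.
    by apply: ltnW; apply: leq_trans h _; rewrite -!mulnn; nia.
  rewrite mulnDr; apply: leq_trans (leq_addr _ _).
  by rewrite mulnA -[(c ^ 2)%N]mulnn leq_mul2r h1 orbT.
have h1 : (c <= 32 * T * H)%N.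
  by apply: ltnW; apply: leq_trans h _; rewrite leq_mul2r; apply/orP; right; lia.
rewrite mulnDr; apply: leq_trans (leq_addl _ _).
apply: (@leq_trans ((32 * T * H) ^ 2)); first by rewrite leq_exp2r.
by rewrite !expnMn; apply: eq_leq; ring.
Qed.

(** Balances the multiplicity of reduction modulo [c] against the gain T^6. If H < c, the
    multiplicity is at most 3 and T is long enough, with 1028 = 4 + 1024. If H >= c, the
    multiplicity is at most 3H / c and T >= 1 suffices. In both cases 729 = 3^6. *)
Lemma shift_length_bound (R : realFieldType) (c H T : nat) (W : R) :
  (0 < c)%N -> (0 < T)%N -> (c ^ 2 <= T ^ 2 * (4 * c + 1024 * H ^ 2))%N ->
  H%:R ^+ 2 <= W -> c%:R <= W ->
  c%:R ^+ 9 * ((2 * H) %/ c + 1)%N%:R ^+ 6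
    <= (729 * 1028 ^+ 3) * W ^+ 3 * c%:R ^+ 3 * T%:R ^+ 6.
Proof.
move=> c0 T0 cT HW cW; set nu := ((2 * H) %/ c + 1)%N.
have cR : 0 < c%:R :> R by rewrite ltr0n.
have TR : 1 <= T%:R :> R by rewrite ler1n.
have W0 : 0 < W by apply: lt_le_trans cW.
have T60 : 0 <= T%:R ^+ 6 :> R by apply: exprn_ge0.
have c30 : 0 <= c%:R ^+ 3 :> R by apply: exprn_ge0.
have W30 : 0 <= W ^+ 3 by apply/exprn_ge0/ltW.
have -> : c%:R ^+ 9 * nu%:R ^+ 6 = c%:R ^+ 3 * (c%:R ^+ 6 * nu%:R ^+ 6) :> R by ring.
have -> : 729 * 1028 ^+ 3 * W ^+ 3 * c%:R ^+ 3 * T%:R ^+ 6 =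
    c%:R ^+ 3 * (729 * (1028 ^+ 3 * W ^+ 3) * T%:R ^+ 6) by ring.
apply: ler_wpM2l => //.
have [h|h] := ltnP H c.
  have nu3 : (nu <= 3)%N.
    by rewrite /nu -ltnS addn1 !ltnS -ltnS ltn_divLR //; lia.
  have nuR : nu%:R ^+ 6 <= 729 :> R.
    rewrite (_ : 729 = 3 ^+ 6 :> R); last by rewrite -natrX; congr (_%:R).
    by rewrite lerXn2r ?nnegrE // (ler_nat R nu 3).
  have c6 : c%:R ^+ 6 <= T%:R ^+ 6 * (1028 ^+ 3 * W ^+ 3) :> R.
    have -> : c%:R ^+ 6 = (c%:R ^+ 2) ^+ 3 :> R by rewrite -exprM.
    have -> : T%:R ^+ 6 * (1028 ^+ 3 * W ^+ 3) = (T%:R ^+ 2 * (1028 * W)) ^+ 3 by ring.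
    have KW : 0 <= 1028 * W by apply: mulr_ge0 (ler0n _ _) (ltW W0).
    have TKW : 0 <= T%:R ^+ 2 * (1028 * W) by apply: mulr_ge0 KW; apply: exprn_ge0.
    apply: lerXn2r; [exact: exprn_ge0|exact: TKW|].
    have := cT; rewrite -(ler_nat R) !(natrX, natrM, natrD) => hc.
    apply: le_trans hc _; apply: ler_wpM2l; first exact: exprn_ge0.
    by lra.
  rewrite -[leRHS]mulrA [X in _ <= _ * X]mulrC [leLHS]mulrC.
  by apply: ler_pM _ _ nuR c6; apply: exprn_ge0.
have cnu : (c * nu <= 3 * H)%N.
  by apply: leq_trans (muln_congr_bound _ _) _; lia.
have h1 : (c%:R * nu%:R) ^+ 6 <= 729 * W ^+ 3 :> R.
  apply: (@le_trans _ _ ((3 * H%:R) ^+ 6)).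
    by rewrite lerXn2r ?nnegrE ?mulr_ge0 // -!natrM ler_nat.
  have -> : (3 * H%:R) ^+ 6 = 729 * (H%:R ^+ 2) ^+ 3 :> R by ring.
  apply: ler_wpM2l; first exact: ler0n.
  by apply: lerXn2r; rewrite ?nnegrE ?(ltW W0) // exprn_ge0.
rewrite -exprMn; apply: le_trans h1 _.
have X0 : 0 <= 729 * W ^+ 3 by apply: mulr_ge0 (ler0n _ _) W30.
have h2 : 729 * W ^+ 3 <= 729 * (1028 ^+ 3 * W ^+ 3).
  apply: ler_wpM2l; first exact: ler0n.
  rewrite -[leLHS]mul1r; apply: ler_wpM2r => //.
  by apply: exprn_ege1; rewrite (ler_nat R 1 1028).
rewrite -[leLHS]mulr1; apply: ler_pM h2 _ => //.
exact: exprn_ege1.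
Qed.

Definition piece_constant (R : realType) : R :=
  (8 * 2688)%:R * 4 ^+ 6 * (729 * 1028 ^+ 3).

Lemma card_residue_fiber (T : finType) (v : T -> int) (P : pred T) (q H : nat) :
  (0 < q)%N -> injective v -> (forall x y, absz (v x - v y) < H)%N ->
  (forall x y, P x -> P y -> (q%:Z %| v x - v y)%Z) ->
  (#|[set x | P x]| <= (2 * H) %/ q + 1)%N.
Proof.
move=> q0 vI vH vq; have [->|[x0 _]] := set_0Vmem [set x | P x].
  by rewrite cards0.
apply: (@card_congr _ _ v q (2 * H) (v x0 - H%:Z) q0).
- by move=> x y _ _; apply: vI.
- by move=> x _; have := vH x x0; lia.
by move=> x y; rewrite !inE; apply: vq.
Qed.

Lemma coprime_ord_residue (c : nat) (c0 : (0 < c)%N) (k : int) :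
  coprime (val (ord_residue c0 k)) c = coprime (absz k) c.
Proof.
rewrite -[LHS]/(coprime (absz (k %% c%:Z)%Z) (absz c%:Z)) -coprimezE.
by rewrite /coprimez gcdz_modl -/(coprimez _ _) coprimezE.
Qed.

(* The pairs with gcd(m, c) = delta reduce to the modulus c1 = c/delta, where
   m/delta is a unit. *)
Lemma gcd_piece_bound (R : realType) (X Y : finType) (vm : X -> int) (vn : Y -> int)
    (alpha : X -> R[i]) (beta : Y -> R[i]) (a : int) (c d f delta H : nat) (W : R) :
  (0 < c)%N -> (d %| c)%N ->
  (forall k : nat, (k ^ 2 %| c * d)%N -> (k <= f)%N) ->
  coprimez a c%:Z -> injective vm -> injective vn ->
  (forall x y, absz (vm x - vm y) < H)%N -> (forall x y, absz (vn x - vn y) < H)%N ->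
  (delta %| c)%N -> H%:R ^+ 2 <= W -> c%:R <= W ->
  normc (\sum_(x | gcdn (absz (vm x)) c == delta) \sum_(y | coprime delta (absz (vn y)))
     alpha x * beta y * kloosterman R (a * vm x) (vn y) c) ^+ 6 * (minn c (d ^ 2))%:R
  <= piece_constant R * (maxdiv c)%:R ^+ 22 * c%:R ^+ 3 * W ^+ 3 * f%:R
     * norm2 alpha ^+ 3 * norm2 beta ^+ 3.
Proof.
move=> c0 dc fmax ac vmI vnI vmH vnH delc HW cW.
have na := norm2_ge0 alpha; have nb := norm2_ge0 beta.
have cR : 0 < c%:R :> R by rewrite ltr0n.
have W0 : 0 < W by apply: lt_le_trans cW.
have C0 : 0 <= piece_constant R.
  exact: mulr_ge0 (mulr_ge0 (ler0n _ _) (exprn_ge0 _ (ler0n _ _)))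
    (mulr_ge0 (ler0n _ _) (exprn_ge0 _ (ler0n _ _))).
set Z := \sum_(x | _) _.
have agcd x : gcdn (absz (vm x)) c = delta -> gcdn (absz (a * vm x)) c = delta.
  move=> <-; rewrite abszM gcdnC Gauss_gcdr 1?gcdnC // coprime_sym.
  by move: ac; rewrite coprimezE.
case: (kloosterman_peel_gcd R c0 delc) => [z|[b [s [s1 bc peel]]]].
  have -> : Z = 0.
    rewrite /Z big1 // => x /eqP hx; rewrite big1 // => y hy.
    by rewrite z ?mulr0 // agcd.
  rewrite normc0 expr0n /= mul0r.
  have E (n k : nat) : 0 <= n%:R ^+ k :> R by apply/exprn_ge0/ler0n.
  exact: mulr_ge0 (mulr_ge0 (mulr_ge0 (mulr_ge0 (mulr_ge0 (mulr_ge0 C0 (E _ _)) (E _ _))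
    (exprn_ge0 _ (ltW W0))) (ler0n _ _)) (exprn_ge0 _ na)) (exprn_ge0 _ nb).
set c1 := (c %/ delta)%N in bc peel.
have del0 : (0 < delta)%N by apply: dvdn_gt0 delc.
have cE : c = (delta * c1)%N by rewrite mulnC divnK.
have c10 : (0 < c1)%N by move: c0; rewrite cE muln_gt0 => /andP[].
have delz : delta%:Z != 0 by rewrite eqz_nat -lt0n.
(* The level must divide the reduced modulus. As [c1 * d1] divides [c * d], the bound [f] on square
   divisors survives. *)
pose d1 := gcdn d c1.
have [T [T0 T2 TH cT]] := exists_shift_length H c10.
pose Px x := gcdn (absz (vm x)) c == delta.
pose Qy y := coprime delta (absz (vn y)).
pose kx x := ord_residue c10 (vm x %/ delta%:Z)%Z.
pose ky y := ord_residue c10 (vn y).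
have delx x : Px x -> (delta%:Z %| vm x)%Z.
  by move=> /eqP h; rewrite dvdzE /= -h dvdn_gcdl.
have vmE x : Px x -> vm x = (vm x %/ delta%:Z)%Z * delta%:Z.
  by move=> /delx h; rewrite divzK.
have ZE : Z = s * \sum_r \sum_t push Px kx alpha r * push Qy ky beta t *
    kloosterman R (b * a * (val r)%:Z) (val t)%:Z c1.
  have e1 x y : Px x -> Qy y -> kloosterman R (a * vm x) (vn y) c =
      s * kloosterman R (b * a * (val (kx x))%:Z) (val (ky y))%:Z c1.
    move=> Pxx Qyy; rewrite peel ?agcd //; last by apply/eqP.
    congr (_ * _); apply: kloosterman_congr => //; last exact: ord_residueE.
    rewrite -(mulz_divA _ (delx x Pxx)) mulrA -mulrBr dvdz_mull //.
    exact: ord_residueE.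
  transitivity (\sum_(x | Px x) alpha x * (s * \sum_t push Qy ky beta t *
      kloosterman R (b * a * (val (kx x))%:Z) (val t)%:Z c1)).
    apply: eq_bigr => x Pxx.
    rewrite -(sum_push Qy ky beta (fun t => kloosterman R (b * a * (val (kx x))%:Z) (val t)%:Z c1)).
    rewrite !mulr_sumr; apply: eq_bigr => y Qyy.
    by rewrite e1 //; ring.
  rewrite (sum_push Px kx alpha (fun r => s * \sum_t push Qy ky beta t *
      kloosterman R (b * a * (val r)%:Z) (val t)%:Z c1)).
  rewrite mulr_sumr; apply: eq_bigr => r _; rewrite !mulr_sumr.
  by apply: eq_bigr => t _; ring.
(* The intervals may be longer than [c1]; [nu] bounds how many of their points share a residue. *)
set nu := ((2 * H) %/ c1 + 1)%N.
have nupx : norm2 (push Px kx alpha) <= nu%:R * norm2 alpha.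
  apply: norm2_push => r; apply: (card_residue_fiber (v := vm)) => // x y.
  move=> /andP[Pxx /eqP kxx] /andP[Pxy /eqP kxy].
  rewrite (vmE _ Pxx) (vmE _ Pxy) -mulrBl dvdz_mulr //.
  exact: (@ord_residue_eq _ c10 _ _ (etrans kxx (esym kxy))).
have nupy : norm2 (push Qy ky beta) <= nu%:R * norm2 beta.
  apply: norm2_push => r; apply: (card_residue_fiber (v := vn)) => // x y.
  move=> /andP[_ /eqP kxx] /andP[_ /eqP kxy].
  exact: (@ord_residue_eq _ c10 _ _ (etrans kxx (esym kxy))).
have near_of (m m0 : int) (r : 'I_c1) : (absz (m - m0) <= H)%N ->
    (c1%:Z %| m - (val r)%:Z)%Z -> near_residue c1 T m0 (val r)%:Z.
  move=> hm hr; case: TH => [->|TH]; [by left|right; exists m; split=> //].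
  by apply: leq_trans TH; rewrite leq_mul2l hm orbT.
have anear : exists m0, forall r, push Px kx alpha r != 0 -> near_residue c1 T m0 (val r)%:Z.
  have [x0 Px0|n0] := pickP Px; last first.
    by exists 0 => r /push_neq0[x]; rewrite n0.
  exists (vm x0 %/ delta%:Z)%Z => r /push_neq0[x Pxx <-].
  apply: (near_of (vm x %/ delta%:Z)%Z); last exact: ord_residueE.
  have h := vmH x x0; rewrite {1}(vmE _ Pxx) {1}(vmE _ Px0) -mulrBl abszM in h.
  by apply: ltnW; apply: leq_ltn_trans h; rewrite leq_pmulr.
have bnear : exists n0, forall t, push Qy ky beta t != 0 -> near_residue c1 T n0 (val t)%:Z.
  have [y0 Qy0|n0] := pickP Qy; last first.
    by exists 0 => r /push_neq0[x]; rewrite n0.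
  exists (vn y0) => r /push_neq0[y Qyy <-].
  by apply: (near_of (vn y)); [exact/ltnW/vnH|exact: ord_residueE].
have {anear} [m0 anear] := anear; have {bnear} [n0 bnear] := bnear.
have acop r : push Px kx alpha r != 0 -> coprime (val r) c1.
  move=> /push_neq0[x Pxx <-].
  have h : coprime (absz (vm x %/ delta%:Z)%Z) c1.
    move/eqP: (Pxx); rewrite {1}(vmE _ Pxx) cE abszM mulnC -muln_gcdr => /eqP.
    by rewrite -[X in _ == X]muln1 eqn_pmul2l.
  by rewrite coprime_ord_residue.
have bac : coprimez (b * a) c1%:Z.
  rewrite coprimezMl bc /=; move: ac; rewrite !coprimezE /=.
  by apply: coprime_dvdr; rewrite cE dvdn_mull.
have fmax1 (k : nat) : (k ^ 2 %| c1 * d1)%N -> (k <= f)%N.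
  move=> h; apply: fmax; apply: dvdn_trans h _.
  by rewrite dvdn_mul // ?dvdn_gcdl // cE dvdn_mull.
have := kloosterman_form_bound c10 T0 T2 (dvdn_gcdr d c1) fmax1 bac acop anear bnear.
rewrite -/d1; set Z1 := \sum_r _ => hZ1.
have nZ : normc Z = normc Z1 by rewrite ZE normcM s1 mul1r.
rewrite nZ; set z := normc Z1 ^+ 6.
have z0 : 0 <= z by rewrite exprn_ge0 // normc_ge0.
have TR : 0 < T%:R :> R by rewrite ltr0n.
have hnu := shift_length_bound c10 T0 cT HW (le_trans _ cW).
have c1c : (c1 <= c)%N by apply: dvdn_leq => //; rewrite cE dvdn_mull.
have {}hnu := hnu (ltac:(by rewrite ler_nat)); rewrite -/nu in hnu.
set P := norm2 alpha ^+ 3 * norm2 beta ^+ 3.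
have P0 : 0 <= P by rewrite mulr_ge0 // exprn_ge0.
set K0 : R := (8 * 2688)%:R * 4 ^+ 6 in hZ1 *.
have K00 : 0 <= K0 by apply: mulr_ge0 (ler0n _ _) (exprn_ge0 _ (ler0n _ _)).
pose D1 : R := (maxdiv c1)%:R ^+ 22; pose D : R := (maxdiv c)%:R ^+ 22.
have D10 : 0 <= D1 by rewrite exprn_ge0.
have D1D : D1 <= D by rewrite lerXn2r ?nnegrE // ler_nat maxdiv_mono.
have f0 : 0 <= f%:R :> R by rewrite ler0n.
have pushP : norm2 (push Px kx alpha) ^+ 3 * norm2 (push Qy ky beta) ^+ 3 <= nu%:R ^+ 6 * P.
  have -> : nu%:R ^+ 6 * P = (nu%:R * norm2 alpha) ^+ 3 * (nu%:R * norm2 beta) ^+ 3.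
    by rewrite /P; ring.
  apply: ler_pM; rewrite ?exprn_ge0 ?norm2_ge0 //.
    by apply: lerXn2r; rewrite ?nnegrE ?norm2_ge0 ?mulr_ge0.
  by apply: lerXn2r; rewrite ?nnegrE ?norm2_ge0 ?mulr_ge0.
set K1 : R := 729 * 1028 ^+ 3 in hnu.
have K10 : 0 <= K1 by apply: mulr_ge0 (ler0n _ _) (exprn_ge0 _ (ler0n _ _)).
have KE : piece_constant R = K0 * K1 by [].
clearbody K0 K1.
set m1 : R := (minn c1 (d1 ^ 2))%:R in hZ1.
have main1 : z * m1 <= K0 * K1 * D * c1%:R ^+ 3 * W ^+ 3 * f%:R * P.
  rewrite -(ler_pM2r (exprn_gt0 6 TR)) -[leLHS]mulrA.
  apply: le_trans hZ1 _; rewrite -/D1 -[leLHS]mulrA.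
  have C10 : 0 <= K0 * D1 * c1%:R ^+ 9 * f%:R.
    by apply: mulr_ge0 => //; apply: mulr_ge0; [apply: mulr_ge0|apply: exprn_ge0].
  apply: le_trans (ler_wpM2l C10 pushP) _.
  have -> : K0 * D1 * c1%:R ^+ 9 * f%:R * (nu%:R ^+ 6 * P) =
     (K0 * f%:R * P) * (D1 * (c1%:R ^+ 9 * nu%:R ^+ 6)) by ring.
  have -> : K0 * K1 * D * c1%:R ^+ 3 * W ^+ 3 * f%:R * P * T%:R ^+ 6 =
     (K0 * f%:R * P) * (D * (K1 * W ^+ 3 * c1%:R ^+ 3 * T%:R ^+ 6)) by ring.
  apply: ler_wpM2l; first by apply: mulr_ge0 => //; apply: mulr_ge0.
  by apply: ler_pM => //; rewrite mulr_ge0 // exprn_ge0.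
(* Passing to [c1] and [d1] loses at most delta^2 in the minimum, which the reduced power [c1 ^ 3]
   pays for. *)
have dd1 : (d <= delta * d1)%N.
  apply: dvdn_leq; first by rewrite muln_gt0 del0 gcdn_gt0 c10 orbT.
  by rewrite /d1 muln_gcdr dvdn_gcd dvdn_mull // -cE.
have hmin : (minn c (d ^ 2) <= delta ^ 2 * minn c1 (d1 ^ 2))%N.
  have h1 : (c <= delta ^ 2 * c1)%N.
    by rewrite {1}cE leq_mul2r -mulnn leq_pmulr // orbT.
  have h2 : (d ^ 2 <= delta ^ 2 * d1 ^ 2)%N by rewrite -expnMn leq_exp2r.
  rewrite /minn; case: (c1 < _)%N; first exact: leq_trans (geq_minl _ _) h1.
  exact: leq_trans (geq_minr _ _) h2.
rewrite KE; apply: (@le_trans _ _ (z * m1 * delta%:R ^+ 2)).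
  rewrite -mulrA; apply: ler_wpM2l => //.
  by rewrite mulrC -natrX -natrM ler_nat.
apply: le_trans (ler_wpM2r (exprn_ge0 2 (ler0n _ _)) main1) _.
have hc : c1%:R ^+ 3 * delta%:R ^+ 2 <= c%:R ^+ 3 :> R.
  rewrite -!natrX -natrM ler_nat cE expnMn mulnC leq_mul2r.
  by rewrite leq_pexp2l // orbT.
have -> : K0 * K1 * D * c1%:R ^+ 3 * W ^+ 3 * f%:R * P * delta%:R ^+ 2 =
   K0 * K1 * D * W ^+ 3 * f%:R * P * (c1%:R ^+ 3 * delta%:R ^+ 2) by ring.
have -> : K0 * K1 * (maxdiv c)%:R ^+ 22 * c%:R ^+ 3 * W ^+ 3 * f%:R * norm2 alpha ^+ 3
   * norm2 beta ^+ 3 = K0 * K1 * D * W ^+ 3 * f%:R * P * c%:R ^+ 3.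
  by rewrite /P /D; ring.
have D0 : 0 <= D by apply: le_trans D1D.
apply: ler_wpM2l => //.
exact: mulr_ge0 (mulr_ge0 (mulr_ge0 (mulr_ge0 (mulr_ge0 K00 K10) D0) (exprn_ge0 _ (ltW W0))) f0) P0.
Qed.

Lemma int_interval_diameter (I : {fset int}) (m m0 : int) :
  int_interval I -> m \in I -> m0 \in I -> (absz (m - m0) < #|` I|)%N.
Proof.
wlog le0 : m m0 / m0 <= m => [W hI mI m0I|].
  have [h|h] := lerP m0 m; first exact: W.
  by rewrite -abszN opprB; apply: W => //; apply: ltW.
move=> hI mI m0I; set k := absz (m - m0).
have -> : k.+1 = size [seq m0 + j%:Z | j <- iota 0 k.+1] by rewrite size_map size_iota.
apply: uniq_leq_size.
  rewrite map_inj_uniq ?iota_uniq // => i j; lia.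
move=> z /mapP[j]; rewrite mem_iota /= add0n ltnS => jk ->.
apply: (hI m0 _ m) => //; rewrite /k in jk; lia.
Qed.

Lemma seq_normE (R : realType) (I : {fset int}) (alpha : int -> R[i]) :
  norm2 (fun x : I => alpha (val x)) = seq_norm I alpha ^+ 2.
Proof.
rewrite /seq_norm sqr_sqrtr; last by apply: sumr_ge0 => m _; apply: nsq_ge0.
by rewrite big_seq_fsetE.
Qed.

Lemma gcdz3_eq1 (m n : int) (c : nat) :
  (gcdz (gcdz m n) c%:Z == 1) = coprime (gcdn (absz m) c) (absz n).
Proof.
by rewrite /gcdz /= eqz_nat /coprime gcdnAC.
Qed.

Lemma sum_by_gcd (R : realType) (c : nat) (I J : {fset int}) (F : int -> int -> R[i]) :
  (0 < c)%N ->
  \sum_(m <- I) \sum_(n <- J | gcdz (gcdz m n) c%:Z == 1) F m n =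
  \sum_(delta <- divisors c) \sum_(x : I | gcdn (absz (val x)) c == delta)
    \sum_(y : J | coprime delta (absz (val y))) F (val x) (val y).
Proof.
move=> c0; rewrite big_seq_fsetE /= [RHS](exchange_big_dep xpredT) //=.
apply: eq_bigr => x _; rewrite big_seq_fsetE /=.
set g := gcdn _ c; have gc : g \in divisors c by rewrite -dvdn_divisors // dvdn_gcdr.
have gE : [seq delta <- divisors c | g == delta] = [:: g].
  rewrite -(filter_pred1_uniq (divisors_uniq c) gc).
  by apply: eq_filter => i; rewrite /= eq_sym.
rewrite -[RHS]big_filter gE.
by rewrite big_seq1; apply: eq_bigl => y; apply: gcdz3_eq1.
Qed.

(** The root is not extracted from [C * D ^+ 22]: a number at least 1 is below its sixth power, and
    this factor is only c^{o(1)}. *)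
Lemma sixth_root_bound (R : realType) (z M f C D T N : R) :
  0 <= z -> 0 < M -> 0 <= f -> 1 <= C -> 1 <= D -> 0 <= T -> 0 <= N ->
  z ^+ 6 * M <= C * D ^+ 22 * T ^+ 6 * f * N ^+ 6 ->
  z <= C * D ^+ 22 * (T * N * (f / M) `^ 6^-1).
Proof.
move=> z0 M0 f0 C1 D1 T0 N0 h.
have C0 : 0 <= C by lra.
have D0 : 0 <= D by lra.
have E1 : 1 <= C * D ^+ 22 by apply: mulr_ege1 => //; apply: exprn_ege1.
have E0 : 0 <= C * D ^+ 22 by lra.
have p0 : 0 <= T * N * (f / M) `^ 6^-1 by rewrite !mulr_ge0 ?powR_ge0.
rewrite -(@ler_pXn2r _ 6) ?nnegrE ?(mulr_ge0 E0 p0) //.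
rewrite [leRHS]exprMn [(T * N * _) ^+ 6]exprMn -[(_ `^ _) ^+ 6]powR_mulrn ?powR_ge0 //.
rewrite -powRrM mulVf ?pnatr_eq0 // powRr1; last by apply: divr_ge0 => //; apply: ltW.
rewrite [X in _ * X]mulrA [leRHS]mulrA ler_pdivlMr //; apply: le_trans h _.
have -> : C * D ^+ 22 * T ^+ 6 * f * N ^+ 6 = C * D ^+ 22 * ((T * N) ^+ 6 * f) by ring.
apply: ler_wpM2r; first by rewrite mulr_ge0 ?exprn_ge0 ?mulr_ge0.
by apply: ler_eXnr.
Qed.

Lemma kloosterman_interval_bound (R : realType) (c d f : nat) (I J : {fset int})
    (alpha beta : int -> R[i]) (a : int) (s : R) :
  (0 < c)%N -> (0 < d)%N -> (d %| c)%N ->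
  (forall k : nat, (k ^ 2 %| c * d)%N -> (k <= f)%N) ->
  int_interval I -> int_interval J -> 1 <= s ->
  #|` I|%:R ^+ 2 <= s ^+ 2 * c%:R -> #|` J|%:R ^+ 2 <= s ^+ 2 * c%:R ->
  coprimez a c%:Z ->
  normc (\sum_(m <- I) \sum_(n <- J | gcdz (gcdz m n) c%:Z == 1)
     alpha m * beta n * kloosterman R (a * m) n c)
  <= piece_constant R * (maxdiv c)%:R ^+ 23 *
     (c%:R * s * (seq_norm I alpha * seq_norm J beta)
      * (f%:R / (minn c (d ^ 2))%:R) `^ 6^-1).
Proof.
move=> c0 d0 dc fmax hI hJ s1 Is Js ac.
rewrite (sum_by_gcd _ _ (fun m n => alpha m * beta n * kloosterman R (a * m) n c) c0).
apply: le_trans (ler_normc_sum _ _ _) _.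
set H := maxn #|` I| #|` J|.
have HW : H%:R ^+ 2 <= s ^+ 2 * c%:R by rewrite /H /maxn; case: ifP.
have cW : c%:R <= s ^+ 2 * c%:R by rewrite ler_peMl // exprn_ege1.
have D1 : 1 <= (maxdiv c)%:R :> R by rewrite ler1n maxdiv_gt0.
have P0 I' (u : int -> R[i]) : 0 <= seq_norm I' u by apply: sqrtr_ge0.
set B := _ * _ * _ * (_ `^ _).
have B0 : 0 <= B.
  by rewrite /B !mulr_ge0 ?powR_ge0 //; lra.
have C1 : 1 <= piece_constant R.
  rewrite /piece_constant; apply: mulr_ege1.
    by apply: mulr_ege1; [rewrite ler1n|apply: exprn_ege1; rewrite (ler1n R 4)].
  apply: mulr_ege1; first by rewrite (ler1n R 729).
  by apply: exprn_ege1; rewrite (ler1n R 1028).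
(* Each gcd contributes at most the same bound, with W = s^2 c; the number of gcds raises 22 to
   23. *)
apply: (@le_trans _ _ (\sum_(delta <- divisors c) piece_constant R * (maxdiv c)%:R ^+ 22 * B)).
  rewrite big_seq [leRHS]big_seq; apply: ler_sum => delta; rewrite -dvdn_divisors // => delc.
  rewrite /B; apply: sixth_root_bound => //.
  - exact: normc_ge0.
  - by rewrite ltr0n leq_min c0 expn_gt0 d0.
  - by apply: mulr_ge0 => //; lra.
  - exact: mulr_ge0.
  have IH (x y : I) : (absz (val x - val y) < H)%N.
    by apply: leq_trans (leq_maxl _ _); apply: int_interval_diameter => //; apply: valP.
  have JH (x y : J) : (absz (val x - val y) < H)%N.
    by apply: leq_trans (leq_maxr _ _); apply: int_interval_diameter => //; apply: valP.
  have := @gcd_piece_bound R I J val val (fun x => alpha (val x)) (fun y => beta (val y))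
    a c d f delta H _ c0 dc fmax ac val_inj val_inj IH JH delc HW cW.
  rewrite !seq_normE => h; apply: le_trans h _; rewrite le_eqVlt; apply/orP; left; apply/eqP.
  move: (piece_constant R) (maxdiv c)%:R => K D; ring.
rewrite big_const_seq count_predT iter_addr_0 -[leLHS]mulr_natl.
have -> : piece_constant R * (maxdiv c)%:R ^+ 23 * B =
    (maxdiv c)%:R * (piece_constant R * (maxdiv c)%:R ^+ 22 * B).
  by move: (piece_constant R) (maxdiv c)%:R => K D; ring.
apply: ler_wpM2r; last by rewrite ler_nat maxdivP.
exact: mulr_ge0 (mulr_ge0 (le_trans ler01 C1) (exprn_ge0 _ (le_trans ler01 D1))) B0.
Qed.

(** * From the divisor function to exponents tending to 0 *)

Lemma ln_maxdiv_bound (R : realType) (k : nat) : (0 < k)%N -> exists C : nat,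
  forall c : nat, (0 < c)%N -> (C <= c)%N ->
  `|ln (maxdiv c)%:R / ln c%:R| <= 2 / k%:R :> R.
Proof.
move=> k0; have [C hC] := maxdiv_bound k0; exists C => c c0 Cc.
have D0 := maxdiv_gt0 c0; have kR : 0 < k%:R :> R by rewrite ltr0n.
have [c1|c1] := leqP c 1.
  have -> : c = 1%N by lia.
  by rewrite ln1 invr0 mulr0 normr0 divr_ge0 ?ler0n.
have lc : 0 < ln c%:R :> R by rewrite ln_gt0 // ltr1n.
rewrite ger0_norm; last by rewrite divr_ge0 ?ln_ge0 ?ler1n.
rewrite ler_pdivrMr // mulrAC ler_pdivlMr //.
(* Beyond [C] the constant of the divisor bound is absorbed into a second factor c, whence the 2 in
   2 / k. *)
have h : (maxdiv c)%:R ^+ k <= c%:R ^+ 2 :> R.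
  rewrite -!natrX ler_nat; apply: leq_trans (hC c c0) _.
  by rewrite -mulnn leq_mul2r Cc orbT.
rewrite mulr_natr -lnXn ?ltr0n // mulr_natl -lnXn ?ltr0n //.
by rewrite ler_ln ?posrE ?exprn_gt0 ?ltr0n.
Qed.

Lemma ln_maxdiv_cvg0 (R : realType) :
  ((fun c : nat => ln (maxdiv c)%:R / ln c%:R : R) @ \oo --> (0 : R))%classic.
Proof.
apply/cvgrPdist_le => eps eps0.
have [k hk] : exists k : nat, 2 / eps <= k.+1%:R.
  exists (Num.truncn (2 / eps)).
  by apply/ltW/truncnS_gt.
have [C hC] := @ln_maxdiv_bound R k.+1 isT.
exists (maxn C 1) => // c /=; rewrite geq_max => /andP[Cc c0].
rewrite sub0r normrN; apply: le_trans (hC c c0 Cc) _.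
by rewrite ler_pdivrMr ?ltr0n // mulrC -ler_pdivrMr.
Qed.

Lemma o1_exponent_cvg (R : realType) (eta : nat -> R) :
  (eta @ \oo --> (0 : R))%classic -> o1_exponent eta.
Proof.
move=> h; split=> //.
have /cvg_seq_bounded : cvgn eta by apply/cvg_ex; exists 0.
case=> M [_ hM]; exists (M + 1) => c; apply: hM => //; lra.
Qed.

Lemma o1_exponent_maxdiv (R : realType) (eta0 : nat -> R) : o1_exponent eta0 ->
  o1_exponent (fun c => 23 * (ln (maxdiv c)%:R / ln c%:R) + `|eta0 c|).
Proof.
move=> [_ h0]; apply: o1_exponent_cvg.
have h : ((fun c => 23 * (ln (maxdiv c)%:R / ln c%:R) + `|eta0 c|) @ \oo
    --> 23 * 0 + `|0 : R|)%classic.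
  apply: cvgD; last exact: cvg_norm.
  by apply: cvgM; [exact: cvg_cst|exact: ln_maxdiv_cvg0].
by rewrite mulr0 normr0 addr0 in h.
Qed.

Lemma powR_maxdiv (R : realType) (c : nat) (t : R) : (0 < c)%N ->
  c%:R `^ (1 + (23 * (ln (maxdiv c)%:R / ln c%:R) + t)) =
  c%:R * (maxdiv c)%:R ^+ 23 * c%:R `^ t.
Proof.
move=> c0; have cn : c%:R != 0 :> R by rewrite pnatr_eq0 -lt0n.
rewrite powRD ?cn ?implybT // powRr1 // powRD ?cn ?implybT // mulrA.
congr (_ * _ * _); rewrite mulrC powRrM -[23]/(23%:R) powR_mulrn ?powR_ge0 //.
(* At c = 1 the logarithm in the denominator vanishes, but both sides are 1. *)
congr (_ ^+ _); have [c1|c1] := leqP c 1.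
  have -> : c = 1%N by lia.
  rewrite powR1 /maxdiv !big_ord_recr big_ord0 /=.
  by [].
rewrite /powR (negPf cn) mulfVK ?lnK ?posrE ?ltr0n ?maxdiv_gt0 //.
by rewrite gt_eqF // ln_gt0 // ltr1n.
Qed.

Theorem theorem1p2 (R : realType) (A : R) (eta0 : nat -> R) :
  o1_exponent eta0 ->
  exists (K : R) (eta : nat -> R), o1_exponent eta /\
  forall (c d d' e0 f : nat) (I J : {fset int}) (alpha beta : int -> R[i])
    (a : int),
  (0 < d)%N -> (0 < d')%N -> (0 < e0)%N ->
  c = (d * d' * e0)%N -> (d' %| d)%N -> coprime d e0 ->
  largest_square_divisor f (c * d) ->
  int_interval I -> int_interval J ->
  #|` I|%:R <= A * c%:R `^ (2^-1 + eta0 c) ->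
  #|` J|%:R <= A * c%:R `^ (2^-1 + eta0 c) ->
  coprimez a c ->
  ComplexField.Normc.normc
    (\sum_(m <- I) \sum_(n <- J | gcdz (gcdz m n) c == 1)
       alpha m * beta n * kloosterman R (a * m) n c)
  <= K * (seq_norm I alpha * seq_norm J beta * c%:R `^ (1 + eta c) *
          (f%:R / (minn c (d ^ 2))%:R) `^ 6^-1).
Proof.
(* Using max(1, A) and |eta0| makes the slack s = [A' * p] at least 1. The slack enters the bound to
   the first power, so the constant is linear in [A'] and the exponent gains |eta0| beside the 23
   divisor functions. *)
move=> o0; set A' := Num.max 1 A.
exists (piece_constant R * A'), (fun c => 23 * (ln (maxdiv c)%:R / ln c%:R) + `|eta0 c|).
split; first exact: o1_exponent_maxdiv.
move=> c d d' e0 f I J alpha beta a d0 d'0 e00 cE _ _ [_ fmax] hI hJ Ic Jc ac.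
have c0 : (0 < c)%N by rewrite cE !muln_gt0 d0 d'0.
have dc : (d %| c)%N by rewrite cE -mulnA dvdn_mulr.
have c1 : 1 <= c%:R :> R by rewrite ler1n.
have A1 : 1 <= A' by rewrite le_max lexx.
set p := c%:R `^ `|eta0 c| : R.
have p1 : 1 <= p by rewrite -(powRr0 c%:R) ler_powR.
have width (L : {fset int}) : #|` L|%:R <= A * c%:R `^ (2^-1 + eta0 c) ->
    #|` L|%:R ^+ 2 <= (A' * p) ^+ 2 * c%:R.
  move=> hL; have -> : c%:R = (c%:R `^ 2^-1) ^+ 2 :> R.
    by rewrite -powR_mulrn ?powR_ge0 // -powRrM mulVf ?pnatr_eq0 // powRr1.
  rewrite -exprMn; apply: lerXn2r; rewrite ?nnegrE ?mulr_ge0 ?powR_ge0 //; try lra.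
  apply: le_trans hL _; apply: (@le_trans _ _ (A' * c%:R `^ (2^-1 + eta0 c))).
    by apply: ler_wpM2r; [exact: powR_ge0|rewrite le_max lexx orbT].
  rewrite -mulrA; apply: ler_wpM2l; first by lra.
  rewrite mulrC /p -powRD ?pnatr_eq0 -?lt0n ?c0 ?implybT //.
  by apply: ler_powR => //; rewrite lerD2l ler_norm.
have s1 : 1 <= A' * p by apply: mulr_ege1.
apply: le_trans (kloosterman_interval_bound alpha beta c0 d0 dc fmax hI hJ s1
  (width I Ic) (width J Jc) ac) _.
rewrite powR_maxdiv // -/p; rewrite le_eqVlt; apply/orP; left; apply/eqP.
move: (piece_constant R) (maxdiv c)%:R => K D; ring.
Qed.
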